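(* Let $0\le\rho\le1$, $\omega\in\mathscr P_{\mathrm{Sh},\rho}(\mathbf R^{2d})$, $a\in\widehat{\mathcal A}{}^{(\omega)}_{\mathrm{Sh},\rho}(\mathbf C^{2d})$, and let $$a_\alpha(w)=\partial_z^\alpha\overline\partial_w^\alpha a(w,w),\quad\alpha\in\mathbf N^d,$$ $$b_\alpha(z,w)=|\alpha|\int_0^1(1-t)^{|\alpha|-1}\,\partial_z^\alpha\overline\partial_w^\alpha a(w+t(z-w),w)\,dt,\quad\alpha\in\mathbf N^d\setminus0.$$ Then for every $\alpha\in\mathbf N^d\setminus0$ there is a unique $c_{1,\alpha}\in\widehat A(\mathbf C^{2d})$ such that $\mathrm{Op}_{\mathfrak V}(b_\alpha)=\mathrm{Op}_{\mathfrak V}(c_{1,\alpha})$. Moreover, $$|\partial_w^\beta\overline\partial_w^\gamma a_\alpha(w)|\lesssim\omega(\sqrt2\,\overline w)\langle w\rangle^{-\rho(2|\alpha|+|\beta+\gamma|)},\quad\alpha,\beta,\gamma\in\mathbf N^d,$$ and, for every $N\ge0$, $$|\partial_z^\beta\overline\partial_w^\gamma c_{1,\alpha}(z,w)|\lesssim e^{\frac12|z-w|^2}\omega(\sqrt2\,\overline z)\langle z+w\rangle^{-\rho(2|\alpha|+|\beta+\gamma|)}\langle z-w\rangle^{-N},\quad\alpha\in\mathbf N^d\setminus0,\ \beta,\gamma\in\mathbf N^d.$$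
   Context: Notation: $\langle x\rangle=(1+|x|^2)^{1/2}$, also for complex vectors; $(z,w)=\sum_jz_j\overline{w_j}$; $\mathbf C^d\simeq\mathbf R^{2d}$ via $x+i\xi\leftrightarrow(x,\xi)$, so $\omega(x+i\xi)=\omega(x,\xi)$; $d\lambda$ is Lebesgue measure; $\partial_z,\overline\partial_w$ are Wirtinger derivatives with multi-index powers, and $\partial_z^\alpha\overline\partial_w^\alpha a(u,v)$ means differentiate $a(z,w)$, then evaluate at $(u,v)$. $\lesssim$: inequality up to a constant independent of $z,w\in\mathbf C^d$ (possibly depending on multi-indices and $N$). $\mathscr P(\mathbf R^n)$ is the set of positive $\omega$ with $\omega,1/\omega\in L^\infty_{loc}$ and $\omega(x+y)\le C\omega(x)\langle y\rangle^s$ for some $C\ge1,s\ge0$. For $\rho\in[0,1]$, $\mathscr P_{\mathrm{Sh},\rho}(\mathbf R^n)$ is the set of $\omega\in\mathscr P(\mathbf R^n)\cap C^\infty$ with $|\partial^\alpha\omega(x)|\lesssim\omega(x)\langle x\rangle^{-\rho|\alpha|}$ for all $\alpha$. $\widehat A(\mathbf C^{2d})$ is the set of $a(z,w)$ such that $(z,w)\mapsto a(z,\overline w)$ is entire on $\mathbf C^{2d}$. $\widehat{\mathcal A}{}^{(\omega)}_{\mathrm{Sh},\rho}(\mathbf C^{2d})$ is the set of $a\in\widehat A(\mathbf C^{2d})$ such that for all $\alpha,\beta\in\mathbf N^d$ and $N\ge0$, $|\partial_z^\alpha\overline\partial_w^\beta a(z,w)|\lesssim e^{\frac12|z-w|^2}\omega(\sqrt2\,\overline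 z)\langle z+w\rangle^{-\rho|\alpha+\beta|}\langle z-w\rangle^{-N}$. For a symbol $a(z,w)$ entire in $z$ for which the integral converges absolutely locally uniformly in $z$, the Wick operator is $\mathrm{Op}_{\mathfrak V}(a)F(z)=\pi^{-d}\int_{\mathbf C^d}a(z,w)F(w)e^{(z-w,w)}d\lambda(w)$, acting on the space $\mathcal A_{\flat_1}(\mathbf C^d)$ of entire $F$ with $|F(z)|\lesssim e^{r|z|}$ for some $r>0$, with values in the entire functions. For general $a\in\widehat A(\mathbf C^{2d})$ it is defined by the unique continuous extension: $\mathrm{Op}_{\mathfrak V}(a)F(z)=\sum_\alpha F_\alpha k_\alpha(z)$ where $F(w)=\sum_\alpha F_\alpha w^\alpha$ and $a(z,w)e^{(z,w)}=\sum_\alpha k_\alpha(z)\overline w^\alpha/\alpha!$. *)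

(* Defs.v *)
From HB Require Import structures.
From mathcomp Require Import all_boot all_order all_algebra finmap.
From mathcomp Require Import all_classical all_reals all_analysis.
From mathcomp.analysis.showcase Require Import summability.
From mathcomp.real_closed Require Import complex.

Set Implicit Arguments.
Unset Strict Implicit.
Unset Printing Implicit Defensive.

Import Order.TTheory GRing.Theory Num.Theory.
Import numFieldNormedType.Exports.

Local Open Scope classical_set_scope.
Local Open Scope ring_scope.
Local Open Scope complex_scope.

(* The topology of R[i] is the one given by its modulus, as for any
   numFieldType; `differentiable` between spaces over R[i] is then complex
   (Frechet) differentiability. *)
HB.instance Definition _ (R : realType) := NormedModule.copy R[i] (R[i])^o.

Section Euclidean.
Context {R : realType}.

Definition cabs (x : R[i]) : R := Normc.normc x.

Definition enorm n (x : 'rV[R]_n) : R := Num.sqrt (\sum_j x 0 j ^+ 2).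
Definition cnorm n (z : 'rV[R[i]]_n) : R :=
  Num.sqrt (\sum_j cabs (z 0 j) ^+ 2).

Definition bracket n (x : 'rV[R]_n) : R := Num.sqrt (1 + enorm x ^+ 2).
Definition cbracket n (z : 'rV[R[i]]_n) : R := Num.sqrt (1 + cnorm z ^+ 2).

Definition cconj n (z : 'rV[R[i]]_n) : 'rV[R[i]]_n := map_mx (@conjc R) z.

(* (z, w), linear in z and antilinear in w *)
Definition cdot n (z w : 'rV[R[i]]_n) : R[i] := \sum_j z 0 j * conjc (w 0 j).

Definition cexp (x : R[i]) : R[i] :=
  (expR (complex.Re x))%:C * (cos (complex.Im x) +i* sin (complex.Im x)).

(* C^d ~ R^(2d), x + i xi <-> (x, xi) *)
Definition to_real d (z : 'rV[R[i]]_d) : 'rV[R]_(d + d) :=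
  row_mx (map_mx (@complex.Re R) z) (map_mx (@complex.Im R) z).
Definition of_real d (x : 'rV[R]_(d + d)) : 'rV[R[i]]_d :=
  \row_j (x 0 (lshift d j) +i* x 0 (rshift d j)).

End Euclidean.

Section Lebesgue.
Context {R : realType}.

Definition cons_tuple_pair n (p : R * n.-tuple R) : n.+1.-tuple R :=
  [tuple of p.1 :: p.2].

Lemma measurable_cons_tuple_pair n :
  measurable_fun [set: R * n.-tuple R] (@cons_tuple_pair n).
Proof. exact: measurable_cons. Qed.

Section step.
Context n (mu : {sigma_finite_measure set (n.-tuple R) -> \bar R}).

Definition lebesgue_cons : set (n.+1.-tuple R) -> \bar R :=
  pushforward (lebesgue_measure \x mu)%E (@cons_tuple_pair n).

Let lebesgue_cons0 : lebesgue_cons set0 = 0%E.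
Proof. by rewrite /lebesgue_cons /pushforward preimage_set0 measure0. Qed.

Let lebesgue_cons_ge0 A : (0 <= lebesgue_cons A)%E.
Proof. by apply: integral_ge0 => x _; exact: measure_ge0. Qed.

Let lebesgue_cons_sigma_additive : semi_sigma_additive lebesgue_cons.
Proof.
have mcons (A : set (n.+1.-tuple R)) :
    measurable A -> measurable (@cons_tuple_pair n @^-1` A).
  move=> mA; rewrite -[X in measurable X]setTI.
  exact: measurable_cons_tuple_pair.
move=> F mF tF mUF; rewrite /lebesgue_cons /pushforward preimage_bigcup.
apply: measure_semi_sigma_additive.
- by move=> k; exact: mcons.
- apply/trivIsetP => /= i j _ _ ij; rewrite -preimage_setI.
  by move/trivIsetP : tF => /(_ _ _ _ _ ij) ->//; rewrite preimage_set0.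
- by rewrite -preimage_bigcup; exact: mcons.
Qed.

HB.instance Definition _ := isMeasure.Build _ _ _ lebesgue_cons
  lebesgue_cons0 lebesgue_cons_ge0 lebesgue_cons_sigma_additive.

Let lebesgue_cons_sigma_finite : sigma_finite setT lebesgue_cons.
Proof.
have /sigma_finiteP[F [TF ndF Foo]] := sigma_finiteT (@lebesgue_measure R).
have /sigma_finiteP[G [TG ndG Goo]] := sigma_finiteT mu.
exists (fun k => (@thead _ _ @^-1` F k) `&`
                 ((fun t : n.+1.-tuple R => [tuple of behead t]) @^-1` G k)) => [|k].
  rewrite predeqE => t; split=> // _.
  have [p _ Fp] : (\bigcup_k F k) (thead t) by rewrite -TF.
  have [q _ Gq] : (\bigcup_k G k) [tuple of behead t] by rewrite -TG.
  exists (maxn p q) => //; split.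
    by have /subsetPset := ndF _ _ (leq_maxl p q); apply.
  by have /subsetPset := ndG _ _ (leq_maxr p q); apply.
have [mF Fk] := Foo k; have [mG Gk] := Goo k; split.
  apply: measurableI; rewrite -[X in measurable X]setTI.
    exact: measurable_tnth.
  exact: measurable_behead.
rewrite /lebesgue_cons /pushforward.
rewrite (_ : _ @^-1` _ = F k `*` G k); last first.
  rewrite predeqE => -[x t] /=; rewrite theadE.
  suff -> : [tuple of behead (cons_tuple_pair (x, t))] = t :> n.-tuple R by [].
  exact: val_inj.
by rewrite product_measure1E// lte_mul_pinfty// ge0_fin_numE.
Qed.

HB.instance Definition _ :=
  Measure_isSigmaFinite.Build _ _ _ lebesgue_cons lebesgue_cons_sigma_finite.
End step.

(* Lebesgue measure on the Borel sets of R^n, as an iterated product measure *)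
Fixpoint lebesgue_tuple n : {sigma_finite_measure set (n.-tuple R) -> \bar R} :=
  match n with
  | 0 => dirac ([tuple] : 0.-tuple R)
  | m.+1 => lebesgue_cons (lebesgue_tuple m)
  end.

Definition rV_of_tuple n (t : n.-tuple R) : 'rV[R]_n := \row_j tnth t j.

(* The point of C^d with coordinates t in R^(2d); dlambda on C^d is
   lebesgue_tuple transported by it. *)
Definition cV_of_tuple d (t : (d + d).-tuple R) : 'rV[R[i]]_d :=
  of_real (rV_of_tuple t).

Definition cintegrable {disp} {T : measurableType disp}
    (mu : {measure set T -> \bar R}) (D : set T) (f : T -> R[i]) : Prop :=
  mu.-integrable D (fun t => (complex.Re (f t))%:E) /\
  mu.-integrable D (fun t => (complex.Im (f t))%:E).

Definition cintegral {disp} {T : measurableType disp}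
    (mu : {measure set T -> \bar R}) (D : set T) (f : T -> R[i]) : R[i] :=
  (\int[mu]_(t in D) complex.Re (f t))%R +i*
  (\int[mu]_(t in D) complex.Im (f t))%R.

End Lebesgue.

Definition mindex (d : nat) := {ffun 'I_d -> nat}.

Section MultiIndex.
Context {d : nat}.

Definition mlen (alpha : mindex d) : nat := (\sum_j alpha j)%N.
Definition mfact (alpha : mindex d) : nat := (\prod_j (alpha j)`!)%N.

Definition mpow {R : realType} (z : 'rV[R[i]]_d) (alpha : mindex d) : R[i] :=
  \prod_j z 0 j ^+ alpha j.

(* D^alpha = D_0^(alpha 0) ... D_(d-1)^(alpha (d-1)) for operators D_j on T *)
Definition miter {T : Type} (D : 'I_d -> T -> T) (alpha : mindex d) (f : T) : T :=
  foldr (fun j g => iter (alpha j) (D j) g) f (enum 'I_d).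

End MultiIndex.

Section RealSymbols.
Context {R : realType} {n : nat}.
Implicit Type f : 'rV[R]_n -> R.

Definition partial (j : 'I_n) f : 'rV[R]_n -> R :=
  fun x => 'D_(delta_mx 0 j) f x.

Definition smooth f : Prop := forall l : seq 'I_n,
  let g := foldr partial f l in
  continuous g /\ forall j x, derivable g x (delta_mx 0 j).

Definition Linfty_loc f : Prop :=
  measurable_fun setT (f \o @rV_of_tuple R n) /\
  forall K : set 'rV[R]_n, compact K -> exists M : R,
    {ae lebesgue_tuple n, forall t,
      K (rV_of_tuple t) -> `|f (rV_of_tuple t)| <= M}.

Definition moderate_weight f : Prop :=
  [/\ forall x, 0 < f x, Linfty_loc f, Linfty_loc (fun x => (f x)^-1) &
    exists C s : R, [/\ 1 <= C, 0 <= s &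
      forall x y, f (x + y) <= C * f x * bracket y `^ s]].

Definition Shubin_weight (rho : R) f : Prop :=
  [/\ moderate_weight f, smooth f &
    forall alpha : mindex n, exists C : R, forall x,
      `|miter partial alpha f x| <=
        C * f x * bracket x `^ (- (rho * (mlen alpha)%:R))].

End RealSymbols.

Section Wirtinger.
Context {R : realType} {d : nat}.
Implicit Type f : 'rV[R[i]]_d -> R[i].

Definition dir_derive f (v z : 'rV[R[i]]_d) : R[i] :=
  derive1 (fun t : R => complex.Re (f (z + t%:C *: v))) 0 +i*
  derive1 (fun t : R => complex.Im (f (z + t%:C *: v))) 0.

Definition dz (j : 'I_d) f : 'rV[R[i]]_d -> R[i] := fun z =>
  2^-1 * (dir_derive f (delta_mx 0 j) z
          - 'i%C * dir_derive f ('i%C *: delta_mx 0 j) z).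

Definition dzbar (j : 'I_d) f : 'rV[R[i]]_d -> R[i] := fun z =>
  2^-1 * (dir_derive f (delta_mx 0 j) z
          + 'i%C * dir_derive f ('i%C *: delta_mx 0 j) z).

Definition dz_dwbar (alpha beta : mindex d)
    (a : 'rV[R[i]]_d -> 'rV[R[i]]_d -> R[i]) :
    'rV[R[i]]_d -> 'rV[R[i]]_d -> R[i] :=
  fun z w => miter dz alpha (fun z' => miter dzbar beta (a z') w) z.

End Wirtinger.

Section Wick.
Context {R : realType} {d : nat}.
Local Notation Cd := 'rV[R[i]]_d.

Definition entire n (f : 'rV[R[i]]_n -> R[i]) : Prop :=
  forall z, differentiable f z.

Definition Ahat (a : Cd -> Cd -> R[i]) : Prop :=
  entire (fun x : 'rV[R[i]]_(d + d) => a (lsubmx x) (cconj (rsubmx x))).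

Definition Wick_bound (rho : R) (om : 'rV[R]_(d + d) -> R) (m : nat)
    (g : Cd -> Cd -> R[i]) : Prop :=
  forall N : R, 0 <= N -> exists C : R, forall z w,
    cabs (g z w) <=
      C * expR (2^-1 * cnorm (z - w) ^+ 2)
        * om (to_real ((Num.sqrt 2)%:C *: cconj z))
        * cbracket (z + w) `^ (- (rho * m%:R)) * cbracket (z - w) `^ (- N).

Definition Ahat_Sh (rho : R) (om : 'rV[R]_(d + d) -> R)
    (a : Cd -> Cd -> R[i]) : Prop :=
  Ahat a /\ forall alpha beta : mindex d,
    Wick_bound rho om (mlen (alpha + beta)) (dz_dwbar alpha beta a).

Definition Aflat1 (F : Cd -> R[i]) : Prop :=
  entire F /\ exists r C : R, 0 < r /\
    forall z, cabs (F z) <= C * expR (r * cnorm z).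

Definition Wick_integrand (a : Cd -> Cd -> R[i]) (F : Cd -> R[i]) (z w : Cd) :
    R[i] :=
  a z w * F w * cexp (cdot (z - w) w).

(* Absolute convergence of the integral over w, with tails that are uniformly
   small for z in compact sets. *)
Definition Wick_converges (a : Cd -> Cd -> R[i]) (F : Cd -> R[i]) : Prop :=
  (forall z, cintegrable (lebesgue_tuple (d + d)) setT
     (fun t => Wick_integrand a F z (cV_of_tuple t))) /\
  forall K : set Cd, compact K -> forall e : R, 0 < e -> exists r : R,
    forall z, K z ->
      (\int[lebesgue_tuple (d + d)]_(t in [set t | (r < cnorm (cV_of_tuple t))%R])
         (cabs (Wick_integrand a F z (cV_of_tuple t)))%:E <= e%:E)%E.

(* symbols for which Op(a) is defined on A_{flat_1} by the integral formula *)
Definition Wick_symbol (a : Cd -> Cd -> R[i]) : Prop :=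
  (forall w, entire (a ^~ w)) /\ forall F, Aflat1 F -> Wick_converges a F.

Definition Op_int (a : Cd -> Cd -> R[i]) (F : Cd -> R[i]) : Cd -> R[i] :=
  fun z => (pi ^- d)%:C *
    cintegral (lebesgue_tuple (d + d)) setT
      (fun t => Wick_integrand a F z (cV_of_tuple t)).

(* unconditional sum over all multi-indices *)
Definition msum_is (u : mindex d -> R[i]) (s : R[i]) : Prop :=
  partial_sum u @ totally --> s.

(* G = Op(a) F for a in hat A(C^(2d)), where F = sum_alpha F_alpha w^alpha and
   a(z,w) e^(z,w) = sum_alpha k_alpha(z) wbar^alpha / alpha!.  The F_alpha and
   k_alpha are determined by F and a. *)
Definition Op_ext (a : Cd -> Cd -> R[i]) (F G : Cd -> R[i]) : Prop :=
  exists (Fc : mindex d -> R[i]) (k : mindex d -> Cd -> R[i]),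
    [/\ forall w, msum_is (fun alpha => Fc alpha * mpow w alpha) (F w),
        forall z w,
          msum_is (fun alpha =>
              k alpha z * mpow (cconj w) alpha / (mfact alpha)%:R)
            (a z w * cexp (cdot z w)) &
        forall z, msum_is (fun alpha => Fc alpha * k alpha z) (G z)].

(* Op(b) = Op(c) on A_{flat_1}, b being given by the integral formula and c by
   the extension to hat A(C^(2d)) *)
Definition Op_eq (b c : Cd -> Cd -> R[i]) : Prop :=
  forall F, Aflat1 F -> Op_ext c F (Op_int b F).

Definition diag_symbol (a : Cd -> Cd -> R[i]) (alpha : mindex d) (w : Cd) :
    R[i] :=
  dz_dwbar alpha alpha a w w.

Definition remainder_symbol (a : Cd -> Cd -> R[i]) (alpha : mindex d)
    (z w : Cd) : R[i] :=
  (mlen alpha)%:R *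
  cintegral lebesgue_measure `[0 : R, 1]
    (fun t : R => ((1 - t) ^+ (mlen alpha).-1)%:C
                  * dz_dwbar alpha alpha a (w + t%:C *: (z - w)) w).

End Wick.

(* Main.v *)
(* Write g for d_z^alpha dbar_w^alpha a, k = |alpha|, and b for the remainder
   symbol b(z, u) = k int_0^1 (1 - t)^(k - 1) g(u + t(z - u), u) dt.  Since
   c(z, w) e^((z, w)) has to be the value of Op(b) at the function e^((., w)),
   the symbol c can only be
     c(z, w) = pi^(-d) int b(z, u) e^((z - u, u - w)) du.
   Let p = z - u and q = u - w.  The growth e^(t^2 |p|^2 / 2) of g at
   (u + t p, u) is at most e^(|p|^2 / 2), and
   |p|^2 / 2 + Re (p, q) = |z - w|^2 / 2 - |q|^2 / 2, so the kernel is bounded by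
   e^(|z - w|^2 / 2) e^(-|q|^2 / 2) times weights and brackets; moving these from
   (u + t p, u) to (z, w) costs powers of <q>, absorbed by the Gaussian, and
   powers of <p>, absorbed by a large power of <t p> and e^((1 - t^2) |p|^2 / 2).
   By translation invariance in u the derivatives of c are obtained by replacing
   g by its derivatives, so they obey the same bounds.

   Expanding e^((u, w)) in powers of conj w, and F in its Taylor series, under
   the integral sign gives Op(b) = Op(c).  Conversely Op(c') = Op(b) on the
   monomials determines the coefficients of c'(z, w) e^((z, w)), hence c'.

   The bounds for a_alpha hold because the Wirtinger derivatives of
   w |-> f(w, w) are the diagonal values of those of f. *)

From HB Require Import structures.
Require Import Defs.
From mathcomp Require Import all_boot all_order all_algebra finmap.
From mathcomp Require Import all_classical all_reals all_analysis measurable_realfun.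
From mathcomp.analysis.showcase Require Import summability.
From mathcomp.real_closed Require Import complex.
From mathcomp Require Import ring lra zify.

Set Implicit Arguments.
Unset Strict Implicit.
Unset Printing Implicit Defensive.

Import Order.TTheory GRing.Theory Num.Theory.
Import numFieldNormedType.Exports.

Local Open Scope classical_set_scope.
Local Open Scope ring_scope.
Local Open Scope complex_scope.

(** Entire means complex differentiable at each point, nothing more, so all regularity of the kernel
    rests on Cauchy's formula, used in quantitative form: a bound of [f] on the unit ball around [x]
    bounds the derivative at [x] and yields a quadratic remainder. Such remainders survive
    integration, so a dominated integral of entire functions is entire and is differentiated under
    the sign. Conjugates disappear by taking [conj w] and [conj u] as independent variables: a
    symbol becomes an entire function on [C^(2d)], and the Wirtinger derivatives become its
    directional derivatives. Differentiating the kernel in [z] or [w] would hit the phase and bring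
    factors [t] out of the segment integral. A common shift [xi] of [z], [w] and [u] acts on [g]
    alone; it reaches only the diagonal [(xi, conj xi)], but [dz] and [dzbar] in [xi] still separate
    the two families of derivatives. [Op_ext] asserts only that some coefficients exist, so
    uniqueness of [c] requires that of the coefficients of unconditionally convergent power series,
    proved from values at small positive points; it also makes Taylor coefficients independent of
    the radius. *)

Arguments cabs : simpl never.
Arguments cexp : simpl never.
Arguments cnorm : simpl never.
Arguments cintegral : simpl never.

(** * Complex numbers *)

Section ComplexModulus.
Context {R : realType}.
Local Notation C := R[i].
Implicit Types (x y z : C).

Lemma normCE x : `|x| = (cabs x)%:C.
Proof. by []. Qed.

Lemma cabs_ge0 x : 0 <= cabs x.
Proof. by rewrite -ler0c -normCE. Qed.

Lemma cabsM x y : cabs (x * y) = cabs x * cabs y.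
Proof. exact: Normc.normcM. Qed.

Lemma cabsV x : cabs x^-1 = (cabs x)^-1.
Proof. exact: Normc.normcV. Qed.

Lemma cabsD x y : cabs (x + y) <= cabs x + cabs y.
Proof. exact: le_normcD. Qed.

Lemma cabsN x : cabs (- x) = cabs x.
Proof. exact: normcN. Qed.

Lemma cabsB x y : cabs (x - y) <= cabs x + cabs y.
Proof. by rewrite -(cabsN y) cabsD. Qed.

Lemma cabs_distC x y : cabs (x - y) = cabs (y - x).
Proof. by rewrite -cabsN opprB. Qed.

Lemma cabs0 : cabs (0 : C) = 0.
Proof. exact: Normc.normc0. Qed.

Lemma cabs1 : cabs (1 : C) = 1.
Proof. exact: Normc.normc1. Qed.

Lemma cabs_eq0 x : (cabs x == 0) = (x == 0).
Proof.
by apply/eqP/eqP => [/Normc.eq0_normc//|->]; exact: cabs0.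
Qed.

Lemma cabs_gt0 x : (0 < cabs x) = (x != 0).
Proof. by rewrite lt_def cabs_ge0 andbT cabs_eq0. Qed.

Lemma cabsR (r : R) : cabs r%:C = `|r|.
Proof. by rewrite /cabs /= expr0n /= addr0 sqrtr_sqr. Qed.

Lemma cabs_nat n : cabs (n%:R : C) = n%:R.
Proof.
by rewrite -(rmorph_nat (real_complex R)) cabsR ger0_norm ?ler0n.
Qed.

Lemma cabsX x n : cabs (x ^+ n) = cabs x ^+ n.
Proof.
by elim: n => [|n IH]; rewrite ?expr0 ?cabs1// !exprS cabsM IH.
Qed.

Lemma cabs_prod I (r : seq I) (P : pred I) (F : I -> C) :
  cabs (\prod_(i <- r | P i) F i) = \prod_(i <- r | P i) cabs (F i).
Proof.
by apply: (big_morph _ cabsM); exact: cabs1.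
Qed.

Lemma cabs_sum I (r : seq I) (P : pred I) (F : I -> C) :
  cabs (\sum_(i <- r | P i) F i) <= \sum_(i <- r | P i) cabs (F i).
Proof.
elim/big_ind2 : _ => //; first by rewrite cabs0.
by move=> x1 x2 y1 y2 h1 h2; apply: (le_trans (cabsD _ _)); exact: lerD.
Qed.

Lemma cabs_sqr x : cabs x ^+ 2 = complex.Re x ^+ 2 + complex.Im x ^+ 2.
Proof.
case: x => a b; rewrite /cabs /= sqr_sqrtr// addr_ge0// ?sqr_ge0//.
Qed.

Lemma cabs_conj x : cabs (conjc x) = cabs x.
Proof. by case: x => a b; rewrite /cabs /= sqrrN. Qed.

Lemma Re_le_cabs x : `|complex.Re x| <= cabs x.
Proof.
rewrite -(ler_pXn2r (ltn0Sn 1)) ?nnegrE ?cabs_ge0// cabs_sqr.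
by rewrite real_normK ?num_real// lerDl sqr_ge0.
Qed.

Lemma Im_le_cabs x : `|complex.Im x| <= cabs x.
Proof.
rewrite -(ler_pXn2r (ltn0Sn 1)) ?nnegrE ?cabs_ge0// cabs_sqr.
by rewrite real_normK ?num_real// lerDr sqr_ge0.
Qed.

Lemma cabs_le_ReIm x : cabs x <= `|complex.Re x| + `|complex.Im x|.
Proof.
rewrite {1}(complexE x); apply: (le_trans (cabsD _ _)).
rewrite cabsM !cabsR.
have -> : cabs ('i%C : C) = 1 by rewrite /cabs /= expr0n expr1n add0r sqrtr1.
by rewrite mul1r.
Qed.

Lemma RecD x y : complex.Re (x + y) = complex.Re x + complex.Re y.
Proof. by case: x; case: y. Qed.
Lemma ImcD x y : complex.Im (x + y) = complex.Im x + complex.Im y.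
Proof. by case: x; case: y. Qed.
Lemma RecN x : complex.Re (- x) = - complex.Re x.
Proof. by case: x. Qed.
Lemma ImcN x : complex.Im (- x) = - complex.Im x.
Proof. by case: x. Qed.
Lemma RecM x y : complex.Re (x * y) =
  complex.Re x * complex.Re y - complex.Im x * complex.Im y.
Proof. by case: x; case: y. Qed.
Lemma ImcM x y : complex.Im (x * y) =
  complex.Re x * complex.Im y + complex.Im x * complex.Re y.
Proof. by case: x => a b; case: y => c d. Qed.

Lemma complex_ext x y :
  complex.Re x = complex.Re y -> complex.Im x = complex.Im y -> x = y.
Proof. by case: x => a b; case: y => c d /= -> ->. Qed.

End ComplexModulus.

(** * The complex exponential and its second-order expansion at 0 *)

Section ComplexExponential.
Context {R : realType}.
Local Notation C := R[i].

Lemma cexpD (x y : C) : cexp (x + y) = cexp x * cexp y.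
Proof.
rewrite /cexp RecD ImcD expRD cosD sinD; apply: complex_ext => /=; ring.
Qed.

Lemma cabs_cexp (x : C) : cabs (cexp x) = expR (complex.Re x).
Proof.
rewrite /cexp cabsM cabsR ger0_norm ?expR_ge0//.
by rewrite [X in _ * X]/cabs /= cos2Dsin2 sqrtr1 mulr1.
Qed.

Lemma cexp_neq0 (x : C) : cexp x != 0.
Proof. by rewrite -cabs_gt0 cabs_cexp expR_gt0. Qed.

Lemma normr_sin_le (b : R) : `|sin b| <= `|b|.
Proof.
have dsin : forall x : R, is_derive x (1 : R) sin (cos x) by move=> x; exact: is_derive_sin.
wlog b0 : b / 0 < b.
  move=> W; have [/W//|b0|<-] := ltgtP 0 b; last by rewrite sin0.
  by rewrite -normrN -sinN -[leRHS]normrN; apply: W; rewrite oppr_gt0.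
have [c _] := @MVT R sin cos 0 b b0 (fun x _ => dsin x)
  (continuous_subspaceT (@continuous_sin R)).
rewrite sin0 !subr0 => ->; rewrite normrM ler_piMl//.
by rewrite ler_norml cos_geN1 cos_le1.
Qed.

Lemma cos_quad (b : R) : `|cos b - 1| <= b ^+ 2.
Proof.
have -> : b = (b / 2) *+ 2 by rewrite -[RHS]mulr_natr; field.
have := normr_sin_le (b / 2).
rewrite mulr2n cosD -mulr2n.
have := cos2Dsin2 (b / 2).
set s := sin _; set c := cos _ => e h.
have -> : c * c - s * s - 1 = - (2 * s ^+ 2).
  by rewrite -[X in _ - X]e; ring.
rewrite normrN ger0_norm; last by have := sqr_ge0 s; lra.
have : s ^+ 2 <= (b / 2) ^+ 2.
  have : `|s| ^+ 2 <= `|b / 2| ^+ 2 by rewrite ler_pXn2r ?nnegrE.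
  by rewrite !real_normK ?num_real.
rewrite -[(b/2)*+2]mulr_natr => h2; nra.
Qed.

Lemma sin_quad (b : R) : `|b| <= 1 -> `|sin b - b| <= b ^+ 2.
Proof.
wlog b0 : b / 0 < b.
  move=> W; have [/W//|b0|<-] := ltgtP 0 b; last first.
    by rewrite sin0 subrr normr0 expr0n.
  move=> b1; rewrite -normrN opprD -sinN -sqrrN; apply: W; rewrite ?oppr_gt0//.
  by rewrite normrN.
move=> b1.
have [c cb] := @MVT R sin cos 0 b b0 (fun x _ => is_derive_sin x)
  (continuous_subspaceT (@continuous_sin R)).
rewrite sin0 !subr0 => ->.
have -> : cos c * b - b = (cos c - 1) * b by ring.
rewrite normrM expr2 (ger0_norm (ltW b0)); apply: ler_wpM2r; first exact: ltW.
apply: (le_trans (cos_quad c)).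
move: cb b1; rewrite in_itv/= (ger0_norm (ltW b0)) => /andP[c0 cb] b1.
nra.
Qed.

(** The upper bound comes from [expR (- a) >= 1 - a]: hence [expR a * (1 - a) <= 1], while [(1 + a +
    2 a^2) (1 - a) = 1 + a^2 (1 - 2 a)] is at least 1 for [a <= 1/2]. *)
Lemma expR_quad (a : R) : `|a| <= 2^-1 -> `|expR a - 1 - a| <= 2 * a ^+ 2.
Proof.
move=> a2; have /ler_normlP [a2n a2p] := a2.
have h1 := expR_ge1Dx a; have h2 := expR_ge1Dx (- a).
rewrite ger0_norm; last by lra.
have e := expRxMexpNx_1 a; move: h2 e (expR_gt0 a).
set E := expR a; set F := expR (- a) => h2 e E0.
have h3 : E * (1 - a) <= 1 by rewrite -[leRHS]e ler_wpM2l// ltW.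
have h4 : E <= 1 + a + 2 * a ^+ 2.
  rewrite -(@ler_pM2r _ (1 - a)); last by lra.
  apply: (le_trans h3).
  nra.
lra.
Qed.

(** With the functional equation [cexpD], this expansion at 0 gives the derivative of [cexp] at
    every point. *)
Lemma cexp_quad (h : C) : cabs h <= 2^-1 ->
  cabs (cexp h - 1 - h) <= 12 * cabs h ^+ 2.
Proof.
case: h => a b hh; rewrite cabs_sqr.
have ha : `|a| <= 2^-1 := le_trans (Re_le_cabs (a +i* b)) hh.
have hb : `|b| <= 2^-1 := le_trans (Im_le_cabs (a +i* b)) hh.
have Ea := expR_quad ha; have Cb := cos_quad b.
have Sb : `|sin b - b| <= b ^+ 2 by apply: sin_quad; apply: (le_trans hb); lra.
apply: (le_trans (cabs_le_ReIm _)).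
rewrite /= mul0r subr0 mul0r addr0 oppr0 addr0.
have {Ea} /ler_normlP [Ea1 Ea2] := Ea.
have /ler_normlP [Cb1 Cb2] := Cb.
have {Sb} /ler_normlP [Sb1 Sb2] := Sb.
have /ler_normlP [ha1 ha2] := ha; have /ler_normlP [hb1 hb2] := hb.
have aE : expR a - 1 - a - (expR a - 1 - a) = 0 by lra.
set e := expR a - 1 - a in Ea1 Ea2; have eE : expR a = 1 + a + e by rewrite /e; lra.
set s := sin b - b in Sb1 Sb2; have sE : sin b = b + s by rewrite /s; lra.
set c := cos b - 1 in Cb1 Cb2; have cE : cos b = 1 + c by rewrite /c; lra.
rewrite eE sE cE.
have -> : (1 + a + e) * (1 + c) - 1 - a = e + (1 + a + e) * c by ring.
have -> : (1 + a + e) * (b + s) - b = s + (a + e) * b + (a + e) * s by ring.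
have a20 := sqr_ge0 a; have b20 := sqr_ge0 b.
have ea : `|e| <= 2 * a ^+ 2 by apply/ler_normlP.
have cb : `|c| <= b ^+ 2 by apply/ler_normlP.
have sb : `|s| <= b ^+ 2 by apply/ler_normlP.
have a4 : a ^+ 2 <= 4^-1 by nra.
have b4 : b ^+ 2 <= 4^-1 by nra.
have P1 : `|1 + a + e| <= 2 by apply/ler_normlP; split; lra.
have P2 : `|(a + e) * b| <= 2 * a ^+ 2 + 2 * b ^+ 2.
  rewrite normrM; apply: (@le_trans _ _ (2 * `|a| * `|b|)).
    apply: ler_wpM2r => //; apply: (le_trans (ler_normD _ _)).
    have : a ^+ 2 <= `|a| * 2^-1 by rewrite -real_normK ?num_real// expr2 ler_wpM2l.
    lra.
  rewrite -(real_normK (num_real a)) -(real_normK (num_real b)).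
  have := sqr_ge0 (`|a| - `|b|); have := sqr_ge0 `|a|; have := sqr_ge0 `|b|.
  nra.
have P3 : `|(a + e) * s| <= 2 * b ^+ 2.
  rewrite normrM ler_pM//; apply/ler_normlP; split; lra.
have P4 : `|(1 + a + e) * c| <= 2 * b ^+ 2 by rewrite normrM ler_pM.
have Q1 := ler_normD e ((1 + a + e) * c).
have Q2 := ler_normD (s + (a + e) * b) ((a + e) * s).
have Q3 := ler_normD s ((a + e) * b).
lra.
Qed.

End ComplexExponential.

Lemma geometric_small {R : realType} (c q e : R) : 0 <= q < 1 -> 0 < e ->
  exists N0, forall N, (N0 <= N)%N -> c * q ^+ N < e.
Proof.
move=> /andP[q0 q1] e0; have : (fun N => c * q ^+ N) @ \oo --> (0 : R).
  rewrite -[X in _ --> X](mulr0 c); apply: cvgMl_tmp.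
  by apply: cvg_expr; rewrite ger0_norm.
move=> /cvgrPdist_lt/(_ _ e0)[N0 _ H]; exists N0 => N /H /=.
by rewrite sub0r normrN => /(le_lt_trans (ler_norm _)).
Qed.

Lemma half_itv {R : realType} : 0 <= (2^-1 : R) < 1.
Proof. by rewrite invr_ge0 ler0n invf_lt1// ltr1n. Qed.

(** * Complex differentiability *)

Section ComplexDifferentiability.
Context {R : realType}.
Local Notation C := R[i].

(* The norm of a normed module over [R[i]] takes its values in [R[i]]. *)
Definition rnorm (V : normedModType C) (v : V) : R := complex.Re `|v|.

Lemma rnormE (V : normedModType C) (v : V) : `|v| = (rnorm v)%:C.
Proof. by rewrite /rnorm RRe_real// normr_real. Qed.

Lemma rnorm_ge0 (V : normedModType C) (v : V) : 0 <= rnorm v.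
Proof. by rewrite -ler0c -rnormE. Qed.

Lemma rnormC (x : C) : rnorm x = cabs x.
Proof. by []. Qed.

Lemma rnormZ (V : normedModType C) (l : C) (v : V) :
  rnorm (l *: v) = cabs l * rnorm v.
Proof.
by apply: complexI; rewrite -rnormE normrZ !rnormE -rmorphM.
Qed.

Lemma rnormD (V : normedModType C) (v w : V) :
  rnorm (v + w) <= rnorm v + rnorm w.
Proof.
rewrite -lecR rmorphD /= -!rnormE; exact: ler_normD.
Qed.

Lemma pos_real_complex (e : C) : 0 < e -> e = (complex.Re e)%:C /\ 0 < complex.Re e.
Proof.
move=> e0; have ee : e = (complex.Re e)%:C by rewrite RRe_real// gtr0_real.
by split=> //; rewrite -ltcR -ee.
Qed.

Lemma near0P (V : normedModType C) (P : V -> Prop) :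
  (\forall h \near (0 : V), P h) <->
  exists2 e : R, 0 < e & forall h, rnorm h < e -> P h.
Proof.
split.
  move=> /nbhs_norm0P [e /= /pos_real_complex[ee e0] H].
  exists (complex.Re e) => // h hh; apply: H => /=.
  by rewrite ee rnormE ltcR.
move=> [e e0 H]; apply/nbhs_norm0P; exists e%:C; first by rewrite /= ltcR.
by move=> h /=; rewrite rnormE ltcR => /H.
Qed.

Lemma nearCP (V : normedModType C) (x : V) (P : set V) :
  nbhs x P <-> exists2 e : R, 0 < e & forall h, rnorm h < e -> P (x + h).
Proof.
split.
  move=> /nbhs_normP[e /= /pos_real_complex[ee e0] H].
  exists (complex.Re e) => // h hh; apply: H => /=.
  by rewrite opprD addNKr normrN ee rnormE ltcR.
move=> [e e0 H]; apply/nbhs_normP; exists e%:C; first by rewrite /= ltcR.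
move=> y /=; rewrite -normrN opprB rnormE ltcR => /H.
by rewrite addrC subrK.
Qed.

(** Together with [differentiable_eps], this trades the little-o over [R[i]] for inequalities
    between real numbers. *)
Lemma eps_differentiable (V : normedModType C) (f : V -> C) (x : V)
    (L : {linear V -> C}) : continuous L ->
  (forall e : R, 0 < e -> exists2 r : R, 0 < r & forall h, rnorm h < r ->
    cabs (f (x + h) - f x - L h) <= e * rnorm h) ->
  differentiable f x /\ 'd f x = L :> (V -> C).
Proof.
move=> cL H.
have fL : f \o shift x = cst (f x) + L +o_ 0 id.
  apply/eqaddoP => e /pos_real_complex[-> e0].
  apply/near0P; have [r r0 Hr] := H _ e0; exists r => // h hr.
  rewrite !rnormE rnormC -rmorphM /= lecR.
  have -> : (f \o shift x - (cst (f x) + L)) h = f (x + h) - f x - L h.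
    by rewrite /= !fctE /= opprD addrA [h + x]addrC.
  exact: Hr.
have dE := diff_unique cL fL.
split; last exact: dE.
apply/diff_locallyP; rewrite dE; split; [exact: cL|exact: fL].
Qed.

(** An explicit quadratic remainder, unlike a little-o, can be integrated over a parameter; this is
    the form in which integrals are differentiated below. *)
Lemma quad_differentiable (V : normedModType C) (f : V -> C) (x : V)
    (L : {linear V -> C}) (M r : R) :
  0 < r -> continuous L ->
  (forall h, rnorm h < r -> cabs (f (x + h) - f x - L h) <= M * rnorm h ^+ 2) ->
  differentiable f x /\ 'd f x = L :> (V -> C).
Proof.
move=> r0 cL H; apply: eps_differentiable => // e e0.
have M1 : 0 < `|M| + 1 by rewrite ltr_wpDl.
exists (Num.min r (e / (`|M| + 1))); first by rewrite lt_min r0 divr_gt0.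
move=> h; rewrite lt_min => /andP[hr he].
apply: (le_trans (H h hr)).
rewrite expr2 mulrA; apply: ler_wpM2r; first exact: rnorm_ge0.
apply: (@le_trans _ _ ((`|M| + 1) * rnorm h)).
  apply: ler_wpM2r; first exact: rnorm_ge0.
  by rewrite (le_trans (ler_norm _))// lerDl.
by rewrite -ler_pdivlMl// mulrC; exact: ltW.
Qed.

Lemma differentiable_eps (V : normedModType C) (f : V -> C) (x : V) :
  differentiable f x -> forall e : R, 0 < e ->
  exists2 r : R, 0 < r & forall h, rnorm h < r ->
    cabs (f (x + h) - f x - 'd f x h) <= e * rnorm h.
Proof.
move=> /diff_locallyP[_ /eqaddoP fL] e e0.
have /fL /near0P[r r0 H] : (0 : C) < e%:C by rewrite ltcR.
exists r => // h hr; have := H h hr.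
rewrite !rnormE rnormC -rmorphM /= lecR.
have -> : (f \o shift x - (cst (f x) + 'd f x)) h = f (x + h) - f x - 'd f x h.
  by rewrite /= !fctE /= opprD addrA [h + x]addrC.
by [].
Qed.

Lemma cabs_le_rnorm n (v : 'rV[C]_n) j : cabs (v 0 j) <= rnorm v.
Proof.
rewrite -lecR -rnormE -normCE [leRHS]/Num.norm /= mx_normE -[leLHS]nngE num_le.
exact: (le_bigmax _ (fun i => `|v i.1 i.2|%:nng) (0, j)).
Qed.

Lemma rnorm_le n (v : 'rV[C]_n) (b : R) :
  0 <= b -> (forall j, cabs (v 0 j) <= b) -> rnorm v <= b.
Proof.
move=> b0 vb; rewrite -lecR -rnormE [leLHS]/Num.norm /=.
have [->|/mx_norm_neq0[[i j] /= ->]] := eqVneq (mx_norm v) 0; first by rewrite ler0c.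
by rewrite (ord1 i) normCE lecR.
Qed.

Lemma rnorm_le_cnorm n (v : 'rV[C]_n) : rnorm v <= cnorm v.
Proof.
apply: rnorm_le => [|j]; first exact: sqrtr_ge0.
rewrite -[leLHS](ger0_norm (cabs_ge0 _)) -sqrtr_sqr ler_sqrt; last first.
  by apply: sumr_ge0 => i _; exact: sqr_ge0.
by rewrite (bigD1 j)//= lerDl; apply: sumr_ge0 => i _; exact: sqr_ge0.
Qed.

Lemma cnorm_ge0 n (v : 'rV[C]_n) : 0 <= cnorm v.
Proof. exact: sqrtr_ge0. Qed.

Lemma cnorm_sqr n (v : 'rV[C]_n) : cnorm v ^+ 2 = \sum_j cabs (v 0 j) ^+ 2.
Proof. by rewrite sqr_sqrtr//; apply: sumr_ge0 => i _; exact: sqr_ge0. Qed.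

Lemma cnorm_le_rnorm n (v : 'rV[C]_n) : cnorm v <= n%:R * rnorm v.
Proof.
rewrite -[leRHS]ger0_norm ?mulr_ge0 ?rnorm_ge0// -sqrtr_sqr ler_sqrt ?sqr_ge0//.
apply: (@le_trans _ _ (\sum_(j < n) rnorm v ^+ 2)).
  by apply: ler_sum => j _; rewrite ler_pXn2r ?nnegrE ?cabs_ge0 ?rnorm_ge0 ?cabs_le_rnorm.
rewrite sumr_const card_ord exprMn -[leLHS]mulr_natl ler_wpM2r ?sqr_ge0//.
by rewrite -natrX ler_nat; case: n {v} => // n; rewrite expnS leq_pmulr.
Qed.

Lemma near_eq_differentiable (V : normedModType C) (f g : V -> C) (x : V) (r : R) :
  0 < r -> (forall h, rnorm h < r -> f (x + h) = g (x + h)) ->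
  differentiable f x -> differentiable g x.
Proof.
move=> r0 fg df; have /diff_locallyP[cL _] := df.
suff [] : differentiable g x /\ 'd g x = 'd f x :> (V -> C) by [].
apply: eps_differentiable => // e e0.
have [r1 r10 H] := differentiable_eps df e0.
exists (Num.min r r1); first by rewrite lt_min r0.
move=> h; rewrite lt_min => /andP[hr hr1].
have gx : g x = f x.
  have := fg 0; rewrite addr0 => -> //.
  by rewrite /rnorm normr0.
by rewrite -fg// gx; exact: H.
Qed.

Lemma linearC_bound n (L : {linear 'rV[C]_n -> C}) :
  exists2 M : R, 0 <= M & forall v, cabs (L v) <= M * rnorm v.
Proof.
exists (\sum_j cabs (L (delta_mx 0 j))); first by apply: sumr_ge0 => j _; exact: cabs_ge0.
move=> v; rewrite {1}(row_sum_delta v) linear_sum.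
apply: (le_trans (cabs_sum _ _ _)); rewrite mulr_suml; apply: ler_sum => j _.
rewrite linearZ cabsM mulrC; apply: ler_wpM2l; first exact: cabs_ge0.
exact: cabs_le_rnorm.
Qed.

Lemma linearC_continuous n (L : {linear 'rV[C]_n -> C}) : continuous L.
Proof.
have [M M0 LM] := linearC_bound L.
apply: bounded_linear_continuous; apply/linear_boundedP.
exists M%:C; split; first by rewrite /= complex_real.
move=> r Mr x; rewrite !rnormE rnormC.
apply: (@le_trans _ _ (M%:C * (rnorm x)%:C)); first by rewrite -rmorphM lecR.
by apply: ler_wpM2r; [rewrite ler0c rnorm_ge0|exact: ltW].
Qed.

Lemma differentiable_var (V : normedModType C) (x : V) :
  differentiable (fun y : V => y) x.
Proof. by apply: (@linear_differentiable _ _ _ idfun) => y; exact: cvg_id. Qed.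

Lemma cexp_differentiable (x : C) : differentiable cexp x /\
  'd cexp x = (fun h => h * cexp x) :> (C -> C).
Proof.
pose L : C -> C := fun h => h * cexp x.
have lL : linear L by move=> a u v; rewrite /L mulrDl scalerAl.
pose L' : {linear C -> C} := HB.pack L (GRing.isLinear.Build C C C _ L lL).
apply: (@quad_differentiable _ cexp x L' (12 * cabs (cexp x)) 2^-1).
- by rewrite invr_gt0.
- move=> y; exact: mulrr_continuous.
move=> h hr; rewrite rnormC.
have -> : cexp (x + h) - cexp x - L' h = cexp x * (cexp h - 1 - h).
  by rewrite cexpD /= /L; ring.
rewrite cabsM [leRHS]mulrAC [leLHS]mulrC ler_wpM2r ?cabs_ge0//.
by apply: cexp_quad; exact: ltW.
Qed.

End ComplexDifferentiability.

(** * Integrals of complex-valued functions *)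

Section ComplexIntegral.
Context {R : realType}.
Local Notation C := R[i].

Definition cmeasurable {disp} {T : measurableType disp} (D : set T) (f : T -> C) :=
  measurable_fun D (fun t => complex.Re (f t)) /\
  measurable_fun D (fun t => complex.Im (f t)).

Section basics.
Context {disp} {T : measurableType disp} (mu : {measure set T -> \bar R}).
Context (D : set T) (mD : measurable D).
Implicit Types (f g : T -> C) (M : T -> R).

Lemma cmeasurable_cst (c : C) : cmeasurable D (fun _ => c).
Proof. by split; exact: measurable_cst. Qed.

Lemma cmeasurableD f g : cmeasurable D f -> cmeasurable D g ->
  cmeasurable D (fun t => f t + g t).
Proof.
move=> [f1 f2] [g1 g2]; split.
- by under eq_fun do rewrite RecD; exact: measurable_funD.
- by under eq_fun do rewrite ImcD; exact: measurable_funD.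
Qed.

Lemma cmeasurableN f : cmeasurable D f -> cmeasurable D (fun t => - f t).
Proof.
move=> [f1 f2]; split.
- by under eq_fun do rewrite RecN; apply: measurableT_comp.
- by under eq_fun do rewrite ImcN; apply: measurableT_comp.
Qed.

Lemma cmeasurableB f g : cmeasurable D f -> cmeasurable D g ->
  cmeasurable D (fun t => f t - g t).
Proof. by move=> mf mg; apply: cmeasurableD => //; exact: cmeasurableN. Qed.

Lemma cmeasurableM f g : cmeasurable D f -> cmeasurable D g ->
  cmeasurable D (fun t => f t * g t).
Proof.
move=> [f1 f2] [g1 g2]; split.
- under eq_fun do rewrite RecM.
  by apply: measurable_funB; exact: measurable_funM.
- under eq_fun do rewrite ImcM.
  by apply: measurable_funD; exact: measurable_funM.
Qed.

Lemma cmeasurable_sum I (r : seq I) (F : I -> T -> C) :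
  (forall i, cmeasurable D (F i)) -> cmeasurable D (fun t => \sum_(i <- r) F i t).
Proof.
move=> mF; elim: r => [|i r IH].
  by under eq_fun do rewrite big_nil; exact: cmeasurable_cst.
by under eq_fun do rewrite big_cons; exact: cmeasurableD.
Qed.

Lemma eq_cmeasurable f g : (forall t, D t -> f t = g t) ->
  cmeasurable D f -> cmeasurable D g.
Proof.
move=> fg [f1 f2]; split.
- by apply: eq_measurable_fun f1 => t /set_mem Dt; rewrite fg.
- by apply: eq_measurable_fun f2 => t /set_mem Dt; rewrite fg.
Qed.

Lemma measurable_cabs f : cmeasurable D f -> measurable_fun D (fun t => cabs (f t)).
Proof.
move=> [f1 f2].
have -> : (fun t => cabs (f t)) =
    (fun x => Num.sqrt x) \o (fun t => complex.Re (f t) ^+ 2 + complex.Im (f t) ^+ 2).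
  by apply/funext => t /=; rewrite -cabs_sqr sqrtr_sqr ger0_norm ?cabs_ge0.
apply: measurableT_comp; first by apply: continuous_measurable_fun; exact: sqrt_continuous.
by apply: measurable_funD; exact: measurable_funX.
Qed.

Lemma cintegrable_dominated f M : cmeasurable D f ->
  mu.-integrable D (EFin \o M) -> (forall t, D t -> cabs (f t) <= M t) ->
  cintegrable mu D f.
Proof.
move=> [f1 f2] iM fM; split; apply: (le_integrable mD _ _ iM).
- exact/measurable_EFinP.
- move=> t Dt; rewrite lee_fin (le_trans _ (ler_norm _)) //.
  exact: (le_trans (Re_le_cabs _) (fM _ Dt)).
- exact/measurable_EFinP.
- move=> t Dt; rewrite lee_fin (le_trans _ (ler_norm _)) //.
  exact: (le_trans (Im_le_cabs _) (fM _ Dt)).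
Qed.

Lemma cintegrable_measurable f : cintegrable mu D f -> cmeasurable D f.
Proof. by move=> [/measurable_int/measurable_EFinP f1 /measurable_int/measurable_EFinP]. Qed.

Lemma eq_cintegral f g : (forall t, D t -> f t = g t) ->
  cintegral mu D f = cintegral mu D g.
Proof.
move=> fg; rewrite /cintegral; congr (_ +i* _); apply: eq_Rintegral => t /set_mem Dt;
  by rewrite fg.
Qed.

Lemma cintegralD f g : cintegrable mu D f -> cintegrable mu D g ->
  cintegral mu D (fun t => f t + g t) = cintegral mu D f + cintegral mu D g.
Proof.
move=> [f1 f2] [g1 g2]; rewrite /cintegral.
under eq_Rintegral do rewrite RecD.
under [X in _ +i* X]eq_Rintegral do rewrite ImcD.
by rewrite !RintegralD.
Qed.

Lemma cintegrableD f g : cintegrable mu D f -> cintegrable mu D g ->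
  cintegrable mu D (fun t => f t + g t).
Proof.
move=> [f1 f2] [g1 g2]; split.
- under eq_fun do rewrite RecD EFinD; exact: integrableD.
- under eq_fun do rewrite ImcD EFinD; exact: integrableD.
Qed.

Lemma cintegrableZ (c : C) f : cintegrable mu D f ->
  cintegrable mu D (fun t => c * f t).
Proof.
case: c => a b [f1 f2]; split.
- under eq_fun do rewrite RecM EFinB !EFinM.
  by apply: integrableB => //; exact: integrableZl.
- under eq_fun do rewrite ImcM EFinD !EFinM.
  by apply: integrableD => //; exact: integrableZl.
Qed.

Lemma cintegralZ (c : C) f : cintegrable mu D f ->
  cintegral mu D (fun t => c * f t) = c * cintegral mu D f.
Proof.
case: c => a b [f1 f2]; rewrite /cintegral.
under eq_Rintegral do rewrite RecM.
under [X in _ +i* X]eq_Rintegral do rewrite ImcM.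
rewrite RintegralB ?RintegralD// ?RintegralZl//=.
all: by first [exact: (integrableZl mD _ f1)|exact: (integrableZl mD _ f2)].
Qed.

Lemma cintegralN f : cintegrable mu D f ->
  cintegral mu D (fun t => - f t) = - cintegral mu D f.
Proof.
move=> fi; rewrite -mulN1r -cintegralZ//; apply: eq_cintegral => t _.
by rewrite mulN1r.
Qed.

Lemma cintegrableN f : cintegrable mu D f -> cintegrable mu D (fun t => - f t).
Proof.
by move=> /(cintegrableZ (-1)); under [in X in X -> _]eq_fun do rewrite mulN1r.
Qed.

Lemma cintegrableB f g : cintegrable mu D f -> cintegrable mu D g ->
  cintegrable mu D (fun t => f t - g t).
Proof. by move=> fi gi; apply: cintegrableD => //; exact: cintegrableN. Qed.

Lemma cintegralB f g : cintegrable mu D f -> cintegrable mu D g ->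
  cintegral mu D (fun t => f t - g t) = cintegral mu D f - cintegral mu D g.
Proof. by move=> fi gi; rewrite cintegralD ?cintegralN//; exact: cintegrableN. Qed.

Lemma cintegrable0 : cintegrable mu D (fun=> 0).
Proof. by split => /=; exact: integrable0. Qed.

Lemma cintegral0 : cintegral mu D (fun=> 0) = 0.
Proof. by rewrite /cintegral /= /Rintegral integral0. Qed.

Lemma cintegrable_sum I (r : seq I) (F : I -> T -> C) :
  (forall i, cintegrable mu D (F i)) ->
  cintegrable mu D (fun t => \sum_(i <- r) F i t).
Proof.
move=> iF; elim: r => [|i r IH].
  by under eq_fun do rewrite big_nil; exact: cintegrable0.
by under eq_fun do rewrite big_cons; exact: cintegrableD.
Qed.

Lemma cintegral_sum I (r : seq I) (F : I -> T -> C) :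
  (forall i, cintegrable mu D (F i)) ->
  cintegral mu D (fun t => \sum_(i <- r) F i t) = \sum_(i <- r) cintegral mu D (F i).
Proof.
move=> iF; elim: r => [|i r IH].
  by under eq_fun do rewrite big_nil; rewrite big_nil cintegral0.
under eq_fun do rewrite big_cons.
by rewrite cintegralD ?IH ?big_cons//; exact: cintegrable_sum.
Qed.

(** The factor 2 comes from estimating real and imaginary parts separately. It is harmless, as all
    the bounds are up to constants. *)
Lemma cabs_cintegral_le f M : cmeasurable D f ->
  mu.-integrable D (EFin \o M) -> (forall t, D t -> cabs (f t) <= M t) ->
  cabs (cintegral mu D f) <= 2 * \int[mu]_(t in D) M t.
Proof.
move=> mf iM fM; have [f1 f2] := cintegrable_dominated mf iM fM.
apply: (le_trans (cabs_le_ReIm _)) => /=.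
have -> : 2 * \int[mu]_(t in D) M t = \int[mu]_(t in D) M t + \int[mu]_(t in D) M t.
  by rewrite mulrC mulr_natr mulr2n.
apply: lerD.
- apply: (le_trans (le_normr_Rintegral mD f1)); apply: le_Rintegral => //.
    by have := integrable_norm f1.
  by move=> t Dt; exact: (le_trans (Re_le_cabs _) (fM _ Dt)).
- apply: (le_trans (le_normr_Rintegral mD f2)); apply: le_Rintegral => //.
    by have := integrable_norm f2.
  by move=> t Dt; exact: (le_trans (Im_le_cabs _) (fM _ Dt)).
Qed.

End basics.

Section continuity.

Lemma Re_continuous : continuous (@complex.Re R : C -> R).
Proof.
move=> x A /nbhs_normP[e /= e0 H]; apply/nearCP; exists e => // h he.
apply: H => /=; rewrite RecD opprD addNKr normrN.
exact: (le_lt_trans (Re_le_cabs _)).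
Qed.

Lemma Im_continuous : continuous (@complex.Im R : C -> R).
Proof.
move=> x A /nbhs_normP[e /= e0 H]; apply/nearCP; exists e => // h he.
apply: H => /=; rewrite ImcD opprD addNKr normrN.
exact: (le_lt_trans (Im_le_cabs _)).
Qed.

Lemma complex_continuous (T : topologicalType) (f g : T -> R) (x : T) :
  {for x, continuous f} -> {for x, continuous g} ->
  {for x, continuous (fun t => f t +i* g t : C)}.
Proof.
move=> cf cg; apply/cvgrPdist_le => e /pos_real_complex[-> e0].
set r := complex.Re e.
have r2 : 0 < r / 2 by rewrite divr_gt0.
have /cvgrPdist_le/(_ _ r2) hf := cf.
have /cvgrPdist_le/(_ _ r2) hg := cg.
near=> t; rewrite normCE lecR; apply: (le_trans (cabs_le_ReIm _)) => /=.
rewrite (splitr r); apply: lerD; near: t; assumption.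
Unshelve. all: by end_near. Qed.

Lemma ccontinuousM (T : topologicalType) (f g : T -> C) :
  continuous f -> continuous g -> continuous (fun t => f t * g t).
Proof. by move=> cf cg t; apply: (@continuousM _ _ f g); [exact: cf|exact: cg]. Qed.

Lemma ccontinuousB (T : topologicalType) (f g : T -> C) :
  continuous f -> continuous g -> continuous (fun t => f t - g t).
Proof. by move=> cf cg t; apply: cvgB; [exact: cf|exact: cg]. Qed.

Lemma ccontinuousX (T : topologicalType) (f : T -> C) k :
  continuous f -> continuous (fun t => f t ^+ k).
Proof.
move=> cf; elim: k => [|k IH]; first by move=> t; exact: cvg_cst.
by under eq_fun do rewrite exprS; exact: ccontinuousM.
Qed.

Lemma ccontinuous_comp (T U V : topologicalType) (g : T -> U) (f : U -> V) :
  continuous g -> continuous f -> continuous (fun t => f (g t)).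
Proof. by move=> cg cf t; apply: continuous_comp; [exact: cg|exact: cf]. Qed.

End continuity.

End ComplexIntegral.

(** * Cauchy's theorem and formula *)

Section SegmentIntegral.
Context {R : realType}.
Local Notation C := R[i].
Local Notation leb := (@lebesgue_measure R).

Lemma continuous_cintegrable (g : R -> C) (a b : R) :
  continuous g -> cintegrable leb `[a, b] g.
Proof.
move=> cg; split.
- apply: continuous_compact_integrable; first exact: segment_compact.
  apply: continuous_subspaceT => x.
  by apply: continuous_comp; [exact: cg|exact: Re_continuous].
- apply: continuous_compact_integrable; first exact: segment_compact.
  apply: continuous_subspaceT => x.
  by apply: continuous_comp; [exact: cg|exact: Im_continuous].
Qed.

Lemma cintegral_itv_split (g : R -> C) (a b c : R) : continuous g ->
  a <= b -> b <= c ->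
  cintegral leb `[a, c] g = cintegral leb `[a, b] g + cintegral leb `[b, c] g.
Proof.
move=> cg ab bc; have [g1 g2] := continuous_cintegrable a c cg.
have split1 (h : R -> R) : leb.-integrable `[a, c] (EFin \o h) ->
    \int[leb]_(t in `[a, c]) h t = \int[leb]_(t in `[a, b]) h t +
      \int[leb]_(t in `[b, c]) h t.
  move=> ih; rewrite -[X in _ = _ + X]Rintegral_itv_obnd_cbnd; last first.
    by apply: integrableS ih => //; apply: subset_itvr; rewrite bnd_simp.
  by rewrite -(@Rintegral_itvB _ h _ _ b ih) ?bnd_simp// addrC subrK.
by rewrite /cintegral (split1 _ g1) (split1 _ g2).
Qed.

Lemma Rintegral_itv_cst (a b M : R) : a <= b ->
  \int[leb]_(t in `[a, b]) M = M * (b - a).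
Proof.
move=> ab; rewrite Rintegral_cst//= lebesgue_measure_itv/= lte_fin.
by case: ltgtP ab => //= -> _; rewrite subrr.
Qed.

Lemma integrable_itv_cst (a b M : R) :
  leb.-integrable `[a, b] (EFin \o (fun=> M)).
Proof.
apply: continuous_compact_integrable; first exact: segment_compact.
by apply: continuous_subspaceT => x; exact: cvg_cst.
Qed.

Lemma cabs_cintegral_itv_le (g : R -> C) (a b M : R) : continuous g -> a <= b ->
  (forall t, a <= t <= b -> cabs (g t) <= M) ->
  cabs (cintegral leb `[a, b] g) <= 2 * (M * (b - a)).
Proof.
move=> cg ab gM; rewrite -Rintegral_itv_cst//.
apply: cabs_cintegral_le => //.
- exact: (cintegrable_measurable (continuous_cintegrable a b cg)).
- exact: integrable_itv_cst.
Qed.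

Lemma cintegral_itv_cst (c : C) (a b : R) : a <= b ->
  cintegral leb `[a, b] (fun=> c) = c * (b - a)%:C.
Proof.
move=> ab; rewrite /cintegral !Rintegral_itv_cst//.
by case: c => u v; apply: complex_ext => /=; ring.
Qed.

End SegmentIntegral.

Section Subdivision.
Context {R : realType}.

Lemma half_segments (a b : R) : 0 <= b ->
  [/\ a <= a, a + b <= a + (b + b), a <= a + b & a + b + b <= a + (b + b)].
Proof. by move=> b0; split; lra. Qed.

Lemma quarter_absurd (j a b c d : R) : 4 * a < j -> 4 * b < j -> 4 * c < j ->
  4 * d < j -> j <= a + b + c + d -> False.
Proof. lra. Qed.

End Subdivision.

(** * Goursat's theorem for rectangles *)

Section Goursat.
Context {R : realType}.
Local Notation C := R[i].
Local Notation leb := (@lebesgue_measure R).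
Context (f : C -> C) (cf : continuous f).

Let cfh (y : R) : continuous (fun u : R => f (u +i* y)).
Proof.
move=> u; apply: continuous_comp; last exact: cf.
by apply: complex_continuous; [exact: id|exact: cvg_cst].
Qed.

Let cfv (x : R) : continuous (fun v : R => f (x +i* v)).
Proof.
move=> v; apply: continuous_comp; last exact: cf.
by apply: complex_continuous; [exact: cvg_cst|exact: id].
Qed.

(* The integral of f over the boundary of [x, x + s] x [y, y + t]. *)
Definition rectint (x y s t : R) : C :=
  cintegral leb `[x, x + s] (fun u => f (u +i* y) - f (u +i* (y + t))) +
  'i%C * cintegral leb `[y, y + t] (fun v => f ((x + s) +i* v) - f (x +i* v)).

Let hint (x s y : R) := cintegral leb `[x, x + s] (fun u => f (u +i* y)).
Let vint (x y t : R) := cintegral leb `[y, y + t] (fun v => f (x +i* v)).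

Let iH (x s y : R) : cintegrable leb `[x, x + s] (fun u => f (u +i* y)).
Proof. exact: continuous_cintegrable. Qed.

Let iV (x y t : R) : cintegrable leb `[y, y + t] (fun v => f (x +i* v)).
Proof. exact: continuous_cintegrable. Qed.

Let iC (c : C) (a b : R) : cintegrable leb `[a, b] (fun=> c).
Proof. by apply: continuous_cintegrable => u; exact: cvg_cst. Qed.

Let rectintE x y s t : rectint x y s t =
  hint x s y - hint x s (y + t) + 'i%C * (vint (x + s) y t - vint x y t).
Proof.
by rewrite /rectint !cintegralB//; exact: continuous_cintegrable.
Qed.

Lemma rectint_split x y s t : 0 <= s -> 0 <= t ->
  rectint x y (s + s) (t + t) =
  rectint x y s t + rectint (x + s) y s t +
  rectint x (y + t) s t + rectint (x + s) (y + t) s t.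
Proof.
move=> s0 t0.
have H v : hint x (s + s) v = hint x s v + hint (x + s) s v.
  by rewrite /hint (@cintegral_itv_split _ _ _ (x + s)) ?addrA ?lerDl.
have V u : vint u y (t + t) = vint u y t + vint u (y + t) t.
  by rewrite /vint (@cintegral_itv_split _ _ _ (y + t)) ?addrA ?lerDl.
rewrite !rectintE !H !V !addrA; ring.
Qed.

(** The boundary integral of an affine function vanishes, so [f] may be replaced by its deviation
    from [f p + l (q - p)]. On pairs of opposite sides this changes the integrands by the constants
    [l i t] and [- l s]; the corrections in [E1] and [E2] cancel once the second is multiplied by
    [i]. *)
Lemma rectint_le (x y s t px py e : R) (l : C) :
  0 <= s -> 0 <= t -> 0 <= e -> x <= px <= x + s -> y <= py <= y + t ->
  (forall q, cabs (q - (px +i* py)) <= s + t ->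
    cabs (f q - f (px +i* py) - l * (q - (px +i* py))) <= e * (s + t)) ->
  cabs (rectint x y s t) <= 8 * e * (s + t) ^+ 2.
Proof.
move=> s0 t0 e0 /andP[xp px'] /andP[yp py'] H.
set p := px +i* py in H.
pose r q := f q - f p - l * (q - p).
have near_p u v : x <= u <= x + s -> y <= v <= y + t -> cabs (r (u +i* v)) <= e * (s + t).
  move=> /andP[u1 u2] /andP[v1 v2]; apply: H.
  apply: (le_trans (cabs_le_ReIm _)) => /=.
  by apply: lerD; apply/ler_normlP; split; lra.
have xs : x <= x <= x + s by rewrite lexx lerDl.
have xs' : x <= x + s <= x + s by rewrite lexx lerDl s0.
have yt : y <= y <= y + t by rewrite lexx lerDl.
have yt' : y <= y + t <= y + t by rewrite lexx lerDl t0.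
have E1 : cintegral leb `[x, x + s] (fun u => f (u +i* y) - f (u +i* (y + t))) =
    cintegral leb `[x, x + s] (fun u => f (u +i* y) - f (u +i* (y + t)) + l * (0 +i* t))
    - l * (0 +i* t) * s%:C.
  rewrite [in RHS]cintegralD; [|by []|exact: cintegrableB|exact: iC].
  rewrite cintegral_itv_cst ?lerDl//.
  have -> : x + s - x = s by ring.
  by rewrite addrK.
have E2 : cintegral leb `[y, y + t] (fun v => f ((x + s) +i* v) - f (x +i* v)) =
    cintegral leb `[y, y + t] (fun v => f ((x + s) +i* v) - f (x +i* v) - l * s%:C)
    + l * s%:C * t%:C.
  rewrite [in RHS]cintegralB; [|by []|exact: cintegrableB|exact: iC].
  rewrite cintegral_itv_cst ?lerDl//.
  have -> : y + t - y = t by ring.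
  by rewrite subrK.
rewrite /rectint E1 E2.
set I1 := cintegral _ _ _; set I2 := cintegral _ _ _.
have -> : I1 - l * (0 +i* t) * s%:C + 'i%C * (I2 + l * s%:C * t%:C) = I1 + 'i%C * I2.
  have -> : 0 +i* t = 'i%C * t%:C :> C by apply: complex_ext => /=; ring.
  ring.
have I1le : cabs I1 <= 2 * (2 * (e * (s + t)) * s).
  have -> : 2 * (2 * (e * (s + t)) * s) = 2 * (2 * (e * (s + t)) * (x + s - x)).
    by congr (_ * (_ * _)); ring.
  apply: cabs_cintegral_itv_le; rewrite ?lerDl//.
    move=> u; apply: cvgD; last exact: cvg_cst.
    by apply: cvgB; exact: cfh.
  move=> u ux.
  have -> : f (u +i* y) - f (u +i* (y + t)) + l * (0 +i* t) =
      r (u +i* y) - r (u +i* (y + t)).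
    have -> : 0 +i* t = (u +i* (y + t)) - (u +i* y) :> C by apply: complex_ext => /=; ring.
    by rewrite /r; ring.
  apply: (le_trans (cabsB _ _)); rewrite [2 * _]mulrC mulr_natr mulr2n.
  by apply: lerD; exact: near_p.
have I2le : cabs I2 <= 2 * (2 * (e * (s + t)) * t).
  have -> : 2 * (2 * (e * (s + t)) * t) = 2 * (2 * (e * (s + t)) * (y + t - y)).
    by congr (_ * (_ * _)); ring.
  apply: cabs_cintegral_itv_le; rewrite ?lerDl//.
    move=> u; apply: cvgB; last exact: cvg_cst.
    by apply: cvgB; exact: cfv.
  move=> v vy.
  have -> : f ((x + s) +i* v) - f (x +i* v) - l * s%:C =
      r ((x + s) +i* v) - r (x +i* v).
    have -> : s%:C = ((x + s) +i* v) - (x +i* v) :> C by apply: complex_ext => /=; ring.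
    by rewrite /r; ring.
  apply: (le_trans (cabsB _ _)); rewrite [2 * _]mulrC mulr_natr mulr2n.
  by apply: lerD; exact: near_p.
apply: (le_trans (cabsD _ _)); rewrite cabsM.
have -> : cabs ('i%C : C) = 1 by rewrite /cabs /= expr0n expr1n add0r sqrtr1.
have es : 0 <= e * (s + t) ^+ 2 by rewrite mulr_ge0// sqr_ge0.
rewrite mul1r; apply: (le_trans (lerD I1le I2le)).
have -> : 2 * (2 * (e * (s + t)) * s) + 2 * (2 * (e * (s + t)) * t) =
  4 * (e * (s + t) ^+ 2) by ring.
rewrite -mulrA; lra.
Qed.

(** Bisection: some quarter carries at least a fourth of the integral. After [n] steps the integral
    is at most [4^n] times the one over a rectangle of size [2^-n], which [rectint_le] bounds by a
    multiple of [e 4^-n] near the common point of all the rectangles. *)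
Lemma Goursat (x y s t : R) : 0 <= s -> 0 <= t ->
  (forall u v, x <= u <= x + s -> y <= v <= y + t -> differentiable f (u +i* v)) ->
  rectint x y s t = 0.
Proof.
move=> s0 t0 df.
pose h n : R := 2^-1 ^+ n.
have h0 n : 0 < h n by rewrite exprn_gt0// invr_gt0.
have hS n : h n = h n.+1 + h n.+1 by rewrite /h exprS; field.
(* A rectangle of generation [n] has sides [s * h n] and [t * h n], so its lower left corner [p]
   determines it. *)
pose J n (p : R * R) := cabs (rectint p.1 p.2 (s * h n) (t * h n)).
have step n (p : R * R) : exists q : R * R,
    [/\ p.1 <= q.1, q.1 + s * h n.+1 <= p.1 + s * h n,
        p.2 <= q.2, q.2 + t * h n.+1 <= p.2 + t * h n & J n p <= 4 * J n.+1 q].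
  have s1 : 0 <= s * h n.+1 by rewrite mulr_ge0// ltW.
  have t1 : 0 <= t * h n.+1 by rewrite mulr_ge0// ltW.
  have sE : s * h n = s * h n.+1 + s * h n.+1 by rewrite hS; ring.
  have tE : t * h n = t * h n.+1 + t * h n.+1 by rewrite hS; ring.
  apply: contrapT => /forallNP N.
  have small (q : R * R) : p.1 <= q.1 -> q.1 + s * h n.+1 <= p.1 + s * h n ->
      p.2 <= q.2 -> q.2 + t * h n.+1 <= p.2 + t * h n -> 4 * J n.+1 q < J n p.
    by move=> q1 q2 q3 q4; rewrite ltNge; apply/negP => q5; apply: (N q); split.
  have Jle : J n p <= J n.+1 p + J n.+1 (p.1 + s * h n.+1, p.2) +
      J n.+1 (p.1, p.2 + t * h n.+1) + J n.+1 (p.1 + s * h n.+1, p.2 + t * h n.+1).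
    rewrite {1}/J sE tE rectint_split//.
    do 3 (apply: (le_trans (cabsD _ _)); rewrite lerD2r).
    by [].
  have [p1 p2 p3 p4] := half_segments p.1 s1; have [q1 q2 q3 q4] := half_segments p.2 t1.
  have := small p; have := small (p.1 + s * h n.+1, p.2).
  have := small (p.1, p.2 + t * h n.+1).
  have := small (p.1 + s * h n.+1, p.2 + t * h n.+1) => /=.
  rewrite sE tE => /(_ p3 p4 q3 q4) e1 /(_ p1 p2 q3 q4) e2 /(_ p3 p4 q1 q2) e3.
  move=> /(_ p1 p2 q1 q2) e4; exact: (quarter_absurd e4 e3 e2 e1 Jle).
pose next n p := xget p [set q : R * R |
    [/\ p.1 <= q.1, q.1 + s * h n.+1 <= p.1 + s * h n,
        p.2 <= q.2, q.2 + t * h n.+1 <= p.2 + t * h n & J n p <= 4 * J n.+1 q]].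
have nextP n p := @xgetPex _ p _ (step n p).
pose P := fix P n := if n is m.+1 then next m (P m) else (x, y).
have PS n : [/\ (P n).1 <= (P n.+1).1, (P n.+1).1 + s * h n.+1 <= (P n).1 + s * h n,
        (P n).2 <= (P n.+1).2, (P n.+1).2 + t * h n.+1 <= (P n).2 + t * h n &
        J n (P n) <= 4 * J n.+1 (P n.+1)] by exact: nextP.
have JP n : J 0%N (x, y) <= 4 ^+ n * J n (P n).
  elim: n => [|n IH]; first by rewrite expr0 mul1r.
  have [_ _ _ _ e] := PS n; apply: (le_trans IH).
  by rewrite exprSr -mulrA ler_wpM2l ?exprn_ge0.
have mono n m : (n <= m)%N ->
    [/\ (P n).1 <= (P m).1, (P m).1 + s * h m <= (P n).1 + s * h n,
        (P n).2 <= (P m).2 & (P m).2 + t * h m <= (P n).2 + t * h n].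
  elim: m => [|m IH]; first by rewrite leqn0 => /eqP ->; split.
  rewrite leq_eqVlt => /predU1P[->|]; first by split.
  rewrite ltnS => /IH[a1 a2 a3 a4]; have [b1 b2 b3 b4 _] := PS m.
  by split; [exact: le_trans b1|exact: le_trans a2|exact: le_trans b3|exact: le_trans a4].
have s_h n : 0 <= s * h n by rewrite mulr_ge0// ltW.
have t_h n : 0 <= t * h n by rewrite mulr_ge0// ltW.
have ub1 n m : (P m).1 <= (P n).1 + s * h n.
  have [/mono[a1 a2 _ _]|/ltnW /mono[a1 a2 _ _]] := leqP n m.
    by have := s_h m; lra.
  by have := s_h n; lra.
have ub2 n m : (P m).2 <= (P n).2 + t * h n.
  have [/mono[_ _ a1 a2]|/ltnW /mono[_ _ a1 a2]] := leqP n m.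
    by have := t_h m; lra.
  by have := t_h n; lra.
(* Lower left corners increase and upper right corners decrease, so the supremum of the former lies
   in every rectangle. *)
pose px := sup (range (fun n => (P n).1)); pose py := sup (range (fun n => (P n).2)).
have px1 n : (P n).1 <= px.
  apply: ub_le_sup; last by exists n.
  by exists ((P 0%N).1 + s * h 0%N) => _ [m _ <-]; exact: ub1.
have px2 n : px <= (P n).1 + s * h n.
  by apply: ge_sup => [|_ [m _ <-]]; [exists (P 0%N).1, 0%N|exact: ub1].
have py1 n : (P n).2 <= py.
  apply: ub_le_sup; last by exists n.
  by exists ((P 0%N).2 + t * h 0%N) => _ [m _ <-]; exact: ub2.
have py2 n : py <= (P n).2 + t * h n.
  by apply: ge_sup => [|_ [m _ <-]]; [exists (P 0%N).2, 0%N|exact: ub2].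
have dfp : differentiable f (px +i* py).
  have [] := (px1 0%N, px2 0%N); have [] := (py1 0%N, py2 0%N).
  rewrite /= /h expr0 !mulr1 => a1 a2 a3 a4.
  by apply: df; apply/andP.
have key e : 0 < e -> cabs (rectint x y s t) <= 8 * e * (s + t) ^+ 2.
  move=> e0; have [r r0 H] := differentiable_eps dfp e0.
  have [n hn] : exists n, (s + t) * h n < r.
    by have [n hn] := geometric_small (s + t) half_itv r0; exists n; exact: hn.
  have rl := @rectint_le (P n).1 (P n).2 (s * h n) (t * h n) px py e
    ('d f (px +i* py) 1) (s_h n) (t_h n) (ltW e0).
  have {rl} : J n (P n) <= 8 * e * (s * h n + t * h n) ^+ 2.
    apply: rl; [by rewrite px1 px2|by rewrite py1 py2|move=> q qn].
    set w := q - _ in qn *.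
    have -> : q = (px +i* py) + w by rewrite /w addrC subrK.
    have -> : 'd f (px +i* py) 1 * w = 'd f (px +i* py) w.
      by rewrite -[w in RHS]mulr1 -[w * 1]/(w *: 1) linearZ /= mulrC.
    have wr : rnorm w < r.
      by rewrite rnormC; apply: (le_lt_trans qn); rewrite -mulrDl.
    apply: (le_trans (H w wr)); rewrite rnormC.
    by apply: ler_wpM2l => //; exact: ltW.
  have JE : J 0%N (x, y) = cabs (rectint x y s t) by rewrite /J /h expr0 !mulr1.
  rewrite -JE => Jn; apply: (le_trans (JP n)).
  apply: (@le_trans _ _ (4 ^+ n * (8 * e * (s * h n + t * h n) ^+ 2))).
    by apply: ler_wpM2l => //; exact: exprn_ge0.
  rewrite -mulrDl exprMn /h -exprM mulnC exprM.
  have -> : 2^-1 ^+ 2 = 4^-1 :> R by rewrite expr2; field.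
  rewrite mulrCA -[X in X <= _]mulrA mulrCA [X in _ * (_ * X)]mulrA.
  rewrite le_eqVlt; apply/orP; left; apply/eqP.
  have : 4 ^+ n * 4^-1 ^+ n = 1 :> R by rewrite -exprMn mulfV// expr1n.
  set A := _ ^+ n; set B := _ ^+ n => AB.
  by transitivity (8 * e * (s + t) ^+ 2 * (A * B)); [ring|rewrite AB mulr1].
apply/eqP; rewrite -cabs_eq0; apply/eqP/le_anti; rewrite cabs_ge0 andbT.
apply/ler_addgt0Pl => e e0; rewrite addr0.
have d0 : 0 < 8 * ((s + t) ^+ 2 + 1) by rewrite mulr_gt0// ltr_wpDl// sqr_ge0.
have e1 : 0 < e / (8 * ((s + t) ^+ 2 + 1)) by exact: divr_gt0.
apply: (le_trans (key _ e1)); move: d0; set q := (s + t) ^+ 2 => d0.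
have q1 : 0 < q + 1 by rewrite ltr_wpDl// sqr_ge0.
have -> : 8 * (e / (8 * (q + 1))) * q = e * (q / (q + 1)).
  by field; rewrite gt_eqF.
by rewrite ler_piMr ?(ltW e0)// ler_pdivrMr// mul1r lerDl.
Qed.

End Goursat.

(** * Means over circles and the mean value property *)

Section CircleMean.
Context {R : realType}.
Local Notation C := R[i].
Local Notation leb := (@lebesgue_measure R).

Definition ecirc (v : R) : C := cexp (0 +i* (2 * pi * v)).

Lemma cabs_ecirc v : cabs (ecirc v) = 1.
Proof. by rewrite /ecirc cabs_cexp /= expR0. Qed.

Lemma ecirc_neq0 v : ecirc v != 0.
Proof. exact: cexp_neq0. Qed.

Lemma real_complex_continuous : continuous (fun r : R => r%:C : C).
Proof. by move=> x; apply: complex_continuous; [exact: id|exact: cvg_cst]. Qed.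

Lemma cexp_continuous : continuous (@cexp R).
Proof.
by move=> x; apply: differentiable_continuous; have [] := cexp_differentiable x.
Qed.

Lemma ecirc_continuous : continuous ecirc.
Proof.
move=> v; apply: (@continuous_comp _ _ _ (fun v : R => 0 +i* (2 * pi * v) : C) (@cexp R)).
  by apply: complex_continuous; [exact: cvg_cst|exact: mulrl_continuous].
exact: cexp_continuous.
Qed.

Lemma conj_ecirc v : conjc (ecirc v) = (ecirc v)^-1.
Proof.
apply: (mulfI (ecirc_neq0 v)); rewrite mulfV ?ecirc_neq0//.
by rewrite -sqr_normc normCE cabs_ecirc -rmorphXn expr1n.
Qed.

Definition circ_mean (psi : C -> C) (r : R) : C :=
  cintegral leb `[0, 1] (fun v => psi (r%:C * ecirc v)).

Arguments circ_mean : simpl never.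

Lemma circle_continuous (psi : C -> C) (r : R) : continuous psi ->
  continuous (fun v : R => psi (r%:C * ecirc v)).
Proof.
move=> cpsi v; apply: continuous_comp; last exact: cpsi.
apply: (@continuousM _ _ (fun=> r%:C) ecirc); first exact: cvg_cst.
exact: ecirc_continuous.
Qed.

Lemma circ_mean_continuous (psi : C -> C) (r e : R) : continuous psi -> 0 < e ->
  exists2 d : R, 0 < d & forall r', `|r - r'| < d ->
    cabs (circ_mean psi r' - circ_mean psi r) <= e.
Proof.
move=> cpsi e0.
have e2 : 0 < e / 2 by rewrite divr_gt0.
have e4 : 0 < (e / 2 / 2)%:C :> C by rewrite ltcR divr_gt0.
have /compact_near_coveringP K := @segment_compact R 0 1.
pose P (r' v : R) := cabs (psi (r'%:C * ecirc v) - psi (r%:C * ecirc v)) <= e / 2.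
(* Compactness of [[0, 1]] gives one neighbourhood of [r] that serves all angles. *)
have near_r : \forall r' \near r, `[0, 1]%classic `<=` P r'.
  apply: (K R (nbhs r) (fun r' v => P r' v)) => v v01.
  pose G (p : R * R) := psi (p.2%:C * ecirc p.1).
  have cG : {for (v, r), continuous G}.
    apply: continuous_comp; last exact: cpsi.
    apply: (@continuousM _ _ (fun p : R * R => p.2%:C) (fun p : R * R => ecirc p.1)).
      by apply: continuous_comp; [exact: cvg_snd|exact: real_complex_continuous].
    by apply: continuous_comp; [exact: cvg_fst|exact: ecirc_continuous].
  move/cvgrPdist_le : cG => /(_ _ e4) [[/= A B] [nA nB] AB].
  exists (A, B) => // -[v' r'] [/= Av' Br'].
  have h1 := AB (v', r') (conj Av' Br').
  have h2 := AB (v', r) (conj Av' (nbhs_singleton nB)).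
  move: h1 h2; rewrite /= !normCE !lecR /P => h1 h2.
  have -> : psi (r'%:C * ecirc v') - psi (r%:C * ecirc v') =
    (G (v, r) - G (v', r)) - (G (v, r) - G (v', r')) by rewrite /G /=; ring.
  apply: (le_trans (cabsB _ _)); rewrite [leRHS]splitr; exact: lerD.
move/nbhs_ballP : near_r => [d /= d0 H]; exists d => // r' rr'.
have {}H := H r' rr'.
have -> : circ_mean psi r' - circ_mean psi r = cintegral leb `[0, 1]
    (fun v => psi (r'%:C * ecirc v) - psi (r%:C * ecirc v)).
  by rewrite cintegralB//; exact/continuous_cintegrable/circle_continuous.
have -> : e = 2 * (e / 2 * (1 - 0)) by field.
apply: cabs_cintegral_itv_le => //.
  by move=> v; apply: cvgB; exact: circle_continuous.
Qed.

(* Goursat for psi o exp on a rectangle of height 2 pi: by periodicity the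
   horizontal sides cancel, the vertical ones are circular means of psi. *)
Lemma circ_mean_annulus (psi : C -> C) (r1 r2 : R) : continuous psi ->
  0 < r1 -> r1 <= r2 ->
  (forall z, r1 <= cabs z <= r2 -> differentiable psi z) ->
  circ_mean psi r1 = circ_mean psi r2.
Proof.
move=> cpsi r10 r12 dpsi.
have r20 : 0 < r2 := lt_le_trans r10 r12.
have tp : 0 < 2 * pi :> R by rewrite mulr_gt0// pi_gt0.
have tpn : 2 * pi != 0 :> R by rewrite gt_eqF.
pose f (z : C) := psi (cexp ((2 * pi)%:C * z)).
have fE x v : f (x +i* v) = psi ((expR (2 * pi * x))%:C * ecirc v).
  rewrite /f; congr psi.
  have -> : (2 * pi)%:C * (x +i* v) = (2 * pi * x)%:C + (0 +i* (2 * pi * v)) :> C.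
    by apply: complex_ext => /=; ring.
  by rewrite cexpD [X in X * _]/cexp /= cos0 sin0 mulr1.
have cf : continuous f.
  move=> z; apply: continuous_comp; last exact: cpsi.
  apply: (@continuous_comp _ _ _ (fun z : C => (2 * pi)%:C * z) (@cexp R)).
    exact: mulrl_continuous.
  exact: cexp_continuous.
pose x1 := ln r1 / (2 * pi); pose x2 := ln r2 / (2 * pi).
have X1 : expR (2 * pi * x1) = r1.
  by rewrite /x1 mulrC divfK// lnK.
have X2 : expR (2 * pi * x2) = r2.
  by rewrite /x2 mulrC divfK// lnK.
have x12 : 0 <= x2 - x1.
  by rewrite subr_ge0 ler_pM2r ?invr_gt0// ler_ln// posrE.
have := @Goursat R f cf x1 0 (x2 - x1) 1 x12 ler01.
rewrite /rectint !add0r addrC subrK.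
have -> : cintegral leb `[x1, x2] (fun u => f (u +i* 0) - f (u +i* 1)) = 0.
  rewrite -[RHS](cintegral0 leb `[x1, x2]); apply: eq_cintegral => u _.
  rewrite !fE /ecirc mulr0 mulr1.
  have -> : cexp (0 +i* (2 * pi)) = cexp (0 +i* 0) :> C.
    by rewrite /cexp /= mulr_natl cos2pi sin2pi cos0 sin0.
  by rewrite subrr.
rewrite add0r => H.
have : 'i%C * cintegral leb `[0, 1] (fun v => f (x2 +i* v) - f (x1 +i* v)) = 0.
  apply: H => u v /andP[u1 u2] _.
  rewrite /f; apply: differentiable_comp.
    apply: differentiable_comp; last by have [] := cexp_differentiable ((2 * pi)%:C * (u +i* v)).
    apply: (@differentiableM _ _ (fun=> _) id).
      exact: differentiable_cst.
    exact: differentiable_var.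
  apply: dpsi; rewrite cabs_cexp /= mul0r subr0.
  by rewrite -{1}X1 -X2 !ler_expR !ler_pM2l// u1.
move/eqP; rewrite mulf_eq0 => /orP[/eqP[/eqP]|]; first by rewrite oner_eq0.
rewrite cintegralB; [|by []|..]; last 2 first.
- apply: continuous_cintegrable.
  have -> : (fun v => f (x2 +i* v)) = (fun v => psi (r2%:C * ecirc v)).
    by apply/funext => v; rewrite fE X2.
  exact: circle_continuous.
- apply: continuous_cintegrable.
  have -> : (fun v => f (x1 +i* v)) = (fun v => psi (r1%:C * ecirc v)).
    by apply/funext => v; rewrite fE X1.
  exact: circle_continuous.
rewrite subr_eq0 => /eqP E; rewrite /circ_mean.
transitivity (cintegral leb `[0, 1] (fun v => f (x1 +i* v))).
  by apply: eq_cintegral => v _; rewrite fE X1.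
by rewrite -E; apply: eq_cintegral => v _; rewrite fE X2.
Qed.

Lemma circ_mean0 (psi : C -> C) : circ_mean psi 0 = psi 0.
Proof.
rewrite /circ_mean -[RHS]mulr1.
have -> : 1 = (1 - 0)%:C :> C by rewrite subr0.
rewrite -cintegral_itv_cst//; apply: eq_cintegral => v _.
by rewrite mul0r.
Qed.

Lemma cabs_le_eps (x : C) : (forall e : R, 0 < e -> cabs x <= e) -> x = 0.
Proof.
move=> H; apply/eqP; rewrite -cabs_eq0; apply/eqP/le_anti; rewrite cabs_ge0 andbT.
by apply/ler_addgt0Pl => e e0; rewrite addr0 H.
Qed.

(** The function to which this is applied is only known to be continuous at one point, which lies on
    the circle of radius [rho] or at the centre. The mean is constant in [r] on either side of
    [rho]; its continuity in [r] carries the value across that radius and down to the centre. *)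
Lemma mean_value_circle (psi : C -> C) (rho r : R) : continuous psi -> 0 < rho ->
  (forall z, z != 0 -> cabs z != rho -> differentiable psi z) ->
  0 < r -> circ_mean psi r = psi 0.
Proof.
move=> cpsi rho0 dpsi r0.
have in_disc s : 0 < s < rho -> circ_mean psi s = psi 0.
  move=> /andP[s0 srho].
  apply/eqP; rewrite -subr_eq0; apply/eqP/cabs_le_eps => e e0.
  have [d d0 H] := circ_mean_continuous 0 cpsi e0.
  pose s' := Num.min s (d / 2).
  have s'0 : 0 < s' by rewrite lt_min s0 divr_gt0.
  have s's : s' <= s by rewrite ge_min lexx.
  have <- : circ_mean psi s' = circ_mean psi s.
    apply: (circ_mean_annulus cpsi s'0 s's) => z /andP[z1 z2].
    apply: dpsi; first by rewrite -cabs_gt0 (lt_le_trans s'0).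
    by rewrite lt_eqF// (le_lt_trans z2).
  rewrite -circ_mean0; apply: H; rewrite sub0r normrN gtr0_norm//.
  by rewrite gt_min ltr_pdivrMr// ltr_pMr// ltr1n orbT.
have on_circle : circ_mean psi rho = psi 0.
  apply/eqP; rewrite -subr_eq0; apply/eqP/cabs_le_eps => e e0.
  have [d d0 H] := circ_mean_continuous rho cpsi e0.
  pose s' := Num.max (rho / 2) (rho - d / 2).
  have s'0 : 0 < s' by rewrite lt_max divr_gt0.
  have s'rho : s' < rho.
    by rewrite gt_max ltr_pdivrMr// ltr_pMr// ltr1n/= ltrBlDr ltrDl divr_gt0.
  rewrite -(in_disc s') ?s'0// cabs_distC; apply: H.
  rewrite gtr0_norm ?subr_gt0// ltrBlDr -ltrBlDl.
  by rewrite lt_max; apply/orP; right; lra.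
have [rrho|rrho|->//] := ltgtP r rho; first by apply: in_disc; rewrite r0.
apply/eqP; rewrite -subr_eq0; apply/eqP/cabs_le_eps => e e0.
have [d d0 H] := circ_mean_continuous rho cpsi e0.
pose s' := Num.min r (rho + d / 2).
have s'rho : rho < s' by rewrite lt_min rrho ltrDl divr_gt0.
have s'r : s' <= r by rewrite ge_min lexx.
have <- : circ_mean psi s' = circ_mean psi r.
  apply: (circ_mean_annulus cpsi (lt_trans rho0 s'rho) s'r) => z /andP[z1 z2].
  apply: dpsi.
    by rewrite -cabs_gt0 (lt_trans rho0)// (lt_le_trans s'rho).
  by rewrite gt_eqF// (lt_le_trans s'rho).
rewrite -on_circle; apply: H; rewrite ltr0_norm ?subr_lt0// opprB ltrBlDr.
by rewrite gt_min; apply/orP; right; lra.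
Qed.

End CircleMean.

(** * Cauchy's formula on the unit circle and its second-order consequences *)

Section CauchyFormula.
Context {R : realType}.
Local Notation C := R[i].
Local Notation leb := (@lebesgue_measure R).

Definition difference_quotient (phi : C -> C) (z w : C) : C :=
  if w == z then ('d phi (z : C) (1 : C)) else (phi w - phi z) / (w - z).

Lemma diffC (phi : C -> C) (z h : C) : ('d phi (z : C) h) = h * ('d phi (z : C) (1 : C)).
Proof. by rewrite -[h in LHS]mulr1 -[h * 1]/(h *: 1) linearZ. Qed.

Lemma difference_quotient_differentiable (phi : C -> C) (z w : C) :
  (forall x, differentiable phi x) -> w != z ->
  differentiable (difference_quotient phi z) w.
Proof.
move=> dphi wz.
apply: (@near_eq_differentiable _ _ (fun w => (phi w - phi z) / (w - z)) _ w (cabs (w - z))).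
- by rewrite cabs_gt0 subr_eq0.
- move=> h; rewrite rnormC => hw; rewrite /difference_quotient.
  case: eqP => // e; move: hw.
  by rewrite (_ : w - z = - h) ?cabsN ?ltxx// -e opprD addNKr.
- apply: (@differentiableM _ _ (fun w => phi w - phi z) (fun w => (w - z)^-1)).
    by apply: differentiableB => //; exact: differentiable_cst.
  apply: (@differentiableV _ _ (fun w => w - z)); last by rewrite subr_eq0.
  apply: differentiableB; last exact: differentiable_cst.
  exact: differentiable_var.
Qed.

Lemma difference_quotient_continuous (phi : C -> C) (z : C) :
  (forall x, differentiable phi x) -> continuous (difference_quotient phi z).
Proof.
move=> dphi w; have [->|wz] := eqVneq w z; last first.
  by apply: differentiable_continuous; exact: difference_quotient_differentiable.
move=> A /nbhs_normP[e /= /pos_real_complex[-> e0] H].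
set e' := complex.Re e in e0 H.
have e2 : 0 < e' / 2 by rewrite divr_gt0.
have [r r0 Hr] := differentiable_eps (dphi z) e2.
apply/nearCP; exists r => // h hr; apply: H => /=.
rewrite {1}/difference_quotient eqxx /difference_quotient normCE ltcR.
case: eqP => [_|/eqP hz]; first by rewrite subrr cabs0.
have h0 : h != 0 by apply: contra_neq hz => ->; rewrite addr0.
have -> : z + h - z = h by ring.
have -> : ('d phi (z : C) (1 : C)) - (phi (z + h) - phi z) / h =
    - ((phi (z + h) - phi z - ('d phi (z : C) h)) / h).
  by rewrite [in RHS]diffC; move: ('d phi (z : C) (1 : C)) => D; field.
rewrite cabsN cabsM cabsV ltr_pdivrMr ?cabs_gt0//.
apply: (le_lt_trans (Hr h hr)); rewrite rnormC ltr_pM2r ?cabs_gt0//.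
by rewrite ltr_pdivrMr// ltr_pMr// ltr1n.
Qed.

Lemma differentiable_power k (z : C) : differentiable (fun z : C => z ^+ k) z.
Proof.
elim: k => [|k IH]; first exact: differentiable_cst.
under eq_fun do rewrite exprS.
by apply: (@differentiableM _ _ id (fun z => z ^+ k)) => //; exact: differentiable_var.
Qed.

Lemma cintegral_conj {disp} {T : measurableType disp} (mu : {measure set T -> \bar R})
    (D : set T) (mD : measurable D) (f : T -> C) : cintegrable mu D f ->
  cintegral mu D (fun t => conjc (f t)) = conjc (cintegral mu D f).
Proof.
move=> [f1 f2]; rewrite /cintegral /=; congr (_ +i* _).
  by apply: eq_Rintegral => t _; case: (f t).
rewrite -[RHS]mulN1r -RintegralZl//.
by apply: eq_Rintegral => t _; case: (f t) => a b /=; rewrite mulN1r.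
Qed.

(** On the circle, inverse is conjugate, so these are conjugates of means of positive powers, to
    which the mean value property applies. *)
Lemma ecirc_power_mean k : cintegral leb `[0, 1] (fun v => (ecirc v)^-1 ^+ k) =
  (k == 0)%:R.
Proof.
case: k => [|k].
  transitivity (cintegral leb `[0, 1] (fun=> 1)); first exact: eq_cintegral.
  by rewrite cintegral_itv_cst// subr0 mulr1.
have cX : continuous (fun z : C => z ^+ k.+1).
  by move=> z; exact: differentiable_continuous (differentiable_power _ _).
have mv : circ_mean (fun z : C => z ^+ k.+1) 1 = 0 ^+ k.+1.
  apply: (@mean_value_circle R (fun z => z ^+ k.+1) 1 1 cX ltr01 _ ltr01) => z _ _.
  exact: differentiable_power.
transitivity (conjc (circ_mean (fun z : C => z ^+ k.+1) 1)).
  rewrite /circ_mean -cintegral_conj//; last first.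
    by apply: continuous_cintegrable; exact: (circle_continuous cX).
  by apply: eq_cintegral => v _; rewrite mul1r rmorphXn; exact: (congr1 (fun x => x ^+ _) (esym (conj_ecirc v))).
rewrite mv expr0n; exact: conjc0.
Qed.

Lemma cabs_circle_kernel (z : C) (v : R) : cabs z < 1 ->
  1 - cabs z <= cabs (1 - z / ecirc v).
Proof.
move=> z1; rewrite lerBlDr.
have -> : 1 = cabs ((1 - z / ecirc v) + z / ecirc v) by rewrite subrK cabs1.
apply: (le_trans (cabsD _ _)).
by rewrite [cabs (z / _)]cabsM cabsV cabs_ecirc invr1 mulr1.
Qed.

Lemma circle_kernel_neq0 (z : C) (v : R) : cabs z < 1 -> 1 - z / ecirc v != 0.
Proof.
move=> z1; rewrite -cabs_gt0; apply: lt_le_trans (cabs_circle_kernel v z1).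
by rewrite subr_gt0.
Qed.

Lemma inv_ecirc_continuous : continuous (fun v : R => (ecirc v)^-1).
Proof.
move=> v; apply: continuous_comp; first exact: ecirc_continuous.
by apply: inv_continuous; exact: ecirc_neq0.
Qed.

Lemma circle_kernel_continuous (z : C) : cabs z < 1 ->
  continuous (fun v : R => (1 - z / ecirc v)^-1).
Proof.
move=> z1 v; apply: (@continuous_comp _ _ _ (fun v : R => 1 - z / ecirc v) (fun x : C => x^-1)).
  apply: cvgB; first exact: cvg_cst.
  apply: (@continuousM _ _ (fun=> z) (fun v => (ecirc v)^-1)); first exact: cvg_cst.
  exact: inv_ecirc_continuous.
by apply: inv_continuous; exact: circle_kernel_neq0.
Qed.

Lemma geometric_kernel (x : C) N : 1 - x != 0 ->
  (1 - x)^-1 = \sum_(k < N) x ^+ k + x ^+ N / (1 - x).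
Proof.
move=> x1; apply: (mulfI x1); rewrite mulfV// mulrDr.
have E := subrX1 x N.
have -> : (1 - x) * \sum_(k < N) x ^+ k = 1 - x ^+ N.
  by rewrite -[1 - x]opprB mulNr -E opprB.
by rewrite mulrC mulfVK// subrK.
Qed.

(** Only the constant term of the geometric series has a nonzero mean. Finite sums with an explicit
    remainder take the place of an exchange of series and integral. *)
Lemma mean_circle_kernel (z : C) : cabs z < 1 ->
  cintegral leb `[0, 1] (fun v => (1 - z / ecirc v)^-1) = 1.
Proof.
move=> z1; apply/eqP; rewrite -subr_eq0; apply/eqP/cabs_le_eps => e e0.
have z10 : 0 < 1 - cabs z by rewrite subr_gt0.
have [N hN] : exists N, 2 / (1 - cabs z) * cabs z ^+ N.+1 < e.
  have zi : 0 <= cabs z < 1 by rewrite cabs_ge0.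
  by have [N hN] := geometric_small (2 / (1 - cabs z)) zi e0; exists N; exact: hN.
have cpow0 k : continuous (fun v : R => (ecirc v)^-1 ^+ k).
  exact: ccontinuousX inv_ecirc_continuous.
have cpow k : continuous (fun v => z ^+ k * (ecirc v)^-1 ^+ k).
  by apply: ccontinuousM (cpow0 k) => v; exact: cvg_cst.
have cker : continuous (fun v => z ^+ N.+1 * (ecirc v)^-1 ^+ N.+1 * (1 - z / ecirc v)^-1).
  exact: ccontinuousM (cpow N.+1) (circle_kernel_continuous z1).
have E : cintegral leb `[0, 1] (fun v => \sum_(k < N.+1) z ^+ k * (ecirc v)^-1 ^+ k) = 1.
  rewrite cintegral_sum; [|by []|by move=> i; exact: continuous_cintegrable (cpow i)].
  transitivity (\sum_(k < N.+1) z ^+ k * (k == 0%N :> nat)%:R : C).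
    apply: eq_bigr => k _; rewrite cintegralZ; [|by []|exact: continuous_cintegrable (cpow0 k)].
    by rewrite ecirc_power_mean.
  by rewrite big_ord_recl /= expr0 mul1r big1 ?addr0// => i _; rewrite mulr0.
have E2 : cintegral leb `[0, 1] (fun v => (1 - z / ecirc v)^-1) =
    cintegral leb `[0, 1] (fun v => \sum_(k < N.+1) z ^+ k * (ecirc v)^-1 ^+ k) +
    cintegral leb `[0, 1]
      (fun v => z ^+ N.+1 * (ecirc v)^-1 ^+ N.+1 * (1 - z / ecirc v)^-1).
  rewrite -cintegralD; [|by []| |]; last 2 first.
  - by apply: cintegrable_sum; [by []|move=> i; exact: continuous_cintegrable (cpow i)].
  - exact: continuous_cintegrable cker.
  apply: eq_cintegral => v _; rewrite [LHS](geometric_kernel N.+1) ?circle_kernel_neq0//.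
  by rewrite exprMn; congr (_ + _); apply: eq_bigr => k _; rewrite exprMn.
rewrite E2 E addrC addKr.
apply: le_trans (ltW hN).
have -> : 2 / (1 - cabs z) * cabs z ^+ N.+1 =
  2 * (cabs z ^+ N.+1 / (1 - cabs z) * (1 - 0)) by field; rewrite gt_eqF.
apply: cabs_cintegral_itv_le => // v _.
rewrite !cabsM !cabsX !cabsV cabs_ecirc invr1 expr1n mulr1.
apply: ler_wpM2l; first by rewrite exprn_ge0// cabs_ge0.
by rewrite lef_pV2 ?posrE ?cabs_gt0 ?circle_kernel_neq0// cabs_circle_kernel.
Qed.

(** The mean value property is applied to [psi w = w (phi w - phi z) / (w - z)], which vanishes at
    0; on the unit circle [w / (w - z)] is the kernel [1 / (1 - z / w)]. *)
Lemma Cauchy_formula (phi : C -> C) (z : C) :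
  (forall x, differentiable phi x) -> cabs z < 1 ->
  cintegral leb `[0, 1] (fun v => phi (ecirc v) / (1 - z / ecirc v)) = phi z.
Proof.
move=> dphi z1.
pose psi w := w * difference_quotient phi z w.
have cpsi : continuous psi.
  move=> w; apply: (@continuousM _ _ id (difference_quotient phi z)); first exact: cvg_id.
  exact: difference_quotient_continuous.
(* [z] is the only point where [psi] is not obviously differentiable, and [rho] is the radius of the
   circle through it. For [z = 0] the exceptional point is the centre, which [mean_value_circle]
   excludes anyway, and any positive radius will do. *)
pose rho := if z == 0 then 1 else cabs z.
have rho0 : 0 < rho by rewrite /rho; case: eqVneq => // z0; rewrite cabs_gt0.
have dpsi w : w != 0 -> cabs w != rho -> differentiable psi w.
  move=> w0 wrho; apply: (@differentiableM _ _ id (difference_quotient phi z)).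
    exact: differentiable_var.
  apply: difference_quotient_differentiable => //.
  move: wrho; rewrite /rho; case: (eqVneq z 0) => [->//|_].
  by apply: contra_neq => ->.
have := mean_value_circle cpsi rho0 dpsi ltr01.
rewrite /psi mul0r /circ_mean => H.
have cphi : continuous (fun v => phi (ecirc v)).
  move=> v; apply: continuous_comp; first exact: ecirc_continuous.
  exact: differentiable_continuous.
have cK := circle_kernel_continuous z1.
have cphiK : continuous (fun v => phi (ecirc v) / (1 - z / ecirc v)).
  exact: ccontinuousM cphi cK.
have : cintegral leb `[0, 1] (fun v => phi (ecirc v) / (1 - z / ecirc v)
    - phi z * (1 - z / ecirc v)^-1) = 0.
  rewrite -[RHS]H; apply: eq_cintegral => v _; rewrite mul1r.
  have ez : ecirc v != z.
    by apply/eqP => e; move: z1; rewrite -e cabs_ecirc ltxx.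
  rewrite /difference_quotient (negbTE ez) -mulrBl mulrCA; congr (_ * _).
  have e0 := ecirc_neq0 v.
  by field; rewrite e0 subr_eq0 ez.
have iK := continuous_cintegrable 0 1 cK.
rewrite cintegralB; [|by []|exact: continuous_cintegrable cphiK|exact: cintegrableZ iK].
rewrite (cintegralZ _ _ iK); last by [].
by rewrite mean_circle_kernel// mulr1 => /eqP; rewrite subr_eq0 => /eqP.
Qed.

Lemma kernel_remainder (p x e : C) : e != 0 -> e - x != 0 ->
  p / (1 - x / e) - p - x * (p / e) = p * (x / e) ^+ 2 / (1 - x / e).
Proof. by move=> e0 ex; field; rewrite e0 ex. Qed.

(** The kernel is expanded as [1 + x / e + (x / e)^2 / (1 - x / e)] under Cauchy's integral. In
    [4 * M] one factor 2 bounds the last denominator for [|x| <= 1/2], the other comes from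
    [cabs_cintegral_le]. Only a bound of [phi] on the unit disc enters. *)
Lemma Cauchy_second_order (phi : C -> C) (M : R) :
  (forall x, differentiable phi x) ->
  (forall x, cabs x <= 1 -> cabs (phi x) <= M) ->
  [/\ 'd phi (0 : C) (1 : C) = cintegral leb `[0, 1] (fun v => phi (ecirc v) / ecirc v),
      cabs ('d phi (0 : C) (1 : C)) <= 2 * M &
      forall x, cabs x <= 2^-1 ->
        cabs (phi x - phi 0 - 'd phi (0 : C) x) <= 4 * M * cabs x ^+ 2].
Proof.
move=> dphi phiM.
have cphi : continuous (fun v => phi (ecirc v)).
  move=> v; apply: continuous_comp; first exact: ecirc_continuous.
  exact: differentiable_continuous.
have cphie : continuous (fun v => phi (ecirc v) / ecirc v).
  exact: ccontinuousM cphi inv_ecirc_continuous.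
have M0 : 0 <= M by apply: (le_trans (cabs_ge0 (phi 0)) (phiM _ _)); rewrite cabs0.
pose A := cintegral leb `[0, 1] (fun v => phi (ecirc v) / ecirc v).
have A_le : cabs A <= 2 * M.
  have -> : 2 * M = 2 * (M * (1 - 0)) by rewrite subr0 mulr1.
  apply: cabs_cintegral_itv_le => // v _.
  by rewrite cabsM cabsV cabs_ecirc invr1 mulr1 phiM// cabs_ecirc.
have quad x : cabs x <= 2^-1 -> cabs (phi x - phi 0 - x * A) <= 4 * M * cabs x ^+ 2.
  move=> x2; have x1 : cabs x < 1 by apply: le_lt_trans x2 _; rewrite invf_lt1// ltr1n.
  have cK := circle_kernel_continuous x1.
  have cphiK : continuous (fun v => phi (ecirc v) / (1 - x / ecirc v)).
    exact: ccontinuousM cphi cK.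
  have E0 : phi 0 = cintegral leb `[0, 1] (fun v => phi (ecirc v)).
    rewrite -(Cauchy_formula dphi (_ : cabs 0 < 1)) ?cabs0//.
    by apply: eq_cintegral => v _; rewrite mul0r subr0 divr1.
  rewrite -(Cauchy_formula dphi x1) E0 /A.
  have cxA : continuous (fun v => x * (phi (ecirc v) / ecirc v)).
    by apply: ccontinuousM cphie => v; exact: cvg_cst.
  have iA := continuous_cintegrable 0 1 cphie.
  have iK := continuous_cintegrable 0 1 cphiK.
  have i0 := continuous_cintegrable 0 1 cphi.
  have iK0 : cintegrable leb `[0, 1]
      (fun v => phi (ecirc v) / (1 - x / ecirc v) - phi (ecirc v)).
    exact: cintegrableB.
  rewrite -(cintegralZ _ _ iA); last by [].
  rewrite -(cintegralB _ iK i0); last by [].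
  rewrite -(cintegralB _ iK0 (cintegrableZ _ _ iA)); [|by []..].
  have -> : 4 * M * cabs x ^+ 2 = 2 * (2 * M * cabs x ^+ 2 * (1 - 0)) by ring.
  apply: cabs_cintegral_itv_le => [|//|v _].
    exact: ccontinuousB (ccontinuousB cphiK cphi) cxA.
  have k0 := circle_kernel_neq0 v x1; have e0 := ecirc_neq0 v.
  rewrite (_ : _ - _ - _ = phi (ecirc v) * (x / ecirc v) ^+ 2 / (1 - x / ecirc v)); last first.
    apply: kernel_remainder => //; rewrite subr_eq0; apply/eqP => ex.
    by move: x1; rewrite -ex cabs_ecirc ltxx.
  rewrite cabsM [cabs (phi _ * _)]cabsM cabsX [cabs (x / _)]cabsM !cabsV cabs_ecirc invr1 mulr1 mulrAC.
  apply: ler_wpM2r; first by rewrite exprn_ge0 ?cabs_ge0.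
  rewrite mulrC; apply: ler_pM; rewrite ?invr_ge0 ?cabs_ge0 ?phiM ?cabs_ecirc//.
  rewrite invf_ple ?posrE ?cabs_gt0//.
  by apply: le_trans (cabs_circle_kernel v x1); lra.
(* The quadratic estimate is also what identifies the integral [A] with the derivative. *)
have dA h : 'd phi (0 : C) h = h * A.
  pose L : C -> C := fun h => h * A.
  have lL : linear L by move=> a u v; rewrite /L mulrDl scalerAl.
  pose L' : {linear C -> C} := HB.pack L (GRing.isLinear.Build C C C _ L lL).
  have [] // := @quad_differentiable _ _ phi 0 L' (4 * M) 2^-1 _ _ _.
  - by move=> y; exact: mulrr_continuous.
  - by move=> k kr; rewrite add0r; apply: quad; exact: ltW.
  by move=> _ ->.
split; [by rewrite dA mul1r|by rewrite dA mul1r|].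
by move=> x x2; rewrite dA; exact: quad.
Qed.

End CauchyFormula.

(** * Lebesgue measure on tuples *)

Section TupleMeasure.
Context {R : realType}.
Local Notation leb := (@lebesgue_measure R).
Local Notation mu n := (@lebesgue_tuple R n).

(* [measurableTypeR R], the domain of [lebesgue_measure], and [R] carry
   convertible sigma-algebras with distinct displays. *)
Lemma measurable_cons_pair n :
  measurable_fun [set: measurableTypeR R * n.-tuple R] (@cons_tuple_pair R n).
Proof. exact: measurable_cons_tuple_pair. Qed.

Lemma ge0_integral_tupleS n (f : n.+1.-tuple R -> \bar R) :
  measurable_fun setT f -> (forall t, 0 <= f t)%E ->
  (\int[mu n.+1]_t f t =
   \int[leb]_x \int[mu n]_t f (cons_tuple_pair (x, t)))%E.
Proof.
move=> mf f0.
have mc := @measurable_cons_pair n.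
transitivity (\int[leb \x mu n]_p (f \o @cons_tuple_pair R n) p)%E.
  transitivity (\int[pushforward (leb \x mu n) (@cons_tuple_pair R n)]_t f t)%E.
    by apply: eq_measure_integral.
  rewrite (@ge0_integral_pushforward _ _ _ _ _ _ mc)//.
rewrite fubini_tonelli1//; first exact: measurableT_comp.
by move=> p; exact: f0.
Qed.

Lemma integral_tuple0 (f : 0.-tuple R -> \bar R) :
  measurable_fun setT f -> (\int[mu 0]_t f t = f [tuple])%E.
Proof. by move=> mf; rewrite integral_dirac// diracT mul1e. Qed.

Lemma translation_measurable n (a : n.-tuple R) :
  measurable_fun setT (fun t : n.-tuple R => [tuple tnth t i + tnth a i | i < n]).
Proof.
apply/measurable_fun_tnthP => i.
rewrite (_ : _ \o _ = fun t => tnth t i + tnth a i).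
  by apply: measurable_funD => //; exact: measurable_tnth.
by apply/funext => t /=; rewrite tnth_mktuple.
Qed.

Lemma lebesgue_measure_translation (a : R) (A : set R) : measurable A ->
  leb ((fun x => x + a) @^-1` A) = leb A.
Proof.
move=> mA.
rewrite -[LHS]/(pushforward leb ((fun x => x + a) : _ -> measurableTypeR R) A).
apply/esym/lebesgue_measure_unique => //= [|mt _ [[u v]] _ <-].
  exact: measurable_funD.
rewrite /pushforward /=.
have -> : (fun x => x + a) @^-1` [set` `]u, v]] = [set` `](u - a), (v - a)]].
  by apply/seteqP; split => x /=; rewrite !in_itv/= ltrBlDr lerBrDr.
rewrite !lebesgue_measure_itv /= !lte_fin ltrD2r.
by case: ifP => // _; congr EFin; ring.
Qed.

(** Induction on the dimension: a translation acts separately on head and tail, and by uniqueness of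
    the product measure it is enough to compare measures of rectangles. *)
Lemma lebesgue_tuple_translation n (a : n.-tuple R) (A : set (n.-tuple R)) :
  measurable A ->
  mu n ((fun t : n.-tuple R => [tuple tnth t i + tnth a i | i < n]) @^-1` A) = mu n A.
Proof.
elim: n a A => [|n IH] a A mA.
  rewrite (_ : _ @^-1` A = A)//; apply/seteqP.
  by split => t /=; rewrite (tuple0 t) (tuple0 [tuple _ | _ < 0]).
set tau := (fun t : n.+1.-tuple R => _).
pose a0 := thead a; pose a' := [tuple of behead a].
set tau' := (fun t : n.-tuple R => [tuple tnth t i + tnth a' i | i < n]) in IH.
pose sigma (p : R * n.-tuple R) := (p.1 + a0, [tuple tnth p.2 i + tnth a' i | i < n]).
have tau_sigma : tau \o @cons_tuple_pair R n = @cons_tuple_pair R n \o sigma.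
  apply/funext => -[x t] /=; apply: eq_from_tnth => i; rewrite tnth_mktuple.
  case: (unliftP ord0 i) => [j ->|->]; last by rewrite /cons_tuple_pair /= !tnth0.
  rewrite /cons_tuple_pair !tnthS tnth_mktuple; congr (_ + _).
  by rewrite [tnth a _](tnth_nth 0) [RHS](tnth_nth 0) /= nth_behead.
have msigma : measurable_fun [set: measurableTypeR R * n.-tuple R]
    (sigma : _ -> (measurableTypeR R * n.-tuple R)%type).
  apply/measurable_fun_pairP; split => /=.
    by apply: measurable_funD => //; exact: measurable_fst.
  exact: (measurableT_comp (translation_measurable a') measurable_snd).
have mc := @measurable_cons_pair n.
rewrite /= /lebesgue_cons /pushforward.
rewrite -[X in _ X = _]/((tau \o @cons_tuple_pair R n) @^-1` A) tau_sigma.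
have mcA : measurable (@cons_tuple_pair R n @^-1` A).
  by rewrite -[X in measurable X]setTI; exact: mc.
rewrite -[LHS]/(pushforward (leb \x mu n)%E
  (sigma : _ -> (measurableTypeR R * n.-tuple R)%type) (@cons_tuple_pair R n @^-1` A)).
apply/esym; apply: product_measure_unique => // B1 B2 mB1 mB2.
rewrite -[LHS]/((leb \x mu n)%E (((fun x => x + a0) @^-1` B1) `*` (tau' @^-1` B2))).
rewrite product_measure1E//.
- by congr (_ * _)%E; [exact: lebesgue_measure_translation|exact: IH].
- by rewrite -[X in measurable X]setTI; exact: measurable_funD.
- by rewrite -[X in measurable X]setTI; exact: translation_measurable.
Qed.

Definition gaussw (e : R) (x : R) : R := expR (- (e * x ^+ 2)).

Lemma measurable_gaussw e : measurable_fun setT (gaussw e).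
Proof.
apply: measurableT_comp => //; apply: measurableT_comp => //.
by apply: measurable_funM => //; exact: measurable_funX.
Qed.

(** [gaussw e] is, up to a constant factor, the centred normal density of variance [1 / (2 e)]. *)
Lemma integrable_gaussw (e : R) : 0 < e -> leb.-integrable setT (EFin \o gaussw e).
Proof.
move=> e0; pose s := Num.sqrt (2 * e)^-1.
have e2 : 0 < (2 * e)^-1 by rewrite invr_gt0 mulr_gt0.
have s0 : s != 0 by rewrite gt_eqF// sqrtr_gt0.
have := integrable_normal_pdf 0 s.
move=> /(integrableZl measurableT (normal_peak s)^-1).
apply: eq_integrable => // x _ /=.
rewrite normal_pdfE// -EFinM mulKf ?gt_eqF ?normal_peak_gt0//.
rewrite /normal_fun subr0 /gaussw; congr (expR _)%:E.
rewrite sqr_sqrtr ?ltW//; field; rewrite gt_eqF//.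
Qed.

Lemma integrable_prod_tuple n (g : R -> R) :
  measurable_fun setT g -> (forall x, 0 <= g x) -> leb.-integrable setT (EFin \o g) ->
  (mu n).-integrable setT (EFin \o (fun t : n.-tuple R => \prod_i g (tnth t i))).
Proof.
move=> mg g0 ig.
have mprod m : measurable_fun setT (fun t : m.-tuple R => \prod_i g (tnth t i)).
  apply: measurable_prod => i _; apply: measurableT_comp => //; exact: measurable_tnth.
have prod0 m (t : m.-tuple R) : 0 <= \prod_i g (tnth t i) by exact: prodr_ge0.
elim: n => [|n IH].
  apply/integrableP; split; first by apply/measurable_EFinP; exact: mprod.
  under eq_integral do rewrite gee0_abs ?lee_fin//.
  by rewrite integral_tuple0 ?ltry//; apply/measurable_EFinP; exact: mprod.
apply/integrableP; split; first by apply/measurable_EFinP; exact: mprod.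
under eq_integral do rewrite gee0_abs ?lee_fin//.
rewrite ge0_integral_tupleS; [|by apply/measurable_EFinP; exact: mprod
  |by move=> t; rewrite lee_fin prod0].
have E x : (\int[mu n]_t (\prod_i g (tnth (cons_tuple_pair (x, t)) i))%:E =
    (g x)%:E * \int[mu n]_t (\prod_i g (tnth t i))%:E)%E.
  rewrite -ge0_integralZl_EFin//; last 2 first.
  - by move=> t _; rewrite lee_fin prod0.
  - by apply/measurable_EFinP; exact: mprod.
  apply: eq_integral => t _; rewrite big_ord_recl EFinM; congr (_ * _)%E.
  by congr EFin; apply: eq_bigr => i _; rewrite tnthS.
under eq_integral do rewrite E.
have [c cE] : exists c, (\int[mu n]_t (\prod_i g (tnth t i))%:E = c%:E)%E.
  by exists (fine (\int[mu n]_t (\prod_i g (tnth t i))%:E)); rewrite fineK// integrable_fin_num.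
have c0 : 0 <= c by rewrite -lee_fin -cE; apply: integral_ge0 => t _; rewrite lee_fin.
rewrite cE ge0_integralZr//; [|exact/measurable_EFinP|by move=> x _; rewrite lee_fin].
rewrite lte_mul_pinfty//; first by apply: integral_ge0 => x _; rewrite lee_fin.
  by rewrite integrable_fin_num.
by rewrite ltry.
Qed.

(** [r k] rounds each coordinate down to a multiple of [1 / (k + 1)]. The composite [f \o r k] takes
    countably many values, each on a union of boxes measurable for the product structure, and it
    tends to [f] pointwise by continuity. *)
Lemma continuous_measurable_rV n (f : 'rV[R]_n -> R) : continuous f ->
  measurable_fun setT (f \o @rV_of_tuple R n).
Proof.
move=> cf.
pose r (k : nat) (x : 'rV[R]_n) : 'rV[R]_n :=
  \row_j ((Num.floor (x 0 j * k.+1%:R))%:~R / k.+1%:R).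
apply: (@measurable_fun_cvg _ _ _ setT (fun k => f \o r k \o @rV_of_tuple R n)).
- move=> k _ B mB; rewrite setTI.
  pose pt (q : {ffun 'I_n -> int}) : 'rV[R]_n := \row_j ((q j)%:~R / k.+1%:R).
  pose box (q : {ffun 'I_n -> int}) : set (n.-tuple R) :=
    \bigcap_(j in [set: 'I_n]) ((fun t : n.-tuple R => tnth t j) @^-1`
      [set x | (q j)%:~R <= x * k.+1%:R < (q j + 1)%:~R]).
  have -> : (f \o r k \o rV_of_tuple (n:=n)) @^-1` B =
      \bigcup_q (if `[< B (f (pt q)) >] then box q else set0).
    apply/seteqP; split => t /=.
      move=> Bt; exists [ffun j => Num.floor (tnth t j * k.+1%:R)] => //.
      rewrite ifT; last first.
        apply/asboolP; move: Bt; congr (B (f _)).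
        by apply/rowP => j; rewrite !mxE ffunE.
      by move=> j _ /=; rewrite ffunE floor_itv.
    move=> [q _]; case: ifPn => // /asboolP Bq tq.
    move: Bq; congr (B (f _)); apply/rowP => j; rewrite !mxE; congr (_%:~R / _).
    by apply/esym/floor_def; exact: (tq j I).
  apply: countable_bigcupT_measurable; first exact: countableP.
  move=> q; case: ifP => // _.
  apply: fin_bigcap_measurable; first exact: finite_finset.
  move=> j _; rewrite -[X in measurable X]setTI; apply: measurable_tnth => //.
  rewrite (_ : mkset _ = `[(q j)%:~R / k.+1%:R, (q j + 1)%:~R / k.+1%:R[%classic)//.
  by apply/seteqP; split => x /=; rewrite in_itv/= ler_pdivrMr// ltr_pdivlMr.
- move=> t _ /=.
  apply: (cvg_comp (fun k => r k (rV_of_tuple t)) f _ (cf _)).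
  apply/cvgrPdist_le => e e0.
  near=> k.
  rewrite [leLHS]/Num.norm /= mx_normrE; apply/bigmax_leP; split; first exact: ltW.
  move=> [i j] _ /=; rewrite !mxE.
  set x := tnth t j.
  have k0 : 0 < k.+1%:R :> R by [].
  have /andP[h1 h2] := floor_itv (x * k.+1%:R).
  have -> : x - (Num.floor (x * k.+1%:R))%:~R / k.+1%:R =
     (x * k.+1%:R - (Num.floor (x * k.+1%:R))%:~R) / k.+1%:R by field.
  rewrite ger0_norm; last by rewrite divr_ge0// subr_ge0.
  rewrite ler_pdivrMr//; apply: (@le_trans _ _ 1).
    by rewrite lerBlDl; move: h2; rewrite intrD addrC => /ltW; rewrite addrC.
  rewrite -ler_pdivrMl// mulr1; apply: ltW; apply: lt_le_trans (_ : k%:R <= _); last by rewrite ler_nat.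
  near: k; exact: nbhs_infty_gtr.
Unshelve. all: by end_near. Qed.

End TupleMeasure.

(** * Entire functions of several variables *)

Section EntireFunctions.
Context {R : realType}.
Local Notation C := R[i].
Local Notation leb := (@lebesgue_measure R).

Lemma entire_line n (f : 'rV[C]_n -> C) (x v : 'rV[C]_n) (l : C) : entire f ->
  differentiable (fun l : C => f (x + l *: v)) l /\
  'd (fun l : C => f (x + l *: v)) l (1 : C) = 'd f (x + l *: v) v.
Proof.
move=> ef; set c := 'd f (x + l *: v) v.
pose L : C -> C := fun h => h * c.
have lL : linear L by move=> a u w; rewrite /L mulrDl scalerAl.
pose L' : {linear C -> C} := HB.pack L (GRing.isLinear.Build C C C _ L lL).
have [] // := @eps_differentiable _ _ (fun l : C => f (x + l *: v)) l L'.
- by move=> y; exact: mulrr_continuous.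
- move=> e e0; have v1 : 0 < rnorm v + 1 by rewrite ltr_wpDl// rnorm_ge0.
  have [r r0 H] := differentiable_eps (ef (x + l *: v)) (divr_gt0 e0 v1).
  exists (r / (rnorm v + 1)); first exact: divr_gt0.
  move=> h; rewrite rnormC ltr_pdivlMr// => hr.
  have hv : rnorm (h *: v) <= cabs h * (rnorm v + 1).
    by rewrite rnormZ ler_wpM2l ?cabs_ge0// lerDl.
  have := H (h *: v) (le_lt_trans hv hr).
  rewrite linearZ /= [(l + h) *: v]scalerDl addrA => /le_trans; apply.
  rewrite mulrAC ler_pdivrMr// -mulrA; apply: ler_wpM2l => //; exact: ltW.
- by move=> df dE; split=> //; rewrite dE /= /L mul1r.
Qed.

Definition pd n (v : 'rV[C]_n) (f : 'rV[C]_n -> C) (x : 'rV[C]_n) : C := 'd f x v.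

Lemma entire_continuous n (f : 'rV[C]_n -> C) : entire f -> continuous f.
Proof. by move=> ef x; exact: differentiable_continuous (ef x). Qed.

(** [Cauchy_second_order] is applied on each complex line through [x]. Since the constants involve
    only a bound of [f] on the unit ball around [x], the estimates can be integrated over a
    parameter. *)
Lemma entire_second_order n (f : 'rV[C]_n -> C) (x : 'rV[C]_n) (M : R) : entire f ->
  (forall y, rnorm (y - x) <= 1 -> cabs (f y) <= M) ->
  (forall h, cabs ('d f x h) <= 2 * M * rnorm h) /\
  forall h, rnorm h <= 2^-1 -> cabs (f (x + h) - f x - 'd f x h) <= 4 * M * rnorm h ^+ 2.
Proof.
move=> ef fM.
have unit_dir h : h != 0 -> exists2 v : 'rV[C]_n, rnorm v = 1 & h = (rnorm h)%:C *: v.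
  move=> h0; have nh0 : (rnorm h)%:C != 0 :> C.
    by rewrite -rnormE normr_eq0.
  exists ((rnorm h)%:C^-1 *: h); last by rewrite scalerA mulfV// scale1r.
  rewrite rnormZ cabsV cabsR ger0_norm ?rnorm_ge0// mulVf//.
  by apply: contra_neq nh0 => ->.
have key v : rnorm v = 1 -> cabs ('d f x v) <= 2 * M /\
    forall l : C, cabs l <= 2^-1 ->
      cabs (f (x + l *: v) - f x - l * 'd f x v) <= 4 * M * cabs l ^+ 2.
  move=> v1.
  have [] := @Cauchy_second_order R (fun l : C => f (x + l *: v)) M.
  - by move=> l; have [] := entire_line x v l ef.
  - move=> l l1; apply: fM; rewrite addrAC subrr add0r rnormZ v1 mulr1//.
  have [_] := entire_line x v 0 ef; rewrite scale0r addr0 => -> _ d1 H.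
  split=> // l /H; rewrite diffC.
  by have [_ ->] := entire_line x v 0 ef; rewrite scale0r addr0.
split=> h.
  have [->|h0] := eqVneq h 0; first by rewrite linear0 cabs0 /rnorm normr0 mulr0.
  have [v v1 hE] := unit_dir h h0; have [d1 _] := key v v1.
  rewrite {1}hE linearZ cabsM cabsR ger0_norm ?rnorm_ge0// mulrC ler_wpM2r ?rnorm_ge0//.
have [->|h0] := eqVneq h 0.
  by rewrite addr0 subrr linear0 subr0 cabs0 /rnorm normr0 expr0n/= mulr0.
have [v v1 hE] := unit_dir h h0; have [_ H] := key v v1 => h2.
have := H (rnorm h)%:C; rewrite cabsR ger0_norm ?rnorm_ge0// -hE => /(_ h2).
have -> : 'd f x h = (rnorm h)%:C * 'd f x v by rewrite {1}hE linearZ.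
by [].
Qed.

Definition cbox (r : R) : set C := [set z | `|complex.Re z| <= r /\ `|complex.Im z| <= r].

Lemma compact_cbox r : compact (cbox r).
Proof.
have -> : cbox r = (fun p : R * R => p.1 +i* p.2) @` (`[- r, r] `*` `[- r, r]).
  apply/seteqP; split => [z [z1 z2]|_ [[a b] [/= a1 b1] <-]].
    exists (complex.Re z, complex.Im z); last by case: (z).
    by rewrite /= !in_itv/= -!ler_norml.
  by move: a1 b1; rewrite /cbox /= !in_itv/= -!ler_norml.
apply: continuous_compact; last by apply: compact_setX; exact: segment_compact.
apply: continuous_subspaceT => p.
by apply: complex_continuous; [exact: cvg_fst|exact: cvg_snd].
Qed.

Lemma compact_continuous_bounded n (f : 'rV[C]_n -> C) (K : set 'rV[C]_n) :
  compact K -> continuous f -> exists2 M, 0 <= M & forall x, K x -> cabs (f x) <= M.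
Proof.
move=> Kc cf.
have : compact ((fun x => cabs (f x)) @` K).
  apply: continuous_compact Kc; apply: continuous_subspaceT => x.
  apply: (@continuous_comp _ _ _ f (@cabs R)); first exact: cf.
  move=> A /nbhs_normP[e /= e0 H]; apply/nearCP; exists e => // h he; apply: H => /=.
  move: he; rewrite rnormC => he; apply: le_lt_trans he.
  rewrite ler_norml; apply/andP; split.
    by rewrite lerNl opprB lerBlDr addrC; exact: cabsD.
  by rewrite lerBlDr -{1}(addrK h (f x)) [leRHS]addrC cabsB.
move=> /compact_bounded[M [_ HM]].
exists (`|M| + 1) => [|x Kx]; first by rewrite addr_ge0.
apply: (le_trans (ler_norm _)); apply: (HM (`|M| + 1)).
  by rewrite (le_lt_trans (ler_norm _))// ltrDl.
by exists x.
Qed.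

Lemma continuous_bounded n (f : 'rV[C]_n -> C) (r : R) : continuous f ->
  exists2 M, 0 <= M & forall x, rnorm x <= r -> cabs (f x) <= M.
Proof.
move=> cf.
have Kc : compact [set v : 'rV[C]_n | forall i, cbox r (v ord0 i)].
  by apply: (@rV_compact _ _ (fun=> cbox r)) => _; exact: compact_cbox.
have [M M0 HM] := compact_continuous_bounded Kc cf.
exists M => // x xr; apply: HM => i; split.
  exact: le_trans (Re_le_cabs _) (le_trans (cabs_le_rnorm x i) xr).
exact: le_trans (Im_le_cabs _) (le_trans (cabs_le_rnorm x i) xr).
Qed.

Lemma entire_derivative_circle n (f : 'rV[C]_n -> C) (x v : 'rV[C]_n) : entire f ->
  'd f x v = cintegral leb `[0, 1] (fun t => f (x + ecirc t *: v) / ecirc t).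
Proof.
move=> ef; have dl l := (entire_line x v l ef).1.
have [_] := entire_line x v 0 ef; rewrite scale0r addr0 => <-.
have [M M0 HM] := continuous_bounded (rnorm x + rnorm v) (entire_continuous ef).
have HM' l : cabs l <= 1 -> cabs (f (x + l *: v)) <= M.
  move=> l1; apply: HM; apply: (le_trans (rnormD _ _)).
  by rewrite lerD2l rnormZ ler_piMl ?rnorm_ge0.
by have [h _ _] := Cauchy_second_order dl HM'; exact: h.
Qed.

Section parametric.
Context {disp} {T : measurableType disp} (mu : {measure set T -> \bar R}).
Context (D : set T) (mD : measurable D).

Lemma cmeasurable_cvg (f_ : nat -> T -> C) (f : T -> C) :
  (forall k, cmeasurable D (f_ k)) ->
  (forall t, D t -> forall e : R, 0 < e ->
     exists N, forall k, (N <= k)%N -> cabs (f t - f_ k t) <= e) ->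
  cmeasurable D f.
Proof.
move=> mf_ cf; split.
- apply: (@measurable_fun_cvg _ _ _ D (fun k t => complex.Re (f_ k t))).
    by move=> k; have [] := mf_ k.
  move=> t Dt; apply/cvgrPdist_le => e e0; have [N HN] := cf t Dt e e0.
  exists N => // k /= Nk; rewrite -RecN -RecD.
  exact: le_trans (Re_le_cabs _) (HN k Nk).
- apply: (@measurable_fun_cvg _ _ _ D (fun k t => complex.Im (f_ k t))).
    by move=> k; have [] := mf_ k.
  move=> t Dt; apply/cvgrPdist_le => e e0; have [N HN] := cf t Dt e e0.
  exists N => // k /= Nk; rewrite -ImcN -ImcD.
  exact: le_trans (Im_le_cabs _) (HN k Nk).
Qed.

Context n (K : 'rV[C]_n -> T -> C).
Hypothesis mK : forall x, cmeasurable D (K x).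
Hypothesis eK : forall t, D t -> entire (K ^~ t).
Hypothesis domK : forall r : R, exists2 M : T -> R, mu.-integrable D (EFin \o M) &
  forall x t, rnorm x <= r -> D t -> cabs (K x t) <= M t.

Lemma cintegrable_parametric x : cintegrable mu D (K x).
Proof.
have [M iM KM] := domK (rnorm x).
by apply: (@cintegrable_dominated _ _ _ _ _ mD _ M) => // t; exact: KM.
Qed.

(** The derivative is a limit of difference quotients along [v / (k + 1)], hence measurable;
    Cauchy's estimate dominates it by the function that dominates [K] on the ball of radius
    [rnorm x + 1]. *)
Lemma cintegrable_parametric_diff x v : cintegrable mu D (fun t => 'd (K ^~ t) x v).
Proof.
have [M iM KM] := domK (rnorm x + 1).
have near_x t : D t -> forall y, rnorm (y - x) <= 1 -> cabs (K y t) <= M t.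
  move=> Dt y yx; apply: KM => //; rewrite -[y](subrK x) addrC.
  by apply: (le_trans (rnormD _ _)); rewrite lerD2l.
have iM2 : mu.-integrable D (EFin \o (fun t => 2 * rnorm v * M t)).
  apply: eq_integrable (integrableZl mD (2 * rnorm v) iM) => //.
apply: (@cintegrable_dominated _ _ _ _ _ mD _ (fun t => 2 * rnorm v * M t)) => //; last first.
  move=> t Dt; have [H _] := entire_second_order (eK Dt) (near_x t Dt).
  by rewrite mulrAC.
apply: (@cmeasurable_cvg (fun k t => k.+1%:R * (K (x + k.+1%:R^-1 *: v) t - K x t))).
  move=> k; exact: cmeasurableM (cmeasurable_cst _ _) (cmeasurableB (mK _) (mK _)).
move=> t Dt e e0.
have v1 : 0 < rnorm v + 1 by rewrite ltr_wpDl// rnorm_ge0.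
have [r r0 H] := differentiable_eps (eK Dt x) (divr_gt0 e0 v1).
have [N hN] : exists N, (rnorm v + 1) / r < N%:R.
  by exists (Num.bound ((rnorm v + 1) / r)); rewrite archi_boundP// divr_ge0 ?ltW.
exists N => k Nk.
have k0 : 0 < k.+1%:R :> R by [].
have kv : rnorm (k.+1%:R^-1 *: v) < r.
  rewrite rnormZ cabsV cabs_nat mulrC ltr_pdivrMr//.
  apply: (@lt_trans _ _ (rnorm v + 1)); first by rewrite ltrDl.
  rewrite mulrC -ltr_pdivrMr//; apply: (lt_le_trans hN).
  by rewrite ler_nat; exact: leq_trans Nk (leqnSn k).
have kn : k.+1%:R != 0 :> C by rewrite pnatr_eq0.
have -> : 'd (K^~ t) x v - k.+1%:R * (K (x + k.+1%:R^-1 *: v) t - K x t) =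
  - (k.+1%:R * (K (x + k.+1%:R^-1 *: v) t - K x t - 'd (K^~ t) x (k.+1%:R^-1 *: v))).
  have -> : 'd (K^~ t) x (k.+1%:R^-1 *: v) = k.+1%:R^-1 * 'd (K^~ t) x v by rewrite linearZ.
  by rewrite [in RHS]mulrBr mulVKf//; ring.
rewrite cabsN cabsM cabs_nat.
apply: (@le_trans _ _ (k.+1%:R * (e / (rnorm v + 1) * rnorm (k.+1%:R^-1 *: v)))).
  by apply: ler_wpM2l => //; exact: H.
rewrite rnormZ cabsV cabs_nat mulrCA [_^-1 * _]mulrC -mulrA [_ * (_ * _)]mulrA.
have -> : e / (rnorm v + 1) * (k.+1%:R * (rnorm v * k.+1%:R^-1)) =
    e * (rnorm v / (rnorm v + 1)) by field; rewrite gt_eqF//= gt_eqF.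
rewrite ler_piMr ?(ltW e0)// ler_pdivrMr// mul1r lerDl//.
Qed.

(** The quadratic remainder of each [K ^~ t] depends on [t] only through the dominating function, so
    it integrates to a quadratic remainder of the integral. *)
Lemma entire_parametric :
  entire (fun x => cintegral mu D (K x)) /\
  forall x v, 'd (fun x => cintegral mu D (K x)) x v =
    cintegral mu D (fun t => 'd (K ^~ t) x v).
Proof.
suff key x : differentiable (fun x => cintegral mu D (K x)) x /\
    'd (fun x => cintegral mu D (K x)) x = (fun v => cintegral mu D (fun t => 'd (K ^~ t) x v))
      :> ('rV[C]_n -> C).
  by split=> [x|x v]; [exact: (key x).1|exact: (congr1 (fun F => F v) (key x).2)].
pose L (v : 'rV[C]_n) := cintegral mu D (fun t => 'd (K ^~ t) x v).
have iL v := cintegrable_parametric_diff x v.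
have lL : linear L.
  move=> a u v; transitivity (a * L u + L v); last by [].
  rewrite /L -(cintegralZ mD _ (iL u)) -(cintegralD mD (cintegrableZ mD _ (iL u)) (iL v)).
  by apply: eq_cintegral => t _; rewrite linearP.
pose L' : {linear 'rV[C]_n -> C} := HB.pack L (GRing.isLinear.Build C 'rV[C]_n C _ L lL).
have [M iM KM] := domK (rnorm x + 1).
have near_x t : D t -> forall y, rnorm (y - x) <= 1 -> cabs (K y t) <= M t.
  move=> Dt y yx; apply: KM => //; rewrite -[y](subrK x) addrC.
  by apply: (le_trans (rnormD _ _)); rewrite lerD2l.
apply: (@quad_differentiable _ _ _ x L' (2 * (4 * \int[mu]_(t in D) M t)) 2^-1).
- by rewrite invr_gt0.
- exact: linearC_continuous.
move=> h h2.
have iKh := cintegrable_parametric (x + h); have iK0 := cintegrable_parametric x.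
rewrite /= /L -cintegralB// -cintegralB//; last exact: cintegrableB.
have -> : 2 * (4 * \int[mu]_(t in D) M t) * rnorm h ^+ 2 =
    2 * \int[mu]_(t in D) (4 * rnorm h ^+ 2 * M t).
  by rewrite RintegralZl//; ring.
apply: cabs_cintegral_le => //.
- apply: cintegrable_measurable.
  by apply: cintegrableB => //; exact: cintegrableB.
- by apply: eq_integrable (integrableZl mD (4 * rnorm h ^+ 2) iM) => //.
move=> t Dt; have [_ H] := entire_second_order (eK Dt) (near_x t Dt).
by rewrite mulrAC; apply: H; exact: ltW.
Qed.

End parametric.

Lemma entire_shift n (f : 'rV[C]_n -> C) (a : 'rV[C]_n) : entire f ->
  entire (fun x => f (x + a)) /\
  forall x v, 'd (fun x => f (x + a)) x v = 'd f (x + a) v.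
Proof.
move=> ef; suff key x : differentiable (fun x => f (x + a)) x /\
    'd (fun x => f (x + a)) x = 'd f (x + a) :> ('rV[C]_n -> C).
  by split=> [x|x v]; [exact: (key x).1|exact: (congr1 (fun F => F v) (key x).2)].
have /diff_locallyP[cL _] := ef (x + a).
apply: eps_differentiable => // e e0.
have [r r0 H] := differentiable_eps (ef (x + a)) e0; exists r => // h hr.
by have -> : x + h + a = x + a + h; [rewrite addrAC|exact: H].
Qed.

Lemma entireZ n (f : 'rV[C]_n -> C) (c : C) : entire f ->
  entire (fun x => c * f x) /\ forall x v, 'd (fun x => c * f x) x v = c * 'd f x v.
Proof.
move=> ef; suff key x : differentiable (fun x => c * f x) x /\
    'd (fun x => c * f x) x = (fun v => c * 'd f x v) :> ('rV[C]_n -> C).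
  by split=> [x|x v]; [exact: (key x).1|exact: (congr1 (fun F => F v) (key x).2)].
pose L (v : 'rV[C]_n) := c * 'd f x v.
have lL : linear L by move=> a u v; rewrite /L linearP mulrDr; congr (_ + _); exact: mulrCA.
pose L' : {linear 'rV[C]_n -> C} := HB.pack L (GRing.isLinear.Build C 'rV[C]_n C _ L lL).
apply: (@eps_differentiable _ _ _ _ L') => [|e e0]; first exact: linearC_continuous.
have c1 : 0 < cabs c + 1 by rewrite ltr_wpDl// cabs_ge0.
have [r r0 H] := differentiable_eps (ef x) (divr_gt0 e0 c1); exists r => // h hr.
rewrite /= /L -!mulrBr cabsM.
apply: (@le_trans _ _ ((cabs c + 1) * (e / (cabs c + 1) * rnorm h))).
  by apply: ler_pM; rewrite ?cabs_ge0 ?lerDl//; exact: H.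
by rewrite mulrA mulrCA mulfV ?gt_eqF// mulr1.
Qed.

(* A directional derivative is a circular mean of translates, so that its
   differentiability and the symmetry of second derivatives pass under the
   integral sign. *)
Lemma entire_diff n (f : 'rV[C]_n -> C) (v : 'rV[C]_n) : entire f ->
  entire (pd v f) /\ forall w, pd w (pd v f) = pd v (pd w f).
Proof.
move=> ef.
have key v' : entire (pd v' f) /\
    forall x w, pd w (pd v' f) x =
      cintegral leb `[0, 1] (fun t => pd w f (x + ecirc t *: v') / ecirc t).
  pose K (x : 'rV[C]_n) (t : R) := (ecirc t)^-1 * f (x + ecirc t *: v').
  have KE : pd v' f = (fun x => cintegral leb `[0, 1] (K x)).
    apply/funext => x; rewrite [LHS]entire_derivative_circle//.
    by apply: eq_cintegral => t _; rewrite /K mulrC.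
  have eS t := entire_shift (ecirc t *: v') ef.
  have eK t := entireZ (ecirc t)^-1 (eS t).1.
  have cK x : continuous (K x).
    apply: ccontinuousM; first exact: inv_ecirc_continuous.
    have cl : continuous (fun l : C => f (x + l *: v')).
      by move=> l; exact: differentiable_continuous (entire_line x v' l ef).1.
    exact: ccontinuous_comp (@ecirc_continuous R) cl.
  have mK x : cmeasurable (`[0, 1]%classic : set (measurableTypeR R)) (K x).
    exact: cintegrable_measurable (continuous_cintegrable 0 1 (cK x)).
  have domK r : exists2 M : measurableTypeR R -> R, leb.-integrable `[0, 1] (EFin \o M) &
      forall x t, rnorm x <= r -> `[0, 1]%classic t -> cabs (K x t) <= M t.
    have [M M0 HM] := continuous_bounded (r + rnorm v') (entire_continuous ef).
    exists (fun=> M); first exact: integrable_itv_cst.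
    move=> x t xr _; rewrite /K cabsM cabsV cabs_ecirc invr1 mul1r; apply: HM.
    by apply: (le_trans (rnormD _ _)); rewrite rnormZ cabs_ecirc mul1r lerD2r.
  have mI : measurable (`[0, 1]%classic : set (measurableTypeR R)) by [].
  have [e1 e2] := entire_parametric mI mK (fun t _ => (eK t).1) domK.
  rewrite KE; split=> // x w.
  have dS t : pd w (fun x => f (x + ecirc t *: v')) x = pd w f (x + ecirc t *: v').
    exact: (eS t).2.
  have dK t : pd w (K^~ t) x = (ecirc t)^-1 * pd w (fun x => f (x + ecirc t *: v')) x.
    exact: (eK t).2.
  have dK' t : pd w (K^~ t) x = pd w f (x + ecirc t *: v') / ecirc t.
    by rewrite dK dS mulrC.
  transitivity (cintegral leb `[0, 1] (fun t => pd w (K^~ t) x)); first exact: e2.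
  by apply: eq_cintegral => t _; exact: dK'.
split=> [|w]; first exact: (key v).1.
(* The integral representing [pd w (pd v f)] is Cauchy's formula for the derivative of [pd w f]
   along [v]; this is the symmetry. *)
apply/funext => x; rewrite (key v).2; apply/esym.
exact: entire_derivative_circle (key w).1.
Qed.

End EntireFunctions.

(** * Affine substitution, products and iterated derivatives of entire functions *)

Section EntireCalculus.
Context {R : realType}.
Local Notation C := R[i].
Local Notation leb := (@lebesgue_measure R).

Lemma mulmx_bound m n (A : 'M[C]_(m, n)) :
  exists2 K : R, 0 <= K & forall v : 'rV[C]_m, rnorm (v *m A) <= K * rnorm v.
Proof.
have K0 : 0 <= \sum_i \sum_j cabs (A i j).
  by apply: sumr_ge0 => i _; apply: sumr_ge0 => j _; exact: cabs_ge0.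
exists (\sum_i \sum_j cabs (A i j)) => // v.
apply: rnorm_le => [|j]; first by rewrite mulr_ge0// rnorm_ge0.
rewrite mxE; apply: (le_trans (cabs_sum _ _ _)).
rewrite mulr_suml; apply: ler_sum => i _; rewrite cabsM mulrC.
apply: ler_pM; rewrite ?cabs_ge0//; last exact: cabs_le_rnorm.
by rewrite (bigD1 j)//= lerDl; apply: sumr_ge0 => k _; exact: cabs_ge0.
Qed.

Lemma entire_affine m n (f : 'rV[C]_n -> C) (A : 'M[C]_(m, n)) (b : 'rV[C]_n) :
  entire f -> entire (fun x => f (x *m A + b)) /\
  forall v, pd v (fun x => f (x *m A + b)) = fun x => pd (v *m A) f (x *m A + b).
Proof.
move=> ef; suff key x : differentiable (fun x => f (x *m A + b)) x /\
    'd (fun x => f (x *m A + b)) x = (fun v => pd (v *m A) f (x *m A + b)) :> ('rV[C]_m -> C).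
  split=> [x|v]; first exact: (key x).1.
  by apply/funext => x; exact: (congr1 (fun F => F v) (key x).2).
pose L (v : 'rV[C]_m) := pd (v *m A) f (x *m A + b).
have lL : linear L.
  by move=> a u v; rewrite /L /pd mulmxDl -scalemxAl linearP.
pose L' : {linear 'rV[C]_m -> C} := HB.pack L (GRing.isLinear.Build C 'rV[C]_m C _ L lL).
apply: (@eps_differentiable _ _ _ _ L') => [|e e0]; first exact: linearC_continuous.
have [K K0 HK] := mulmx_bound A.
have K1 : 0 < K + 1 by rewrite ltr_wpDl.
have [r r0 H] := differentiable_eps (ef (x *m A + b)) (divr_gt0 e0 K1).
exists (r / (K + 1)); first exact: divr_gt0.
move=> h; rewrite ltr_pdivlMr// => hr.
have hA : rnorm (h *m A) <= rnorm h * (K + 1).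
  by apply: (le_trans (HK h)); rewrite mulrDr mulr1 mulrC lerDl rnorm_ge0.
have := H (h *m A) (le_lt_trans hA hr).
rewrite (_ : x *m A + b + h *m A = (x + h) *m A + b); last by rewrite mulmxDl addrAC.
move=> /le_trans; apply.
by rewrite mulrAC ler_pdivrMr// -mulrA; apply: ler_wpM2l => //; exact: ltW.
Qed.

Lemma entire_cst n (c : C) : entire (fun _ : 'rV[C]_n => c).
Proof. by move=> x; exact: differentiable_cst. Qed.

Lemma entire_coord n (j : 'I_n) : entire (fun x : 'rV[C]_n => x 0 j).
Proof.
move=> x; pose L (v : 'rV[C]_n) : C := v 0 j.
have lL : linear L by move=> a u v; rewrite /L !mxE.
pose L' : {linear 'rV[C]_n -> C} := HB.pack L (GRing.isLinear.Build C 'rV[C]_n C _ L lL).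
exact: (@linear_differentiable _ _ _ L' x (@linearC_continuous _ _ L')).
Qed.

Lemma entireD n (f g : 'rV[C]_n -> C) : entire f -> entire g ->
  entire (fun x => f x + g x).
Proof. by move=> ef eg x; exact: differentiableD (ef x) (eg x). Qed.

Lemma entireN n (f : 'rV[C]_n -> C) : entire f -> entire (fun x => - f x).
Proof. by move=> ef x; exact: differentiableN (ef x). Qed.

Lemma entireM n (f g : 'rV[C]_n -> C) : entire f -> entire g ->
  entire (fun x => f x * g x).
Proof. by move=> ef eg x; exact: differentiableM (ef x) (eg x). Qed.

Lemma entire_sum n I (r : seq I) (F : I -> 'rV[C]_n -> C) :
  (forall i, entire (F i)) -> entire (fun x => \sum_(i <- r) F i x).
Proof.
move=> eF; elim: r => [|i r IH].
  by under eq_fun do rewrite big_nil; exact: entire_cst.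
by under eq_fun do rewrite big_cons; exact: entireD.
Qed.

Lemma entire_prod n I (r : seq I) (F : I -> 'rV[C]_n -> C) :
  (forall i, entire (F i)) -> entire (fun x => \prod_(i <- r) F i x).
Proof.
move=> eF; elim: r => [|i r IH].
  by under eq_fun do rewrite big_nil; exact: entire_cst.
by under eq_fun do rewrite big_cons; exact: entireM.
Qed.

Lemma entireX n k (f : 'rV[C]_n -> C) : entire f -> entire (fun x => f x ^+ k).
Proof.
move=> ef; elim: k => [|k IH]; first exact: entire_cst.
by under eq_fun do rewrite exprS; exact: entireM.
Qed.

Lemma entire_cexp n (f : 'rV[C]_n -> C) : entire f -> entire (fun x => cexp (f x)).
Proof.
move=> ef x; exact: differentiable_comp (ef x) (@cexp_differentiable R (f x)).1.
Qed.

Lemma entire_mpow n (alpha : mindex n) : entire (fun x : 'rV[C]_n => mpow x alpha).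
Proof. by apply: entire_prod => j; apply: entireX; exact: entire_coord. Qed.

Definition pds n (s : seq 'rV[C]_n) (f : 'rV[C]_n -> C) := foldr (@pd R n) f s.

Lemma entire_pd n (v : 'rV[C]_n) f : entire f -> entire (pd v f).
Proof. by move=> ef; have [] := entire_diff v ef. Qed.

Lemma entire_pds n (s : seq 'rV[C]_n) f : entire f -> entire (pds s f).
Proof. by move=> ef; elim: s => //= v s IH; exact: entire_pd. Qed.

Lemma pdC n (v w : 'rV[C]_n) f : entire f -> pd v (pd w f) = pd w (pd v f).
Proof. by move=> ef; have [_ ->] := entire_diff w ef. Qed.

Lemma pds_cat n (s t : seq 'rV[C]_n) f : pds (s ++ t) f = pds s (pds t f).
Proof. exact: foldr_cat. Qed.

Lemma perm_pds n (s t : seq 'rV[C]_n) f : entire f -> perm_eq s t -> pds s f = pds t f.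
Proof.
move=> ef; elim: s t => [|v s IH] t; first by move=> /perm_size/esym/size0nil->.
move=> st; have vt : v \in t by rewrite -(perm_mem st) mem_head.
have [t1 [t2 tE]] : exists t1 t2, t = t1 ++ v :: t2 by case/splitPr: vt => t1 t2; exists t1, t2.
move: st; rewrite {}tE perm_sym -cat1s perm_catCA perm_cons perm_sym => /IH {}IH.
rewrite -[v :: s]/([:: v] ++ s) pds_cat IH [RHS]pds_cat pds_cat -cat1s pds_cat.
elim: t1 {IH vt} => [|w t1 IHt]; first by [].
rewrite -[w :: t1]/([:: w] ++ t1) !(pds_cat [:: w] t1) -IHt.
exact: (pdC v w (entire_pds (t1 ++ t2) ef)).
Qed.

(** A multi-index unrolled into a list of directions: by [perm_pds], reordering derivatives and
    adding multi-indices reduce to permuting lists. *)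
Definition mseq n (e : 'I_n -> 'rV[C]_(n + n)) (alpha : mindex n) : seq 'rV[C]_(n + n) :=
  flatten [seq nseq (alpha j) (e j) | j <- enum 'I_n].

Lemma miter_pdsE n (e : 'I_n -> 'rV[C]_(n + n)) alpha f :
  miter (fun j => pd (e j)) alpha f = pds (mseq e alpha) f.
Proof.
rewrite /miter /mseq; elim: (enum _) => //= j r ->.
rewrite pds_cat; elim: (alpha j) => [|k IH]; first by [].
by rewrite iterS IH.
Qed.

Lemma perm_mseqD n (e : 'I_n -> 'rV[C]_(n + n)) (alpha beta : mindex n) :
  perm_eq (mseq e (alpha + beta)) (mseq e alpha ++ mseq e beta).
Proof.
rewrite /mseq; elim: (enum _) => //= j r IH.
have -> : (alpha + beta) j = (alpha j + beta j)%N by rewrite ffunE.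
rewrite nseqD -!catA perm_cat2l perm_sym perm_catCA perm_cat2l perm_sym.
exact: IH.
Qed.

Lemma mlenD n (alpha beta : mindex n) : mlen (alpha + beta) = (mlen alpha + mlen beta)%N.
Proof. by rewrite /mlen -big_split; apply: eq_bigr => j _; rewrite ffunE. Qed.

End EntireCalculus.

(** * Wirtinger derivatives *)

Section WirtingerDictionary.
Context {R : realType} {d : nat}.
Local Notation C := R[i].
Local Notation Cd := 'rV[C]_d.
Local Notation C2d := 'rV[C]_(d + d).

Lemma pdD n (u v : 'rV[C]_n) f x : pd (u + v) f x = pd u f x + pd v f x.
Proof. by rewrite /pd linearD. Qed.

Lemma pdZ n (l : C) (v : 'rV[C]_n) f x : pd (l *: v) f x = l * pd v f x.
Proof. by rewrite /pd linearZ. Qed.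

Lemma derive1_eps (f : R -> R) (c : R) :
  (forall e : R, 0 < e -> exists2 r : R, 0 < r & forall t, `|t| < r -> t != 0 ->
    `|t^-1 * (f t - f 0) - c| <= e) -> derive1 f 0 = c.
Proof.
move=> H; rewrite /derive1; apply: cvg_lim => //.
apply/cvgrPdist_le => e e0; have [r r0 fr] := H e e0.
exists r => // t /=; rewrite sub0r normrN => tr t0.
by rewrite distrC addr0; exact: fr.
Qed.

(** Agreement of [f] with an entire [G] along one real line suffices. This covers functions
    antiholomorphic in [w] as well as restrictions to the diagonal. *)
Lemma dir_derive_entire n (f : Cd -> C) (v z : Cd) (G : 'rV[C]_n -> C) (x y : 'rV[C]_n) :
  entire G -> (forall t : R, f (z + t%:C *: v) = G (x + t%:C *: y)) ->
  dir_derive f v z = pd y G x.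
Proof.
move=> eG fG; set c := pd y G x.
have H (e : R) : 0 < e -> exists2 r : R, 0 < r & forall t : R, `|t| < r -> t != 0 ->
    cabs (t^-1%:C * (f (z + t%:C *: v) - f z) - c) <= e.
  move=> e0; have y1 : 0 < rnorm y + 1 by rewrite ltr_wpDl// rnorm_ge0.
  have [r r0 D] := differentiable_eps (eG x) (divr_gt0 e0 y1).
  exists (r / (rnorm y + 1)); first exact: divr_gt0.
  move=> t; rewrite ltr_pdivlMr// => tr t0.
  have ty : rnorm (t%:C *: y) <= `|t| * (rnorm y + 1).
    by rewrite rnormZ cabsR ler_wpM2l// lerDl.
  have tC : t%:C != 0 :> C by apply: contra_neq t0 => /complexI.
  have := D _ (le_lt_trans ty tr); rewrite -(fG t).
  have -> : f z = G x by have := fG 0; rewrite !scale0r !addr0.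
  rewrite -[X in cabs (_ - X)]/(pd (t%:C *: y) G x) pdZ => Dt.
  have -> : (t^-1)%:C * (f (z + t%:C *: v) - G x) - c =
      (t%:C)^-1 * (f (z + t%:C *: v) - G x - t%:C * c).
    by rewrite [RHS]mulrBr (mulKf tC) fmorphV.
  rewrite cabsM cabsV cabsR ler_pdivrMl ?normr_gt0//; apply: (le_trans Dt).
  apply: (@le_trans _ _ (e / (rnorm y + 1) * (`|t| * (rnorm y + 1)))).
    by apply: ler_wpM2l => //; rewrite divr_ge0// ltW.
  by rewrite mulrA mulrAC mulrVK ?unitfE ?gt_eqF// mulrC.
have scale t (w : C) : t%:C * w = (t * complex.Re w) +i* (t * complex.Im w).
  by case: w => w1 w2; apply: complex_ext; rewrite /= ?mul0r ?subr0 ?addr0.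
apply: complex_ext; rewrite [LHS]/=; apply: derive1_eps => e /H[r r0 Hr]; exists r => // t tr t0.
- apply: le_trans (Hr t tr t0); rewrite scale0r addr0.
  by apply: le_trans (Re_le_cabs _); rewrite scale RecD RecN /= RecD RecN.
- apply: le_trans (Hr t tr t0); rewrite scale0r addr0.
  by apply: le_trans (Im_le_cabs _); rewrite scale ImcD ImcN /= ImcD ImcN.
Qed.

Definition ez (j : 'I_d) : C2d := row_mx (delta_mx 0 j) 0.
Definition ew (j : 'I_d) : C2d := row_mx 0 (delta_mx 0 j).
(* A symbol a(z, w) is encoded by the entire function (z, y) |-> a(z, conj y) on
   C^(2d); [dz] and [dzbar] become its derivatives along [ez] and [ew], both for
   the symbol and for its restriction to the diagonal. *)
Definition tilde (a : Cd -> Cd -> C) (x : C2d) : C := a (lsubmx x) (cconj (rsubmx x)).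
Definition untilde (G : C2d -> C) (z w : Cd) : C := G (row_mx z (cconj w)).

Lemma cconjK n : involutive (@cconj R n).
Proof. by move=> z; apply/rowP => j; rewrite !mxE conjcK. Qed.

Lemma cconjD n (z w : 'rV[C]_n) : cconj (z + w) = cconj z + cconj w.
Proof. by apply/rowP => j; rewrite !mxE rmorphD. Qed.

Lemma cconjZ n (l : C) (w : 'rV[C]_n) : cconj (l *: w) = conjc l *: cconj w.
Proof. by apply/rowP => j; rewrite !mxE rmorphM. Qed.

Lemma cconj_delta n (j : 'I_n) : cconj (delta_mx 0 j : 'rV[C]_n) = delta_mx 0 j.
Proof. by apply/rowP => i; rewrite !mxE; case: (_ && _); rewrite ?rmorph0 ?rmorph1. Qed.

Lemma tildeK a : untilde (tilde a) = a.
Proof.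
apply/funext => z; apply/funext => w.
by rewrite /untilde /tilde row_mxKl row_mxKr cconjK.
Qed.

Lemma untildeK G : tilde (untilde G) = G.
Proof. by apply/funext => x; rewrite /untilde /tilde cconjK hsubmxK. Qed.

(** [p] and [q] stand for the derivatives along [ez j] and [ew j]. A real step in [w] moves
    [(w, conj w)] along their sum, an imaginary step along [i] times their difference; [dz] and
    [dzbar] are the combinations that separate [p] from [q]. *)
Lemma wirtinger_algebra (p q : C) :
  (2^-1 * (p + q - 'i%C * ('i%C * p + (- 'i%C) * q)) = p) *
  (2^-1 * (p + q + 'i%C * ('i%C * p + (- 'i%C) * q)) = q).
Proof.
have ii : 'i%C * 'i%C = -1 :> C by rewrite -expr2 sqr_i.
have two : (2 : C) != 0 by rewrite pnatr_eq0.
have -> : 'i%C * ('i%C * p + (- 'i%C) * q) = q - p.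
  by rewrite mulrDr !mulrA mulrN ii; ring.
by split; field.
Qed.

Lemma dz_untilde (G : C2d -> C) j w : entire G ->
  dz j (fun z => untilde G z w) = fun z => untilde (pd (ez j) G) z w.
Proof.
move=> eG; apply/funext => z; rewrite /dz.
rewrite (@dir_derive_entire _ _ _ _ G (row_mx z (cconj w)) (ez j) eG); last first.
  by move=> t; rewrite /untilde /ez scale_row_mx scaler0 add_row_mx addr0.
rewrite (@dir_derive_entire _ _ _ _ G (row_mx z (cconj w)) ('i%C *: ez j) eG); last first.
  by move=> t; rewrite /untilde /ez !scale_row_mx !scaler0 add_row_mx addr0.
have := (wirtinger_algebra (pd (ez j) G (row_mx z (cconj w))) 0).1.
by rewrite pdZ !addr0 mulr0 addr0.
Qed.

Lemma dzbar_untilde (G : C2d -> C) j z : entire G ->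
  dzbar j (untilde G z) = untilde (pd (ew j) G) z.
Proof.
move=> eG; apply/funext => w; rewrite /dzbar.
rewrite (@dir_derive_entire _ _ _ _ G (row_mx z (cconj w)) (ew j) eG); last first.
  move=> t; rewrite /untilde /ew scale_row_mx scaler0 add_row_mx addr0.
  by rewrite cconjD cconjZ cconj_delta conjc_real.
rewrite (@dir_derive_entire _ _ _ _ G (row_mx z (cconj w)) (- 'i%C *: ew j) eG); last first.
  move=> t; rewrite /untilde /ew !scale_row_mx !scaler0 add_row_mx addr0.
  rewrite cconjD !cconjZ cconj_delta conjc_real; congr (G (row_mx _ (_ + _ *: (_ *: _)))).
  by apply: complex_ext; rewrite /= ?oppr0.
have := (wirtinger_algebra 0 (pd (ew j) G (row_mx z (cconj w)))).2.
by rewrite pdZ !add0r mulr0 add0r.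
Qed.

Definition diagpt (w : Cd) : C2d := row_mx w (cconj w).

Lemma diag_dir_derive (G : C2d -> C) j w : entire G ->
  dir_derive (fun w => G (diagpt w)) (delta_mx 0 j) w =
    pd (ez j) G (diagpt w) + pd (ew j) G (diagpt w) /\ dir_derive (fun w => G (diagpt w)) ('i%C *: delta_mx 0 j) w =
    'i%C * pd (ez j) G (diagpt w) + (- 'i%C) * pd (ew j) G (diagpt w).
Proof.
move=> eG; split.
- rewrite (@dir_derive_entire _ _ _ _ G (diagpt w) (ez j + ew j) eG) ?pdD//.
  move=> t; rewrite /diagpt /ez /ew add_row_mx addr0 add0r scale_row_mx add_row_mx.
  by rewrite cconjD cconjZ cconj_delta conjc_real.
- rewrite (@dir_derive_entire _ _ _ _ G (diagpt w) ('i%C *: ez j + (- 'i%C) *: ew j) eG).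
    by rewrite pdD !pdZ.
  move=> t; rewrite /diagpt /ez /ew !scale_row_mx !scaler0 add_row_mx addr0 add0r.
  rewrite scale_row_mx add_row_mx.
  rewrite cconjD !cconjZ cconj_delta conjc_real; congr (G (row_mx _ (_ + _ *: (_ *: _)))).
  by apply: complex_ext; rewrite /= ?oppr0.
Qed.

Lemma dz_diag (G : C2d -> C) j : entire G ->
  dz j (fun w => G (diagpt w)) = fun w => pd (ez j) G (diagpt w).
Proof.
move=> eG; apply/funext => w; have [d1 d2] := diag_dir_derive j w eG.
by rewrite /dz d1 d2; exact: (wirtinger_algebra _ _).1.
Qed.

Lemma dzbar_diag (G : C2d -> C) j : entire G ->
  dzbar j (fun w => G (diagpt w)) = fun w => pd (ew j) G (diagpt w).
Proof.
move=> eG; apply/funext => w; have [d1 d2] := diag_dir_derive j w eG.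
by rewrite /dzbar d1 d2; exact: (wirtinger_algebra _ _).2.
Qed.

(** One induction for three encodings [Phi]: a symbol as a function of [z], of [w], and its
    restriction to the diagonal. Entireness is carried along because [D] and [pd] are intertwined on
    entire functions only. *)
Lemma miter_transfer T (D : 'I_d -> T -> T) (e : 'I_d -> C2d) (Phi : (C2d -> C) -> T) alpha G :
  (forall j G, entire G -> D j (Phi G) = Phi (pd (e j) G)) -> entire G ->
  miter D alpha (Phi G) = Phi (pds (mseq e alpha) G).
Proof.
move=> DPhi eG; rewrite -miter_pdsE /miter; elim: (enum _) => [|j r IH]; first by [].
rewrite /= IH {IH}.
have er : entire (foldr (fun i g => iter (alpha i) (pd (e i)) g) G r).
  elim: r => [|i r IH] //=; elim: (alpha i) => [|k IHk] //=; exact: entire_pd.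
have [] : iter (alpha j) (D j) (Phi (foldr (fun i g => iter (alpha i) (pd (e i)) g) G r)) =
  Phi (iter (alpha j) (pd (e j)) (foldr (fun i g => iter (alpha i) (pd (e i)) g) G r)) /\ entire (iter (alpha j) (pd (e j)) (foldr (fun i g => iter (alpha i) (pd (e i)) g) G r)).
  elim: (alpha j) => [|k [IHk ek]]; first by [].
  by rewrite !iterS IHk DPhi//; split=> //; exact: entire_pd.
by [].
Qed.

Definition dzw (alpha beta : mindex d) (G : C2d -> C) : C2d -> C :=
  pds (mseq ez alpha ++ mseq ew beta) G.

Lemma entire_dzw alpha beta G : entire G -> entire (dzw alpha beta G).
Proof. exact: entire_pds. Qed.

Lemma dz_dwbar_untilde alpha beta (G : C2d -> C) : entire G ->
  dz_dwbar alpha beta (untilde G) = untilde (dzw alpha beta G).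
Proof.
move=> eG; apply/funext => z; apply/funext => w; rewrite /dz_dwbar.
have -> : (fun z' => miter dzbar beta (untilde G z') w) =
          (fun z' => untilde (pds (mseq ew beta) G) z' w).
  apply/funext => z'.
  rewrite (@miter_transfer _ _ ew (fun G => untilde G z'))// => j H eH.
  exact: dzbar_untilde.
rewrite (@miter_transfer _ _ ez (fun G z => untilde G z w)); last exact: entire_pds.
  by rewrite /dzw pds_cat.
by move=> j H eH; exact: dz_untilde.
Qed.

Lemma miter_diag alpha beta (G : C2d -> C) : entire G ->
  miter dz alpha (miter dzbar beta (fun w => G (diagpt w))) =
  fun w => dzw alpha beta G (diagpt w).
Proof.
move=> eG; rewrite (@miter_transfer _ _ ew (fun G w => G (diagpt w)))//; last first.
  by move=> j H eH; exact: dzbar_diag.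
rewrite (@miter_transfer _ _ ez (fun G w => G (diagpt w))); last exact: entire_pds.
  by rewrite /dzw pds_cat.
by move=> j H eH; exact: dz_diag.
Qed.

Lemma dzwD alpha beta alpha' beta' (G : C2d -> C) : entire G ->
  dzw alpha beta (dzw alpha' beta' G) = dzw (alpha + alpha') (beta + beta') G.
Proof.
move=> eG; rewrite /dzw -pds_cat; apply: perm_pds => //.
rewrite -!catA perm_sym; apply: (@perm_trans _ (mseq ez alpha ++ mseq ez alpha' ++ mseq ew (beta + beta'))).
  by rewrite catA perm_cat2r; exact: perm_mseqD.
rewrite perm_cat2l perm_sym perm_catCA perm_cat2l perm_sym; exact: perm_mseqD.
Qed.

Lemma entire_tilde a : Ahat a -> entire (tilde a).
Proof. by []. Qed.

End WirtingerDictionary.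

(** * Integration over C^d *)

Section IntegralOverCd.
Context {R : realType}.
Local Notation C := R[i].
Local Notation leb := (@lebesgue_measure R).
Local Notation mu n := (@lebesgue_tuple R n).

Definition shift_tuple n (a : n.-tuple R) (t : n.-tuple R) : n.-tuple R :=
  [tuple tnth t i + tnth a i | i < n].

Lemma integral_translation n (a : n.-tuple R) (f : n.-tuple R -> \bar R) :
  (mu n).-integrable setT f ->
  (mu n).-integrable setT (f \o shift_tuple a) /\
  (\int[mu n]_t f (shift_tuple a t) = \int[mu n]_t f t)%E.
Proof.
move=> fi; have mt : measurable_fun setT (shift_tuple a) := @translation_measurable R n a.
have pushE (g : n.-tuple R -> \bar R) :
    (\int[pushforward (mu n) (shift_tuple a)]_t g t = \int[mu n]_t g t)%E.
  by apply: eq_measure_integral => A mA _; exact: lebesgue_tuple_translation.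
have /integrableP[mf ffi] := fi.
have fti : (mu n).-integrable setT (f \o shift_tuple a).
  apply/integrableP; split; first exact: measurableT_comp.
  move: ffi; rewrite -pushE (@ge0_integral_pushforward _ _ _ _ _ _ mt)//.
  exact: measurableT_comp.
split=> //; rewrite -[RHS]pushE.
by rewrite (@integral_pushforward _ _ _ _ _ _ mt).
Qed.

Context {d : nat}.
Local Notation Cd := 'rV[C]_d.
Local Notation cV := (@cV_of_tuple R d).

Definition tuple_of_cV (b : Cd) : (d + d).-tuple R := [tuple (to_real b) 0 i | i < d + d].

Lemma cV_shift (b : Cd) t : cV (shift_tuple (tuple_of_cV b) t) = cV t + b.
Proof.
apply/rowP => j; rewrite !mxE !tnth_mktuple /to_real row_mxEl row_mxEr !mxE.
by apply: complex_ext; rewrite /= ?RecD ?ImcD.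
Qed.

Lemma cintegral_translation (f : Cd -> C) (b : Cd) :
  cintegrable (mu (d + d)) setT (fun t => f (cV t)) ->
  cintegral (mu (d + d)) setT (fun t => f (cV t + b)) =
  cintegral (mu (d + d)) setT (fun t => f (cV t)).
Proof.
move=> [f1 f2]; rewrite /cintegral; congr (_ +i* _).
- rewrite /Rintegral -(integral_translation (tuple_of_cV b) f1).2.
  by congr fine; apply: eq_integral => t _; rewrite cV_shift.
- rewrite /Rintegral -(integral_translation (tuple_of_cV b) f2).2.
  by congr fine; apply: eq_integral => t _; rewrite cV_shift.
Qed.

Lemma Rintegral_translation (f : Cd -> R) (b : Cd) :
  (mu (d + d)).-integrable setT (EFin \o (fun t => f (cV t))) ->
  (mu (d + d)).-integrable setT (EFin \o (fun t => f (cV t + b))) /\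
  \int[mu (d + d)]_t f (cV t + b) = \int[mu (d + d)]_t f (cV t).
Proof.
move=> fi; have [ti tE] := integral_translation (tuple_of_cV b) fi.
have shE t : f (cV t + b) = f (cV (shift_tuple (tuple_of_cV b) t)) by rewrite cV_shift.
split; first by under eq_fun do rewrite shE.
by under eq_Rintegral do rewrite shE; rewrite /Rintegral tE.
Qed.

Lemma cnorm_cV t : cnorm (cV t) ^+ 2 = \sum_i tnth t i ^+ 2.
Proof.
rewrite cnorm_sqr [RHS]big_split_ord /= -big_split; apply: eq_bigr => j _.
by rewrite /= cabs_sqr !mxE.
Qed.

Lemma integrable_gauss_cV (e : R) : 0 < e ->
  (mu (d + d)).-integrable setT (EFin \o (fun t => expR (- (e * cnorm (cV t) ^+ 2)))).
Proof.
move=> e0; have := integrable_prod_tuple (d + d) (measurable_gaussw e)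
  (fun x => expR_ge0 _) (integrable_gaussw e0).
apply: eq_integrable => // t _ /=; congr (_%:E).
by rewrite cnorm_cV mulr_sumr -sumrN expR_sum.
Qed.

Definition gauss_mass (e : R) : R := \int[mu (d + d)]_t expR (- (e * cnorm (cV t) ^+ 2)).

Lemma integrable_gauss_shift (e : R) (w : Cd) : 0 < e ->
  (mu (d + d)).-integrable setT (EFin \o (fun t => expR (- (e * cnorm (cV t - w) ^+ 2)))) /\
  \int[mu (d + d)]_t expR (- (e * cnorm (cV t - w) ^+ 2)) = gauss_mass e.
Proof.
move=> e0.
exact: (@Rintegral_translation (fun u => expR (- (e * cnorm u ^+ 2))) (- w)
  (integrable_gauss_cV e0)).
Qed.

Lemma diagpt_of_real_continuous (H : 'rV[C]_(d + d) -> C) : continuous H ->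
  forall (x : 'rV[R]_(d + d)) (e : R), 0 < e -> exists2 r : R, 0 < r &
    forall h, `|h| < r -> cabs (H (diagpt (of_real (x + h))) - H (diagpt (of_real x))) <= e.
Proof.
move=> cH x e e0; set p := diagpt (of_real x).
have : nbhs p [set y | cabs (H y - H p) <= e].
  have /cvgrPdist_le := cH p; move=> /(_ e%:C); rewrite ltcR => /(_ e0).
  apply: filterS => y /=; rewrite normCE lecR -cabsN opprB; exact.
move=> /nearCP[r r0 Hr]; exists (r / 3); first exact: divr_gt0.
move=> h hr; have -> : diagpt (of_real (x + h)) = p + diagpt (of_real h).
  rewrite /p /diagpt add_row_mx -cconjD; congr (row_mx _ (cconj _));
  by apply/rowP => j; rewrite !mxE; apply: complex_ext; rewrite /= ?RecD ?ImcD.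
apply: Hr; apply: le_lt_trans (_ : 2 * `|h| < _); last first.
  apply: (@le_lt_trans _ _ (3 * `|h|)); first by rewrite ler_wpM2r// ler_nat.
  by rewrite -ltr_pdivlMl// mulrC.
have hj i : `|h 0 i| <= `|h|.
  rewrite [leRHS]/Num.norm /= mx_normrE.
  exact: (@le_bigmax _ _ _ 0 (fun i : 'I_1 * 'I_(d + d) => `|h i.1 i.2|) (0, i)).
apply: rnorm_le => [|j]; first by rewrite mulr_ge0.
apply: (le_trans (cabs_le_ReIm _)); rewrite mulr2n mulrDl mul1r.
rewrite /diagpt; case: (splitP j) => k jk.
  have -> : j = lshift d k by exact: val_inj.
  by rewrite row_mxEl !mxE /=; apply: lerD; exact: hj.
have -> : j = rshift d k by exact: val_inj.
by rewrite row_mxEr !mxE /= normrN; apply: lerD; exact: hj.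
Qed.

Lemma rV_continuous n (f : 'rV[R]_n -> R) :
  (forall (x : 'rV[R]_n) (e : R), 0 < e -> exists2 r : R, 0 < r &
    forall h : 'rV[R]_n, `|h| < r -> `|f (x + h) - f x| <= e) -> continuous f.
Proof.
move=> H x; apply/(@cvgrPdist_le _ _ _ _ (nbhs_filter x)) => e e0.
have [r r0 Hr] := H x e e0.
apply: (@nbhs_normP R _ (x : ('rV[R]_n : normedModType R)) [set t | `|f x - f t| <= e]).2.
exists r => // y /=; rewrite -normrN opprB => yr.
by have := Hr (y - x) yr; rewrite [x + _]addrC (subrK x y) distrC.
Qed.

(** The kernels integrated over [C^d] are entire functions of [u] and [conj u] taken as independent
    variables, which reduces their measurability to this lemma. *)
Lemma cmeasurable_diagpt (H : 'rV[C]_(d + d) -> C) : continuous H ->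
  cmeasurable setT (fun t : (d + d).-tuple R => H (diagpt (cV t))).
Proof.
move=> cH; split.
- apply: (@continuous_measurable_rV _ _ (fun x => complex.Re (H (diagpt (of_real x))))).
  apply: rV_continuous => x e e0; have [r r0 Hr] := diagpt_of_real_continuous cH x e0.
  exists r => // h /Hr; apply: le_trans.
  by rewrite -RecN -RecD; exact: Re_le_cabs.
- apply: (@continuous_measurable_rV _ _ (fun x => complex.Im (H (diagpt (of_real x))))).
  apply: rV_continuous => x e e0; have [r r0 Hr] := diagpt_of_real_continuous cH x e0.
  exists r => // h /Hr; apply: le_trans.
  by rewrite -ImcN -ImcD; exact: Im_le_cabs.
Qed.

Lemma cmeasurable_entire_cV (F : Cd -> C) : entire F ->
  cmeasurable setT (fun t : (d + d).-tuple R => F (cV t)).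
Proof.
move=> eF; have eH : entire (fun x : 'rV[C]_(d + d) => F (lsubmx x)).
  have := (@entire_affine _ _ _ F (col_mx 1%:M 0 : 'M[C]_(d + d, d)) 0 eF).1.
  congr entire; apply/funext => x; congr F.
  by rewrite addr0 -{1}[x]hsubmxK mul_row_col mulmx1 mulmx0 addr0.
have := cmeasurable_diagpt (entire_continuous eH).
by apply: eq_cmeasurable => t _; rewrite /diagpt row_mxKl.
Qed.

End IntegralOverCd.

(** * Brackets and Gaussians *)

Section Brackets.
Context {R : realType}.
Local Notation C := R[i].

Lemma cnorm_sqrD n (x y : 'rV[C]_n) : cnorm (x + y) ^+ 2 <= 2 * cnorm x ^+ 2 + 2 * cnorm y ^+ 2.
Proof.
rewrite !cnorm_sqr !mulr_sumr -big_split; apply: ler_sum => j _; rewrite mxE /= !cabs_sqr RecD ImcD.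
have := sqr_ge0 (complex.Re (x 0 j) - complex.Re (y 0 j)).
have := sqr_ge0 (complex.Im (x 0 j) - complex.Im (y 0 j)).
by lra.
Qed.

Lemma cnormZ n (l : C) (x : 'rV[C]_n) : cnorm (l *: x) ^+ 2 = cabs l ^+ 2 * cnorm x ^+ 2.
Proof.
by rewrite !cnorm_sqr mulr_sumr; apply: eq_bigr => j _; rewrite mxE cabsM exprMn.
Qed.

Lemma cnormN n (x : 'rV[C]_n) : cnorm (- x) = cnorm x.
Proof. by congr Num.sqrt; apply: eq_bigr => j _; rewrite mxE cabsN. Qed.

Lemma cnorm_cconj n (x : 'rV[C]_n) : cnorm (cconj x) = cnorm x.
Proof. by congr Num.sqrt; apply: eq_bigr => j _; rewrite mxE cabs_conj. Qed.

Lemma gauss_completion n (p q : 'rV[C]_n) :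
  complex.Re (cdot p q) + 2^-1 * cnorm p ^+ 2 =
  2^-1 * cnorm (p + q) ^+ 2 - 2^-1 * cnorm q ^+ 2.
Proof.
rewrite !cnorm_sqr /cdot !mulr_sumr raddf_sum -big_split -sumrB; apply: eq_bigr => j _ /=.
rewrite mxE !cabs_sqr RecD ImcD; case: (p 0 j) (q 0 j) => [a b] [c e] /=.
by field.
Qed.

Lemma cbracket_sqr n (x : 'rV[C]_n) : cbracket x ^+ 2 = 1 + cnorm x ^+ 2.
Proof. by rewrite sqr_sqrtr// addr_ge0// sqr_ge0. Qed.

Lemma cbracket_ge1 n (x : 'rV[C]_n) : 1 <= cbracket x.
Proof. by rewrite -{1}sqrtr1 ler_sqrt ?lerDl ?sqr_ge0// addr_ge0// sqr_ge0. Qed.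

Lemma cbracket_gt0 n (x : 'rV[C]_n) : 0 < cbracket x.
Proof. exact: lt_le_trans ltr01 (cbracket_ge1 x). Qed.

Lemma cbracket_le n m (x : 'rV[C]_n) (y : 'rV[C]_m) (k : R) : 0 <= k ->
  1 + cnorm x ^+ 2 <= k ^+ 2 * (1 + cnorm y ^+ 2) -> cbracket x <= k * cbracket y.
Proof.
move=> k0 H; rewrite -(@ler_pXn2r _ 2)// ?nnegrE ?mulr_ge0 ?(ltW (cbracket_gt0 _))//.
by rewrite exprMn !cbracket_sqr.
Qed.

Lemma cbracketN n (x : 'rV[C]_n) : cbracket (- x) = cbracket x.
Proof. by rewrite /cbracket cnormN. Qed.

(** Peetre's inequality; with [powR_neg_le] it moves negative powers of brackets from one point to
    another. *)
Lemma cbracketD n (x y : 'rV[C]_n) : cbracket (x + y) <= 2 * cbracket x * cbracket y.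
Proof.
rewrite -(@ler_pXn2r _ 2)// ?nnegrE ?mulr_ge0 ?(ltW (cbracket_gt0 _))//.
rewrite !exprMn !cbracket_sqr; have := cnorm_sqrD x y.
have := sqr_ge0 (cnorm x); have := sqr_ge0 (cnorm y); nra.
Qed.

Lemma cbracketZ_le n (l : C) (x : 'rV[C]_n) : cabs l <= 1 -> cbracket (l *: x) <= cbracket x.
Proof.
move=> l1; rewrite -[leRHS]mul1r; apply: cbracket_le => //.
rewrite expr1n mul1r lerD2l cnormZ ler_piMl ?sqr_ge0// expr_le1// cabs_ge0//.
Qed.

Lemma to_realD n (x y : 'rV[C]_n) : to_real (x + y) = to_real x + to_real y.
Proof.
rewrite /to_real add_row_mx; congr row_mx; apply/rowP => j.
  by rewrite !mxE RecD.
by rewrite !mxE ImcD.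
Qed.

Lemma bracket_to_real n (x : 'rV[C]_n) : bracket (to_real x) = cbracket x.
Proof.
rewrite /bracket /cbracket; congr (Num.sqrt (1 + _)).
rewrite cnorm_sqr sqr_sqrtr; last by apply: sumr_ge0 => i _; exact: sqr_ge0.
rewrite big_split_ord /= -big_split; apply: eq_bigr => j _.
by rewrite /to_real row_mxEl row_mxEr !mxE /= cabs_sqr.
Qed.

Lemma powR_neg_le (x y s k : R) : 0 < x -> 0 < k -> 0 <= s -> x <= k * y ->
  y `^ (- s) <= k `^ s * x `^ (- s).
Proof.
move=> x0 k0 s0 xy; have y0 : 0 < y by rewrite -(pmulr_rgt0 _ k0) (lt_le_trans x0).
rewrite !powRN ler_pdivlMr ?powR_gt0// mulrC ler_pdivrMr ?powR_gt0//.
have <- : (k * y) `^ s = k `^ s * y `^ s by rewrite powRM// ltW.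
by apply: ge0_ler_powR; rewrite ?nnegrE ?mulr_ge0// ltW.
Qed.

Lemma cbracket_powR_le1 n (x : 'rV[C]_n) (s : R) : 0 <= s -> cbracket x `^ (- s) <= 1.
Proof. move=> s0; rewrite -(powRr0 (cbracket x)); apply: ler_powR; first exact: cbracket_ge1.
by rewrite oppr_le0. Qed.

Lemma cbracket_expR (N e : R) : 0 <= N -> 0 < e -> exists2 K : R, 0 < K &
  forall n (x : 'rV[C]_n), cbracket x `^ N <= K * expR (e * cnorm x ^+ 2).
Proof.
(* [M] is an integer above [N], so the power is at most [(1 + y)^M] with [y = |x|^2]; the exponent
   [e] is shared equally among [M] factors [1 + y <= (1 + 1 / e') expR (e' y)]. *)
move=> N0 e0; pose M := (Num.truncn N).+1; pose e' := e / M%:R.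
have M0 : (0 : R) < M%:R by [].
have e'0 : 0 < e' by exact: divr_gt0.
exists ((1 + e'^-1) ^+ M) => [|n x]; first by rewrite exprn_gt0// addr_gt0// invr_gt0.
have b1 := cbracket_ge1 x.
apply: (@le_trans _ _ (cbracket x `^ (M.*2)%:R)).
  apply: ler_powR => //; apply: (@le_trans _ _ M%:R).
    by apply: ltW; rewrite truncnS_gt.
  by rewrite ler_nat -addnn leq_addr.
rewrite powR_mulrn ?(ltW (cbracket_gt0 _))// -mul2n exprM cbracket_sqr.
have -> : e * cnorm x ^+ 2 = e' * cnorm x ^+ 2 *+ M.
  by rewrite -mulr_natr /e' mulrAC divfK// gt_eqF.
rewrite -mulr_natl expRM_natl -exprMn.
have y0 := sqr_ge0 (cnorm x); set y := cnorm x ^+ 2 in y0 *.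
have e'i : 0 <= e'^-1 by rewrite invr_ge0 ltW.
apply: lerXn2r; rewrite ?nnegrE; first exact: addr_ge0.
  by rewrite mulr_ge0 ?expR_ge0// addr_ge0.
have E1 := expR_ge1Dx (e' * y); have ey : 0 <= e' * y by rewrite mulr_ge0// ltW.
rewrite mulrDl mul1r; apply: lerD; first by apply: le_trans E1; rewrite lerDl.
by rewrite mulrC ler_pdivlMr// mulrC; apply: le_trans E1; rewrite lerDr.
Qed.

(* Gaussian growth absorbs polynomial loss along the segment t p. *)
Lemma segment_bracket_bound (N : R) : 0 <= N -> exists2 K : R, 0 < K &
  forall n (p : 'rV[C]_n) (t : R), 0 <= t <= 1 ->
    expR (2^-1 * cnorm (t%:C *: p) ^+ 2) * cbracket (t%:C *: p) `^ (- N) <=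
    K * (expR (2^-1 * cnorm p ^+ 2) * cbracket p `^ (- N)).
Proof.
move=> N0; have [K1 K10 HK1] := @cbracket_expR N (3 / 8) N0 ltac:(lra).
exists (2 `^ N + K1) => [|n p t /andP[t0 t1]]; first by rewrite addr_gt0// powR_gt0.
have b0 := cbracket_gt0 p; have bt0 := cbracket_gt0 (t%:C *: p).
have tp : cnorm (t%:C *: p) ^+ 2 = t ^+ 2 * cnorm p ^+ 2.
  by rewrite cnormZ cabsR ger0_norm.
have e1 : expR (2^-1 * cnorm (t%:C *: p) ^+ 2) <= expR (2^-1 * cnorm p ^+ 2).
  by rewrite ler_expR ler_pM2l// tp ler_piMl ?sqr_ge0// expr_le1.
(* For [t >= 1/2] the brackets of [t p] and [p] are comparable. For [t < 1/2] the exponent has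
   [(1 - t^2) / 2 >= 3/8] of [|p|^2] to spare, which is the constant passed to [cbracket_expR]
   above. *)
rewrite [leRHS]mulrCA; case: (leP 2^-1 t) => t2.
  apply: ler_pM; rewrite ?expR_ge0 ?powR_ge0//.
  apply: (@le_trans _ _ (2 `^ N * cbracket p `^ (- N))); last first.
    by rewrite ler_wpM2r ?powR_ge0// lerDl ltW.
  apply: powR_neg_le => //; apply: cbracket_le => //.
  rewrite tp; have := sqr_ge0 (cnorm p).
  have : 4^-1 <= t ^+ 2 by nra.
  by nra.
apply: (@le_trans _ _ (expR (2^-1 * cnorm (t%:C *: p) ^+ 2))).
  by rewrite ler_piMr ?expR_ge0// cbracket_powR_le1.
apply: (@le_trans _ _ (expR (2^-1 * cnorm p ^+ 2) * expR (- (3 / 8 * cnorm p ^+ 2)))).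
  rewrite -expRD ler_expR tp; have := sqr_ge0 (cnorm p).
  have : t ^+ 2 <= 4^-1 by nra.
  by nra.
apply: ler_pM; rewrite ?expR_ge0//.
rewrite expRN -ler_pdivrMr ?powR_gt0// -powRN opprK mulrC ler_pdivrMr ?expR_gt0//.
apply: (le_trans (HK1 _ p)); rewrite ler_wpM2r ?expR_ge0// lerDr powR_ge0//.
Qed.

End Brackets.

(** * The kernel of the extended symbol *)

Section SegmentIntegral.
Context {R : realType}.
Local Notation C := R[i].
Local Notation leb := (@lebesgue_measure R).

Lemma eq_entire n (f g : 'rV[C]_n -> C) : (forall x, f x = g x) -> entire f -> entire g.
Proof. by move=> /funext->. Qed.

Definition seg_integrand n (k : nat) (G : 'rV[C]_n -> C) (p q : 'rV[C]_n) (t : R) : C :=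
  ((1 - t) ^+ k)%:C * G (p + t%:C *: q).

Definition seg_int n (k : nat) (G : 'rV[C]_n -> C) (p q : 'rV[C]_n) : C :=
  cintegral leb `[0, 1] (seg_integrand k G p q).

Lemma seg_integrand_continuous n k (G : 'rV[C]_n -> C) p q : entire G ->
  continuous (seg_integrand k G p q).
Proof.
move=> eG; apply: ccontinuousM.
  have -> : (fun t : R => ((1 - t) ^+ k)%:C) = (fun t : R => (1 - t%:C) ^+ k).
    by apply/funext => t; rewrite rmorphXn rmorphB.
  apply: ccontinuousX; apply: ccontinuousB; last exact: real_complex_continuous.
  by move=> t; exact: cvg_cst.
have cl : continuous (fun l : C => G (p + l *: q)).
  by move=> l; exact: differentiable_continuous (entire_line p q l eG).1.
exact: ccontinuous_comp (@real_complex_continuous R) cl.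
Qed.

Lemma seg_weight_le1 k (t : R) : 0 <= t <= 1 -> cabs ((1 - t) ^+ k)%:C <= 1.
Proof.
move=> /andP[t0 t1]; rewrite cabsR ger0_norm ?exprn_ge0 ?subr_ge0//.
by rewrite exprn_ile1 ?subr_ge0// lerBlDr lerDl.
Qed.

Lemma cabs_seg_int_le n k (G : 'rV[C]_n -> C) p q (M : R) : entire G ->
  (forall t : R, 0 <= t <= 1 -> cabs (G (p + t%:C *: q)) <= M) ->
  cabs (seg_int k G p q) <= 2 * M.
Proof.
move=> eG GM.
have H t : 0 <= t <= 1 -> cabs (seg_integrand k G p q t) <= M.
  move=> t01; rewrite cabsM -[leRHS]mul1r.
  apply: ler_pM; rewrite ?cabs_ge0//; [exact: seg_weight_le1|exact: GM].
have := cabs_cintegral_itv_le (@seg_integrand_continuous n k G p q eG) ler01 H.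
by rewrite subr0 mulr1.
Qed.

(** With [B = 0] the direction of the segment stays fixed, so the derivative moves onto [G] without
    a factor depending on [t]. Shifts of the base point are therefore the parameter in which
    derivatives are computed. *)
Lemma entire_seg_int m n k (G : 'rV[C]_n -> C) (A B : 'M[C]_(m, n)) (p q : 'rV[C]_n) :
  entire G -> entire (fun x => seg_int k G (x *m A + p) (x *m B + q)) /\
  (B = 0 -> forall v, pd v (fun x => seg_int k G (x *m A + p) (x *m B + q)) =
     fun x => seg_int k (pd (v *m A) G) (x *m A + p) (x *m B + q)).
Proof.
move=> eG; pose K (x : 'rV[C]_m) := seg_integrand k G (x *m A + p) (x *m B + q).
have KE x t : K x t = ((1 - t) ^+ k)%:C * G (x *m (A + t%:C *: B) + (p + t%:C *: q)).
  rewrite /K /seg_integrand mulmxDr scalerDr -scalemxAr; congr (_ * G _).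
  by rewrite addrACA.
have KE' t : K^~ t = fun x => ((1 - t) ^+ k)%:C * G (x *m (A + t%:C *: B) + (p + t%:C *: q)).
  by apply/funext => x; exact: KE.
have eA t := entire_affine (A + t%:C *: B) (p + t%:C *: q) eG.
have eK t := entireZ ((1 - t) ^+ k)%:C (eA t).1.
have mI : measurable (`[0, 1]%classic : set (measurableTypeR R)) by [].
have mK x : cmeasurable (`[0, 1]%classic : set (measurableTypeR R)) (K x).
  have cK : continuous (K x) := @seg_integrand_continuous n k G _ _ eG.
  exact: cintegrable_measurable (continuous_cintegrable 0 1 cK).
have domK r : exists2 M : measurableTypeR R -> R, leb.-integrable `[0, 1] (EFin \o M) &
    forall x t, rnorm x <= r -> `[0, 1]%classic t -> cabs (K x t) <= M t.
  have [KA KA0 HA] := mulmx_bound A; have [KB KB0 HB] := mulmx_bound B.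
  have [M M0 HM] := continuous_bounded (KA * r + rnorm p + (KB * r + rnorm q)) (entire_continuous eG).
  exists (fun=> M); first exact: integrable_itv_cst.
  move=> x t xr; rewrite /= in_itv /= => t01.
  rewrite /K /seg_integrand cabsM -[leRHS]mul1r.
  apply: ler_pM; rewrite ?cabs_ge0//; first exact: seg_weight_le1.
  apply: HM; apply: (le_trans (rnormD _ _)); apply: lerD.
    apply: (le_trans (rnormD _ _)); rewrite lerD2r; apply: (le_trans (HA _)).
    exact: ler_wpM2l.
  case/andP: t01 => t0 t1; rewrite rnormZ cabsR ger0_norm//.
  apply: (@le_trans _ _ (1 * rnorm (x *m B + q))); first by rewrite ler_wpM2r ?rnorm_ge0.
  rewrite mul1r; apply: (le_trans (rnormD _ _)); rewrite lerD2r; apply: (le_trans (HB _)).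
  exact: ler_wpM2l.
have eKt t : `[0, 1]%classic t -> entire (K^~ t) by rewrite KE' => _; exact: (eK t).1.
have [e1 e2] := entire_parametric mI mK eKt domK.
split; first exact: e1.
move=> B0 v; apply/funext => x.
transitivity (cintegral leb `[0, 1] (fun t => pd v (K^~ t) x)); first exact: e2.
apply: eq_cintegral => t _; rewrite KE'.
transitivity (((1 - t) ^+ k)%:C * pd v (fun x => G (x *m (A + t%:C *: B) + (p + t%:C *: q))) x).
  exact: (eK t).2.
rewrite (eA t).2 /seg_integrand B0 scaler0 addr0; congr (_ * pd _ _ _).
by rewrite mulmx0 add0r addrA.
Qed.

End SegmentIntegral.

(** * Gaussian bounds for the kernel and for its shifts *)

Section RemainderKernel.
Context {R : realType} {d : nat}.
Local Notation C := R[i].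
Local Notation Cd := 'rV[C]_d.
Local Notation C2d := 'rV[C]_(d + d).

(** [y] takes the place of [conj w], which makes the phase holomorphic in [(z, y)]. *)
Definition wick_phase (z u y : Cd) : C :=
  \sum_j (z 0 j - u 0 j) * (conjc (u 0 j) - y 0 j).

Lemma wick_phaseE z u w : wick_phase z u (cconj w) = cdot (z - u) (u - w).
Proof. by apply: eq_bigr => j _; rewrite !mxE rmorphB. Qed.

(* b(z, u) e^((z - u, u - w)) at y = conj w, up to the factor [mlen alpha]; for
   y = 0 it is the Wick kernel of the remainder symbol. *)
Definition rem_kernel (k : nat) (G : C2d -> C) (z y u : Cd) : C :=
  seg_int k G (diagpt u) (row_mx (z - u) 0) * cexp (wick_phase z u y).

Lemma remainder_symbolE (G : C2d -> C) a alpha z u :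
  dz_dwbar alpha alpha a = untilde G ->
  remainder_symbol a alpha z u =
    (mlen alpha)%:R * seg_int (mlen alpha).-1 G (diagpt u) (row_mx (z - u) 0).
Proof.
move=> aG; rewrite /remainder_symbol aG; congr (_ * _); apply: eq_cintegral => t _.
rewrite /untilde /seg_integrand; congr (_ * G _).
by rewrite scale_row_mx scaler0 /diagpt add_row_mx addr0.
Qed.

Lemma entire_rem_kernel k (G : C2d -> C) u : entire G ->
  entire (fun x : C2d => rem_kernel k G (lsubmx x) (rsubmx x) u).
Proof.
move=> eG; apply: entireM; last first.
  apply: entire_cexp; apply: entire_sum => j; apply: entireM.
    apply: entireD; last exact: entire_cst.
    by under eq_fun do rewrite mxE; exact: entire_coord.
  apply: entireD; first exact: entire_cst.
  by under eq_fun do rewrite mxE; exact: entireN (entire_coord _).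
have := (@entire_seg_int _ _ _ k G 0 (block_mx 1%:M 0 0 0 : 'M[C]_(d + d))
  (diagpt u) (row_mx (- u) 0) eG).1.
apply: eq_entire => x; rewrite mulmx0 add0r; congr (seg_int _ _ _ _).
rewrite -[in LHS](hsubmxK x) mul_row_block !mulmx0 mulmx1 !addr0.
by rewrite add_row_mx addr0.
Qed.

Lemma cmeasurable_rem_kernel k (G : C2d -> C) z y : entire G ->
  cmeasurable setT (fun t : (d + d).-tuple R => rem_kernel k G z y (cV_of_tuple t)).
Proof.
move=> eG.
pose H (X : C2d) := seg_int k G X (row_mx (z - lsubmx X) 0) *
  cexp (\sum_j (z 0 j - X 0 (lshift d j)) * (X 0 (rshift d j) - y 0 j)).
have eH : entire H.
  apply: entireM; last first.
    apply: entire_cexp; apply: entire_sum => j; apply: entireM.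
      by apply: entireD; [exact: entire_cst|exact: entireN (entire_coord _)].
    by apply: entireD; [exact: entire_coord|exact: entire_cst].
  have := (@entire_seg_int _ _ _ k G 1%:M (block_mx (- 1%:M) 0 0 0 : 'M[C]_(d + d)) 0 (row_mx z 0) eG).1.
  apply: eq_entire => x; rewrite mulmx1 addr0; congr (seg_int _ _ _ _).
  rewrite -[in LHS](hsubmxK x) mul_row_block !mulmx0 mulmxN mulmx1 !addr0.
  by rewrite add_row_mx addr0 [- _ + _]addrC.
have := cmeasurable_diagpt (entire_continuous eH).
apply: eq_cmeasurable => t _; rewrite /H /rem_kernel /diagpt row_mxKl; congr (_ * cexp _).
by apply: eq_bigr => j _; rewrite row_mxEl row_mxEr [cconj _ _ _]mxE.
Qed.

Context (om : 'rV[R]_(d + d) -> R) (s Cm : R).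
Hypotheses (om_gt0 : forall x, 0 < om x) (s_ge0 : 0 <= s) (Cm_ge1 : 1 <= Cm)
  (om_mod : forall x y, om (x + y) <= Cm * om x * bracket y `^ s).

Definition om_sqrt2 (z : Cd) : R := om (to_real ((Num.sqrt 2)%:C *: cconj z)).

Lemma om_sqrt2_gt0 z : 0 < om_sqrt2 z. Proof. exact: om_gt0. Qed.

Lemma om_sqrt2_mod z p (l : R) : 0 <= l <= 1 ->
  om_sqrt2 (z + l%:C *: p) <= Cm * om_sqrt2 z * (2 * cbracket p) `^ s.
Proof.
move=> /andP[l0 l1]; rewrite /om_sqrt2 cconjD scalerDr to_realD.
apply: (le_trans (om_mod _ _)); rewrite bracket_to_real.
apply: ler_wpM2l; first by rewrite mulr_ge0 ?ltW// (lt_le_trans ltr01).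
apply: ge0_ler_powR => //; rewrite ?nnegrE ?mulr_ge0 ?(ltW (cbracket_gt0 _))//.
apply: cbracket_le => //; rewrite cnormZ cnorm_cconj cnormZ !cabsR.
rewrite !ger0_norm ?sqrtr_ge0// sqr_sqrtr//.
have := sqr_ge0 (cnorm p); have : l ^+ 2 <= 1 by rewrite expr_le1.
have := sqr_ge0 l; nra.
Qed.

Context (m : R) (k : nat) (G : C2d -> C).
Hypotheses (m_ge0 : 0 <= m) (eG : entire G)
  (G_bound : forall N, 0 <= N -> exists K : R, forall z w,
    cabs (untilde G z w) <= K * expR (2^-1 * cnorm (z - w) ^+ 2) * om_sqrt2 z *
      cbracket (z + w) `^ (- m) * cbracket (z - w) `^ (- N)).

Lemma powRM3 (x y z r : R) : 0 <= x -> 0 <= y -> 0 <= z ->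
  (x * y * z) `^ r = x `^ r * y `^ r * z `^ r.
Proof. by move=> x0 y0 z0; rewrite !powRM// mulr_ge0. Qed.

(** The weights are [1 + eps] and [1 + 1 / eps] with [eps = 1/8]. In [shift_kernel_dom] the growth
    exponent [|p|^2 / 2] may rise only slightly, here to [9/16 |p|^2], if a Gaussian in [u] is to
    remain. *)
Lemma cnorm_sqrD8 n (x y : 'rV[C]_n) :
  cnorm (x + y) ^+ 2 <= 9 / 8 * cnorm x ^+ 2 + 9 * cnorm y ^+ 2.
Proof.
rewrite !cnorm_sqr !mulr_sumr -big_split; apply: ler_sum => j _; rewrite mxE /= !cabs_sqr RecD ImcD.
have := sqr_ge0 (complex.Re (x 0 j) - 8 * complex.Re (y 0 j)).
have := sqr_ge0 (complex.Im (x 0 j) - 8 * complex.Im (y 0 j)).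
by lra.
Qed.

Lemma shift_sum (a b c e : C) : a + b + c - (a + e) = c + (b - e).
Proof. by ring. Qed.

Lemma segment_sum (a b c e : C) : a + b = c + e + c + (a - c - e - (c - b)).
Proof. by ring. Qed.

Lemma G_segment_bound N : 0 <= N -> exists2 K : R, 0 < K & forall z u w (t : R),
  0 <= t <= 1 ->
  cabs (G (diagpt u + t%:C *: row_mx (z - u) 0)) <=
    K * (expR (2^-1 * cnorm (z - u) ^+ 2) * om_sqrt2 z * cbracket (z + w) `^ (- m) *
      cbracket (z - u) `^ (- N) * cbracket (u - w) `^ m).
Proof.
(* Moving the weight and the bracket of the sum to [(z, w)] costs [<p>^s] and [<p>^m <q>^m]; the
   powers of [<p>] are paid from [<p>^(-N')], leaving [<p>^(-N)]. *)
move=> N0; pose N' := N + m + s.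
have N'0 : 0 <= N' by rewrite !addr_ge0.
have [K0 HK0] := G_bound N'0; have [K1 K10 HK1] := @segment_bracket_bound R N' N'0.
pose K := (`|K0| + 1) * K1 * (Cm * 2 `^ s) * 4 `^ m.
have Cm0 : 0 < Cm := lt_le_trans ltr01 Cm_ge1.
exists K; first by rewrite !mulr_gt0 ?powR_gt0// ltr_wpDl.
move=> z u w t t01; pose p := z - u; pose q := u - w.
have -> : G (diagpt u + t%:C *: row_mx (z - u) 0) = untilde G (u + t%:C *: p) u.
  by rewrite /untilde /diagpt scale_row_mx scaler0 add_row_mx addr0.
apply: (le_trans (HK0 _ _)).
have -> : u + t%:C *: p - u = t%:C *: p by rewrite addrAC subrr add0r.
set E := expR (_ * cnorm (_ *: p) ^+ 2).
set O := om_sqrt2 _; set B := cbracket _ `^ _; set D := cbracket _ `^ _.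
have E0 : 0 <= E * D by rewrite mulr_ge0 ?expR_ge0 ?powR_ge0.
have ED : E * D <= K1 * (expR (2^-1 * cnorm p ^+ 2) * cbracket p `^ (- N')) by exact: HK1.
have /andP[t0 t1] := t01.
have OE : O <= Cm * om_sqrt2 z * (2 * cbracket p) `^ s.
  rewrite /O (_ : u + _ = z + (1 - t)%:C *: (- p)); last first.
    rewrite rmorphB rmorph1 scalerBl scale1r scalerN opprK addrA; congr (_ + _).
    by rewrite /p opprB addrC subrK.
  by rewrite -(cbracketN p); apply: om_sqrt2_mod; rewrite subr_ge0 t1 lerBlDr lerDl.
have BE : B <= (4 * cbracket p * cbracket q) `^ m * cbracket (z + w) `^ (- m).
  apply: powR_neg_le; rewrite ?mulr_gt0 ?cbracket_gt0//.
  have -> : z + w = (u + t%:C *: p + u) + ((1 - t)%:C *: p - q).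
    rewrite rmorphB rmorph1 scalerBl scale1r; move: (t%:C *: p) => v.
    by apply/rowP => j; rewrite /p /q !mxE; exact: segment_sum.
  apply: (le_trans (cbracketD _ _)).
  have := cbracketD ((1 - t)%:C *: p) (- q); rewrite cbracketN => H.
  have H' : cbracket ((1 - t)%:C *: p) <= cbracket p.
    by apply: cbracketZ_le; rewrite cabsR ger0_norm ?subr_ge0// lerBlDr lerDl.
  have := cbracket_gt0 (u + t%:C *: p + u); have := cbracket_gt0 q.
  set x1 := cbracket (_ + u) in H H' *; set x2 := cbracket q in H H' *.
  set x3 := cbracket p in H' *; set x4 := cbracket (_ *: p) in H H' *.
  set x5 := cbracket (_ - q) in H *; move=> q0 u0.
  apply: (@le_trans _ _ (2 * x1 * (2 * x3 * x2))); last first.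
    have r4 (a b c : R) : 2 * a * (2 * b * c) = 4 * b * c * a by ring.
    by rewrite r4.
  apply: ler_wpM2l; first by rewrite mulr_ge0// ltW.
  apply: (le_trans H); apply: ler_wpM2r; first exact: ltW.
  by apply: ler_wpM2l.
have O0 : 0 <= O := ltW (om_gt0 _).
have B0 : 0 <= B := powR_ge0 _ _.
apply: (@le_trans _ _ ((`|K0| + 1) * (E * D) * O * B)).
  have r1 (k0 a o b c : R) : k0 * a * o * b * c = k0 * (a * c * o * b) by ring.
  have r2 (k0 a o b c : R) : k0 * (a * c) * o * b = k0 * (a * c * o * b) by ring.
  rewrite [leLHS](r1 K0 E O B D) [leRHS](r2 (`|K0| + 1) E O B D).
  apply: ler_wpM2r; first exact: mulr_ge0 (mulr_ge0 E0 O0) B0.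
  by apply: (le_trans (ler_norm _)); rewrite lerDl.
apply: (@le_trans _ _ ((`|K0| + 1) * (K1 * (expR (2^-1 * cnorm p ^+ 2) * cbracket p `^ (- N'))) *
    (Cm * om_sqrt2 z * (2 * cbracket p) `^ s) *
    ((4 * cbracket p * cbracket q) `^ m * cbracket (z + w) `^ (- m)))).
  have K0' : 0 <= `|K0| + 1 by rewrite addr_ge0.
  apply: ler_pM; [exact: mulr_ge0 (mulr_ge0 K0' E0) O0|exact: B0| |exact: BE].
  apply: ler_pM; [exact: mulr_ge0 K0' E0|exact: O0| |exact: OE].
  by apply: ler_wpM2l; [exact: K0'|exact: ED].
have p0 := cbracket_gt0 p; have q0 := cbracket_gt0 q.
clear E O B D E0 ED OE BE O0 B0 HK0 HK1.
have ps : (2 * cbracket p) `^ s = 2 `^ s * cbracket p `^ s by apply: powRM => //; exact: ltW.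
have pm : (4 * cbracket p * cbracket q) `^ m = 4 `^ m * cbracket p `^ m * cbracket q `^ m.
  exact: powRM3 (ler0n R 4) (ltW p0) (ltW q0).
have pN : cbracket p `^ (- N) = cbracket p `^ (- N') * cbracket p `^ s * cbracket p `^ m.
  have pD a b : cbracket p `^ (a + b) = cbracket p `^ a * cbracket p `^ b.
    by apply: powRD; apply/implyP => _; rewrite gt_eqF.
  by rewrite -!pD; congr (_ `^ _); rewrite /N'; ring.
rewrite -/p -/q ps pm pN /K.
have r3 (a k1 e1 pn c o two ps_ four pm_ qm zm : R) :
    a * (k1 * (e1 * pn)) * (c * o * (two * ps_)) * (four * pm_ * qm * zm) =
    a * k1 * (c * two) * four * (e1 * o * zm * (pn * ps_ * pm_) * qm) by ring.
by rewrite [leLHS]r3.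
Qed.

Lemma rem_kernel_bound N : 0 <= N -> exists2 K : R, 0 < K & forall z w u,
  cabs (rem_kernel k G z (cconj w) u) <=
    K * (expR (2^-1 * cnorm (z - w) ^+ 2) * om_sqrt2 z * cbracket (z + w) `^ (- m) *
      cbracket (z - w) `^ (- N)) * expR (- (3 / 8 * cnorm (u - w) ^+ 2)).
Proof.
move=> N0; have [K1 K10 HK1] := G_segment_bound N0.
(* Replacing [<p>^(-N)] by [<z - w>^(-N)] costs another [<q>^N]. The total [<q>^(N + m)] uses [1/8]
   of the exponent [1/2] of the Gaussian in [q], so [3/8] remains. *)
have [K2 K20 HK2] := @cbracket_expR R (N + m) 8^-1 ltac:(by rewrite addr_ge0) ltac:(lra).
exists (2 * K1 * 2 `^ N * K2) => [|z w u]; first by rewrite !mulr_gt0 ?powR_gt0.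
pose p := z - u; pose q := u - w; have q0 := cbracket_gt0 q.
have pq : z - w = p + q by rewrite /p /q addrA subrK.
rewrite /rem_kernel cabsM cabs_cexp wick_phaseE.
apply: (le_trans (ler_wpM2r (expR_ge0 _) (cabs_seg_int_le k eG (fun t t01 => HK1 z u w t t01)))).
rewrite -/p -/q.
have -> : expR (2^-1 * cnorm (z - w) ^+ 2) =
    expR (2^-1 * cnorm p ^+ 2) * expR (complex.Re (cdot p q)) * expR (2^-1 * cnorm q ^+ 2).
  rewrite -!expRD pq; congr expR; have := gauss_completion p q; lra.
have -> : expR (- (3 / 8 * cnorm q ^+ 2)) =
    expR (8^-1 * cnorm q ^+ 2) * expR (- (2^-1 * cnorm q ^+ 2)).
  by rewrite -!expRD; congr expR; lra.
have h1 : cbracket p `^ (- N) <= (2 * cbracket q) `^ N * cbracket (z - w) `^ (- N).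
  apply: powR_neg_le; rewrite ?mulr_gt0 ?cbracket_gt0// pq.
  by rewrite mulrAC; exact: cbracketD.
have h2 := HK2 _ q.
have p3 : cbracket q `^ (N + m) = cbracket q `^ N * cbracket q `^ m.
  by apply: powRD; apply/implyP => _; rewrite gt_eqF.
rewrite p3 in h2.
have p2 : (2 * cbracket q) `^ N = 2 `^ N * cbracket q `^ N by rewrite powRM// ltW.
rewrite p2 in h1.
have ee : expR (2^-1 * cnorm q ^+ 2) * expR (- (2^-1 * cnorm q ^+ 2)) = 1.
  by rewrite -expRD subrr expR0.
set E1 := expR (_ * cnorm p ^+ 2) in h1 h2 ee *; set E2 := expR (complex.Re _) in h1 h2 ee *.
set E3 := expR (2^-1 * cnorm q ^+ 2) in ee *; set E4 := expR (- _) in ee *.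
set E5 := expR (8^-1 * _) in h2 *.
set O := om_sqrt2 z; set Z := cbracket (z + w) `^ _.
apply: (@le_trans _ _ (2 * (K1 * (E1 * O * Z * (2 `^ N * cbracket q `^ N * cbracket (z - w) `^ (- N)) *
    cbracket q `^ m)) * E2)).
  apply: ler_wpM2r; first exact: expR_ge0.
  do 2 (apply: ler_wpM2l; first by rewrite ?ltW).
  apply: ler_wpM2r; first exact: powR_ge0.
  apply: ler_wpM2l; last exact: h1.
  by rewrite !mulr_ge0 ?expR_ge0 ?powR_ge0// ltW// om_sqrt2_gt0.
have r1 (k1 e1 o zz n2 qn b qm e2 : R) : 2 * (k1 * (e1 * o * zz * (n2 * qn * b) * qm)) * e2 =
    2 * k1 * n2 * (e1 * e2) * o * zz * b * (qn * qm) by ring.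
have r2 (k1 n2 k2 e1 e2 e3 e4 e5 o zz b : R) :
    2 * k1 * n2 * k2 * (e1 * e2 * e3 * o * zz * b) * (e5 * e4) =
    2 * k1 * n2 * (e1 * e2) * o * zz * b * (k2 * e5) * (e3 * e4) by ring.
rewrite [leLHS](r1 K1 E1 O Z (2 `^ N) (cbracket q `^ N) (cbracket (z - w) `^ (- N)) (cbracket q `^ m) E2).
rewrite [leRHS](r2 K1 (2 `^ N) K2 E1 E2 E3 E4 E5 O Z (cbracket (z - w) `^ (- N))) ee mulr1.
apply: ler_wpM2l; last exact: h2.
by rewrite !mulr_ge0 ?expR_ge0 ?powR_ge0// ltW// om_sqrt2_gt0.
Qed.

(* Off the diagonal, a shift x = (xi, eta) of G costs a factor e^(r |z - u|),
   which only the Gaussian in u can absorb: hence a bound that is uniform for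
   bounded z, y and x only. *)
Definition shift_kernel (z y : Cd) (x : C2d) (u : Cd) : C :=
  seg_int k G (diagpt u + x) (row_mx (z - u) 0) * cexp (wick_phase z u y).

(** Balance of the coefficients of [|u|^2]: completing the square gives [-1/4], the excess
    [|p|^2 / 16] in the growth of [G] costs [1/8], and the weight costs [1/16], which leaves
    [-1/16]. All other terms are controlled by [r]. *)
Lemma shift_kernel_dom (r : R) : exists2 K : R, 0 < K & forall z y x u,
  cnorm z <= r -> cnorm y <= r -> rnorm x <= r ->
  cabs (shift_kernel z y x u) <= K * expR (- (16^-1 * cnorm u ^+ 2)).
Proof.
have [K0 HK0] := G_bound (lexx 0).
(* The point [v] below satisfies [|v|^2 <= 8 |u|^2] up to a constant, so [128^-1] becomes [16^-1] in
   front of [|u|^2]. *)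
have [K2 K20 HK2] := @cbracket_expR R s 128^-1 s_ge0 ltac:(lra).
have Cm0 : 0 < Cm := lt_le_trans ltr01 Cm_ge1.
pose r1 := d%:R * r.
pose K3 := (`|K0| + 1) * (Cm * om_sqrt2 0 * (2 `^ s * K2)).
have K30 : 0 < K3.
  rewrite /K3; apply: mulr_gt0; first by rewrite ltr_wpDl.
  exact: mulr_gt0 (mulr_gt0 Cm0 (om_sqrt2_gt0 0)) (mulr_gt0 (powR_gt0 _ (ltr0Sn R 1)) K20).
exists (2 * K3 * expR (19 * r1 ^+ 2 + 3 * r ^+ 2)) => [|z y x u].
  by rewrite mulr_gt0 ?expR_gt0// mulr_gt0.
rewrite -[y]cconjK cnorm_cconj; move: (cconj y) => w zr wr xr.
pose p := z - u; pose xi := lsubmx x; pose eta := cconj (rsubmx x).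
have sq_le (a b : R) : 0 <= a -> a <= b -> a ^+ 2 <= b ^+ 2.
  by move=> a0 ab; rewrite lerXn2r// nnegrE (le_trans a0).
have sub_le (v : Cd) : (forall j, cabs (v 0 j) <= rnorm x) -> cnorm v ^+ 2 <= r1 ^+ 2.
  move=> H; apply: sq_le; first exact: cnorm_ge0.
  apply: (le_trans (cnorm_le_rnorm v)); apply: ler_wpM2l => //.
  by apply: le_trans xr; apply: rnorm_le; [exact: rnorm_ge0|exact: H].
have xi2 : cnorm xi ^+ 2 <= r1 ^+ 2.
  by apply: sub_le => j; rewrite mxE; exact: cabs_le_rnorm.
have eta2 : cnorm eta ^+ 2 <= r1 ^+ 2.
  by apply: sub_le => j; rewrite !mxE cabs_conj; exact: cabs_le_rnorm.
have z2 : cnorm z ^+ 2 <= r ^+ 2 := sq_le _ _ (cnorm_ge0 z) zr.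
have w2 : cnorm w ^+ 2 <= r ^+ 2 := sq_le _ _ (cnorm_ge0 w) wr.
have p2 : cnorm p ^+ 2 <= 2 * r ^+ 2 + 2 * cnorm u ^+ 2.
  by have := cnorm_sqrD z (- u); rewrite cnormN -/p; lra.
pose E := expR (9 / 16 * cnorm p ^+ 2 + 18 * r1 ^+ 2) *
  expR (16^-1 * cnorm u ^+ 2 + 32^-1 * (r1 ^+ 2 + r ^+ 2)).
have key t : 0 <= t <= 1 -> cabs (G (diagpt u + x + t%:C *: row_mx p 0)) <= K3 * E.
  move=> t01; pose v := u + xi + t%:C *: p.
  have tp2 : cnorm (t%:C *: p) ^+ 2 <= cnorm p ^+ 2.
    case/andP: t01 => t0 t1; rewrite cnormZ cabsR ger0_norm// ler_piMl ?sqr_ge0// expr_le1//.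
  have -> : diagpt u + x + t%:C *: row_mx p 0 = row_mx v (cconj (u + eta)).
    rewrite -[x in LHS]hsubmxK /diagpt add_row_mx scale_row_mx scaler0 add_row_mx addr0.
    by rewrite cconjD cconjK.
  apply: (le_trans (HK0 v (u + eta))); rewrite oppr0 powRr0 mulr1.
  have b1 : cbracket (v + (u + eta)) `^ (- m) <= 1 by exact: cbracket_powR_le1.
  have vu : v - (u + eta) = t%:C *: p + (xi - eta).
    rewrite /v; move: (t%:C *: p) => tp; apply/rowP => j; rewrite !mxE; exact: shift_sum.
  have e1 : expR (2^-1 * cnorm (v - (u + eta)) ^+ 2) <= expR (9 / 16 * cnorm p ^+ 2 + 18 * r1 ^+ 2).
    rewrite ler_expR vu; have := cnorm_sqrD8 (t%:C *: p) (xi - eta).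
    have := cnorm_sqrD xi (- eta); rewrite cnormN; lra.
  have v2 : cnorm v ^+ 2 <= 8 * cnorm u ^+ 2 + 4 * r1 ^+ 2 + 4 * r ^+ 2.
    have := cnorm_sqrD (u + xi) (t%:C *: p); have := cnorm_sqrD u xi; rewrite -/v; lra.
  have e2 : om_sqrt2 v <= Cm * om_sqrt2 0 * (2 `^ s * K2) *
      expR (16^-1 * cnorm u ^+ 2 + 32^-1 * (r1 ^+ 2 + r ^+ 2)).
    have := @om_sqrt2_mod 0 v 1; rewrite scale1r add0r ler01 lexx => /(_ isT) /le_trans; apply.
    rewrite -[leRHS]mulrA; apply: ler_wpM2l; first by apply: mulr_ge0; apply: ltW => //; exact: om_sqrt2_gt0.
    have -> : (2 * cbracket v) `^ s = 2 `^ s * cbracket v `^ s.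
      by apply: powRM => //; exact: ltW (cbracket_gt0 v).
    rewrite -[leRHS]mulrA; apply: ler_wpM2l; first exact: powR_ge0.
    apply: (le_trans (HK2 _ v)); apply: ler_wpM2l; first exact: ltW.
    rewrite ler_expR; lra.
  have e1' := expR_ge0 (2^-1 * cnorm (v - (u + eta)) ^+ 2).
  have O0 := ltW (om_sqrt2_gt0 v).
  apply: (@le_trans _ _ ((`|K0| + 1) * (expR (2^-1 * cnorm (v - (u + eta)) ^+ 2) * om_sqrt2 v))).
    rewrite -!mulrA; apply: (@le_trans _ _ (`|K0| * (expR (2^-1 * cnorm (v - (u + eta)) ^+ 2) * (om_sqrt2 v * cbracket (v + (u + eta)) `^ (- m))))).
      apply: ler_wpM2r; last exact: ler_norm.
      by apply: mulr_ge0 => //; apply: mulr_ge0 => //; exact: powR_ge0.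
    apply: ler_pM; [by []|by apply: mulr_ge0 => //; apply: mulr_ge0 => //; exact: powR_ge0|by rewrite lerDl|].
    by apply: ler_wpM2l => //; rewrite ler_piMr.
  rewrite /K3 /E -[leRHS]mulrA; apply: ler_wpM2l; first by rewrite addr_ge0.
  by rewrite [leRHS]mulrCA; apply: ler_pM.
rewrite /shift_kernel cabsM cabs_cexp wick_phaseE -/p.
have := cabs_seg_int_le k eG key.
move=> /(ler_wpM2r (expR_ge0 (complex.Re (cdot p (u - w))))) /le_trans; apply.
have r5 (a b c f : R) : a * (b * c) * f = a * b * (c * f) by ring.
apply: (@le_trans _ _ (2 * K3 * (E * expR (complex.Re (cdot p (u - w)))))).
  by rewrite le_eqVlt r5 eqxx.
rewrite -[leRHS]mulrA; apply: ler_wpM2l; first exact: mulr_ge0 (ler0n R 2) (ltW K30).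
rewrite /E -!expRD ler_expR.
have := gauss_completion p (u - w); rewrite (_ : p + (u - w) = z - w); last by rewrite /p addrA subrK.
have := cnorm_sqrD z (- w); rewrite cnormN.
have := cnorm_sqrD (u - w) w; rewrite subrK.
have := sqr_ge0 r; have := sqr_ge0 r1; lra.
Qed.

Lemma rem_kernelE z y u : rem_kernel k G z y u = shift_kernel z y 0 u.
Proof. by rewrite /shift_kernel addr0. Qed.

End RemainderKernel.

(** * The integrated kernel: holomorphy, bounds and derivatives *)

Section KernelIntegral.
Context {R : realType} {d : nat}.
Local Notation C := R[i].
Local Notation Cd := 'rV[C]_d.
Local Notation C2d := 'rV[C]_(d + d).
Local Notation mu := (@lebesgue_tuple R (d + d)).
Local Notation cV := (@cV_of_tuple R d).

(** The phase and the direction of the segment depend on differences only, so a common translation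
    of [z], [w] and [u] is felt by the base point of [G] alone. *)
Lemma shift_kernel_translate k (G : C2d -> C) z w xi u :
  shift_kernel k G z (cconj w) (diagpt xi) u =
  rem_kernel k G (z + xi) (cconj (w + xi)) (u + xi).
Proof.
rewrite /shift_kernel /rem_kernel.
have -> : diagpt (u + xi) = diagpt u + diagpt xi by rewrite /diagpt add_row_mx cconjD.
have -> : z + xi - (u + xi) = z - u by rewrite opprD addrACA subrr addr0.
rewrite !wick_phaseE.
have -> : z + xi - (u + xi) = z - u by rewrite opprD addrACA subrr addr0.
by have -> : u + xi - (w + xi) = u - w by rewrite opprD addrACA subrr addr0.
Qed.

Definition kernel_int (k : nat) (G : C2d -> C) (x : C2d) : C :=
  cintegral mu setT (fun t => rem_kernel k G (lsubmx x) (rsubmx x) (cV t)).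

Context (om : 'rV[R]_(d + d) -> R) (s Cm : R).
Hypotheses (om_gt0 : forall x, 0 < om x) (s_ge0 : 0 <= s) (Cm_ge1 : 1 <= Cm)
  (om_mod : forall x y, om (x + y) <= Cm * om x * bracket y `^ s).

(** [Wick_bound] with a real exponent [m] in place of [rho * m]. *)
Definition Gbound (m : R) (G : C2d -> C) := forall N, 0 <= N -> exists K : R, forall z w,
  cabs (untilde G z w) <= K * expR (2^-1 * cnorm (z - w) ^+ 2) * om_sqrt2 om z *
    cbracket (z + w) `^ (- m) * cbracket (z - w) `^ (- N).

Definition tame (G : C2d -> C) := entire G /\ exists2 m, 0 <= m & Gbound m G.

Lemma integrable_gaussZ (K e : R) (w : Cd) : 0 < e ->
  mu.-integrable setT (EFin \o (fun t => K * expR (- (e * cnorm (cV t - w) ^+ 2)))).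
Proof.
move=> e0; have [+ _] := integrable_gauss_shift w e0.
by move=> /(integrableZl measurableT K); apply: eq_integrable.
Qed.

Lemma integrable_gaussZ0 (K e : R) : 0 < e ->
  mu.-integrable setT (EFin \o (fun t => K * expR (- (e * cnorm (cV t) ^+ 2)))).
Proof.
move=> e0; have := integrable_gaussZ K 0 e0.
by apply: eq_integrable => // t _ /=; rewrite subr0.
Qed.

Lemma cmeasurable_shift_kernel k (G : C2d -> C) z y x : entire G ->
  cmeasurable setT (fun t : (d + d).-tuple R => shift_kernel k G z y x (cV t)).
Proof.
move=> eG; have [eH _] := entire_affine 1%:M x eG.
have := cmeasurable_rem_kernel k z y eH; apply: eq_cmeasurable => t _.
rewrite /rem_kernel /shift_kernel; congr (_ * _); apply: eq_cintegral => l _.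
by rewrite /seg_integrand mulmx1 addrAC.
Qed.

Lemma entire_kernel_int k (G : C2d -> C) : tame G -> entire (kernel_int k G).
Proof.
move=> [eG [m m0 Gm]].
suff [] : entire (fun x => cintegral mu setT
    (fun t => rem_kernel k G (lsubmx x) (rsubmx x) (cV t))) /\ True by [].
split=> //.
apply: (entire_parametric measurableT _ _ _).1.
- by move=> x; exact: cmeasurable_rem_kernel.
- by move=> t _; exact: entire_rem_kernel.
- move=> r; pose r' := d%:R * `|r| + `|r|.
  have [K K0 HK] := shift_kernel_dom om_gt0 s_ge0 Cm_ge1 om_mod k m0 eG Gm r'.
  exists (fun t => K * expR (- (16^-1 * cnorm (cV t) ^+ 2))).
    by apply: integrable_gaussZ0; lra.
  move=> x t xr _; rewrite rem_kernelE.
  have r0 : rnorm x <= `|r| := le_trans xr (ler_norm r).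
  have sub_le (v : Cd) : (forall j, cabs (v 0 j) <= rnorm x) -> cnorm v <= r'.
    move=> H; apply: (le_trans (cnorm_le_rnorm v)).
    apply: (@le_trans _ _ (d%:R * `|r|)); last by rewrite lerDl.
    by apply: ler_wpM2l => //; apply: le_trans r0; apply: rnorm_le; [exact: rnorm_ge0|exact: H].
  apply: HK.
  + by apply: sub_le => j; rewrite mxE; exact: cabs_le_rnorm.
  + by apply: sub_le => j; rewrite mxE; exact: cabs_le_rnorm.
  + by rewrite /rnorm normr0 addr_ge0// mulr_ge0.
Qed.

Lemma cintegrable_kernel k (G : C2d -> C) z y : tame G ->
  cintegrable mu setT (fun t => rem_kernel k G z y (cV t)).
Proof.
move=> [eG [m m0 Gm]].
have [K K0 HK] := shift_kernel_dom om_gt0 s_ge0 Cm_ge1 om_mod k m0 eG Gm (cnorm z + cnorm y).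
apply: (cintegrable_dominated measurableT (cmeasurable_rem_kernel k z y eG)
  (integrable_gaussZ0 K (_ : 0 < 16^-1))) => [|t _]; first by lra.
rewrite rem_kernelE; apply: HK; rewrite ?lerDl ?lerDr ?cnorm_ge0//.
by rewrite /rnorm normr0 addr_ge0// cnorm_ge0.
Qed.

Lemma kernel_int_bound k (G : C2d -> C) m : entire G -> 0 <= m -> Gbound m G ->
  Gbound m (kernel_int k G).
Proof.
move=> eG m0 Gm N N0.
have [K K0 HK] := rem_kernel_bound om_gt0 s_ge0 Cm_ge1 om_mod k m0 eG Gm N0.
exists (2 * K * @gauss_mass R d (3 / 8)) => z w.
rewrite /untilde /kernel_int row_mxKl row_mxKr.
have e0 : (0 : R) < 3 / 8 by lra.
have [gi gm] := integrable_gauss_shift w e0.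
set B := expR (2^-1 * cnorm (z - w) ^+ 2) * om_sqrt2 om z * cbracket (z + w) `^ (- m) *
    cbracket (z - w) `^ (- N).
have := cabs_cintegral_le measurableT (cmeasurable_rem_kernel k z (cconj w) eG)
  (integrable_gaussZ (K * B) w e0) (fun t _ => HK z w (cV t)).
move=> /le_trans; apply.
have -> : \int[mu]_t (K * B * expR (- (3 / 8 * cnorm (cV t - w) ^+ 2))) =
    K * B * @gauss_mass R d (3 / 8) by rewrite -gm; exact: RintegralZl measurableT gi.
have r1 (k0 g b1 b2 b3 b4 : R) :
    2 * (k0 * (b1 * b2 * b3 * b4) * g) = 2 * k0 * g * b1 * b2 * b3 * b4 by ring.
by rewrite le_eqVlt; apply/orP; left; apply/eqP; exact: r1.
Qed.

(* Translating u by xi moves the shift of (z, w) by (xi, xi) onto G, where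
   derivatives are those of an entire function of the shift. *)
Lemma shift_kernel_int k (G : C2d -> C) z w : tame G ->
  exists2 Cs : C2d -> C, entire Cs &
    (forall xi, Cs (diagpt xi) = untilde (kernel_int k G) (z + xi) (w + xi)) /\
    forall v, pd v Cs 0 = untilde (kernel_int k (pd v G)) z w.
Proof.
move=> tG; have [eG [m m0 Gm]] := tG.
pose Ks (x : C2d) t := shift_kernel k G z (cconj w) x (cV t).
have mKs x : cmeasurable setT (Ks x) by exact: cmeasurable_shift_kernel.
have eSeg u := @entire_seg_int R (d + d) (d + d) k G 1%:M 0 (diagpt u) (row_mx (z - u) 0) eG.
have KsE t : Ks^~ t = fun x => cexp (wick_phase z (cV t) (cconj w)) *
    seg_int k G (x *m 1%:M + diagpt (cV t)) (x *m 0 + row_mx (z - cV t) 0).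
  by apply/funext => x; rewrite /Ks /shift_kernel mulrC mulmx1 mulmx0 add0r [diagpt _ + x]addrC.
have eKs t := entireZ (cexp (wick_phase z (cV t) (cconj w))) (eSeg (cV t)).1.
have eKst t : setT t -> entire (Ks^~ t) by rewrite KsE => _; exact: (eKs t).1.
have domK r : exists2 M : (d + d).-tuple R -> R, mu.-integrable setT (EFin \o M) &
    forall x t, rnorm x <= r -> setT t -> cabs (Ks x t) <= M t.
  pose r' := cnorm z + cnorm w + `|r|.
  have [K K0 HK] := shift_kernel_dom om_gt0 s_ge0 Cm_ge1 om_mod k m0 eG Gm r'.
  exists (fun t => K * expR (- (16^-1 * cnorm (cV t) ^+ 2))).
    by apply: integrable_gaussZ0; lra.
  move=> x t xr _; apply: HK; rewrite /r' ?cnorm_cconj.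
  + by rewrite -addrA lerDl addr_ge0// cnorm_ge0.
  + by rewrite -addrA addrCA lerDl addr_ge0// cnorm_ge0.
  + by apply: (le_trans xr); apply: (le_trans (ler_norm r)); rewrite lerDr addr_ge0// cnorm_ge0.
have [e1 e2] := entire_parametric measurableT mKs eKst domK.
exists (fun x => cintegral mu setT (Ks x)); first exact: e1.
split=> [xi|v].
- rewrite /untilde /kernel_int row_mxKl row_mxKr.
  rewrite -(@cintegral_translation _ _
    (fun u => rem_kernel k G (z + xi) (cconj (w + xi)) u) xi); last exact: cintegrable_kernel.
  by apply: eq_cintegral => t _; exact: shift_kernel_translate.
- rewrite /untilde /kernel_int row_mxKl row_mxKr.
  transitivity (cintegral mu setT (fun t => pd v (Ks^~ t) 0)); first exact: e2.
  apply: eq_cintegral => t _; rewrite KsE.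
  transitivity (cexp (wick_phase z (cV t) (cconj w)) *
    pd v (fun x => seg_int k G (x *m 1%:M + diagpt (cV t)) (x *m 0 + row_mx (z - cV t) 0)) 0).
    exact: (eKs t).2.
  by rewrite (eSeg (cV t)).2// /rem_kernel mulrC !mulmx1 mulmx0 !add0r.
Qed.

Lemma row_mx_surj (x : C2d) : x = row_mx (lsubmx x) (cconj (cconj (rsubmx x))).
Proof. by rewrite cconjK hsubmxK. Qed.

(** The shifted integral and [Cs] are entire and are compared only at the points [(xi, conj xi)].
    That suffices: [dz j] and [dzbar j] in [xi] recover the derivatives of an entire function along
    [ez j] and [ew j]. *)
Lemma pd_kernel_int k (G : C2d -> C) j : tame G ->
  pd (ez j) (kernel_int k G) = kernel_int k (pd (ez j) G) /\
  pd (ew j) (kernel_int k G) = kernel_int k (pd (ew j) G).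
Proof.
move=> tG; have eC := entire_kernel_int k tG.
have key z w : pd (ez j) (kernel_int k G) (row_mx z (cconj w)) =
      kernel_int k (pd (ez j) G) (row_mx z (cconj w)) /\
    pd (ew j) (kernel_int k G) (row_mx z (cconj w)) =
      kernel_int k (pd (ew j) G) (row_mx z (cconj w)).
  have [Cs eCs [Csd Csp]] := shift_kernel_int k z w tG.
  pose C1 (x : C2d) := kernel_int k G (x *m 1%:M + row_mx z (cconj w)).
  have [eC1 pC1] := entire_affine 1%:M (row_mx z (cconj w)) eC.
  have Cs1 : (fun xi : Cd => C1 (diagpt xi)) = (fun xi => Cs (diagpt xi)).
    apply/funext => xi; rewrite Csd /untilde /C1 /diagpt mulmx1 add_row_mx cconjD.
    by rewrite [xi + z]addrC [cconj xi + _]addrC.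
  have d0 : diagpt 0 = 0 :> C2d.
    by rewrite /diagpt (_ : cconj 0 = 0) ?row_mx0//; apply/rowP => i; rewrite !mxE rmorph0.
  have pE v : pd v C1 0 = pd v (kernel_int k G) (row_mx z (cconj w)).
    by rewrite pC1 mulmx1 mul0mx add0r.
  split.
  - have := congr1 (fun F => F 0) (dz_diag j eC1); rewrite -/C1 Cs1.
    by rewrite (dz_diag j eCs) d0 Csp pE => <-.
  - have := congr1 (fun F => F 0) (dzbar_diag j eC1); rewrite -/C1 Cs1.
    by rewrite (dzbar_diag j eCs) d0 Csp pE => <-.
by split; apply/funext => x; rewrite (row_mx_surj x); [exact: (key _ _).1|exact: (key _ _).2].
Qed.

Definition mdelta (j : 'I_d) : mindex d := [ffun i => (i == j : nat)].

Lemma mseq_mdelta (e : 'I_d -> C2d) j : mseq e (mdelta j) = [:: e j].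
Proof.
rewrite /mseq; have := mem_enum 'I_d j; have := enum_uniq 'I_d.
elim: (enum _) => //= i r IH /andP[ir ur]; rewrite inE ffunE.
case: (eqVneq j i) => [->|ji] /=.
  move=> _; congr cons; rewrite -[RHS]/(flatten [::]).
  elim: r ir {IH ur} => //= i' r IH; rewrite inE negb_or => /andP[i'i /IH ->].
  by rewrite ffunE eq_sym (negPf i'i).
exact: IH.
Qed.

Lemma mseq0 (e : 'I_d -> C2d) : mseq e 0 = [::].
Proof. by rewrite /mseq; elim: (enum _) => //= i r ->; rewrite ffunE. Qed.

(** Stable under derivatives by construction, as the iteration of [pd_kernel_int] requires. *)
Definition alg_tame (G : C2d -> C) := entire G /\ forall beta gamma, tame (dzw beta gamma G).

Lemma alg_tame_pd G j : alg_tame G -> alg_tame (pd (ez j) G) /\ alg_tame (pd (ew j) G).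
Proof.
move=> [eG tG].
have z1 : pd (ez j) G = dzw (mdelta j) 0 G.
  by rewrite /dzw mseq_mdelta mseq0 cats0.
have w1 : pd (ew j) G = dzw 0 (mdelta j) G.
  by rewrite /dzw mseq_mdelta mseq0.
split; split; try exact: entire_pd.
- by move=> b c; rewrite z1 dzwD//; exact: tG.
- by move=> b c; rewrite w1 dzwD//; exact: tG.
Qed.

Lemma alg_tame_tame H : alg_tame H -> tame H.
Proof. by move=> [_ /(_ 0 0)]; rewrite /dzw !mseq0. Qed.

Lemma pds_kernel_int k (e : 'I_d -> C2d) (alpha : mindex d) G :
  (forall j H, alg_tame H -> pd (e j) (kernel_int k H) = kernel_int k (pd (e j) H) /\
    alg_tame (pd (e j) H)) ->
  alg_tame G -> pds (mseq e alpha) (kernel_int k G) = kernel_int k (pds (mseq e alpha) G) /\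
    alg_tame (pds (mseq e alpha) G).
Proof.
move=> He aG; rewrite /mseq; elim: (enum _) => [|j r [IH1 IH2]]; first exact: conj erefl aG.
rewrite /= !pds_cat IH1; move: IH2; move: (pds (flatten _) G) => H aH.
elim: (alpha j) => [|n [IH1' IH2']]; first exact: conj erefl aH.
have [E1 E2] := He j _ IH2'.
by split; [rewrite -[LHS]/(pd (e j) (pds (nseq n (e j)) (kernel_int k H))) IH1'|].
Qed.

Lemma dzw_kernel_int k (G : C2d -> C) beta gamma : alg_tame G ->
  dzw beta gamma (kernel_int k G) = kernel_int k (dzw beta gamma G).
Proof.
move=> aG; rewrite /dzw !pds_cat.
have [|E1 E2] := @pds_kernel_int k ew gamma G _ aG.
  by move=> j H aH; exact: conj (pd_kernel_int k j (alg_tame_tame aH)).2 (alg_tame_pd j aH).2.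
rewrite E1; have [|E3 _] := @pds_kernel_int k ez beta _ _ E2.
  by move=> j H aH; exact: conj (pd_kernel_int k j (alg_tame_tame aH)).1 (alg_tame_pd j aH).1.
exact: E3.
Qed.

End KernelIntegral.

(** * Absolute convergence of the Wick integral of the remainder symbol *)

Section WickSymbol.
Context {R : realType} {d : nat}.
Local Notation C := R[i].
Local Notation Cd := 'rV[C]_d.
Local Notation C2d := 'rV[C]_(d + d).
Local Notation mu := (@lebesgue_tuple R (d + d)).
Local Notation cV := (@cV_of_tuple R d).

Lemma compact_cnorm_bounded (K : set Cd) : compact K ->
  exists r : R, forall z, K z -> cnorm z <= r.
Proof.
move=> Kc.
have bj j := compact_continuous_bounded Kc (entire_continuous (@entire_coord R d j)).
pose M j := sval (cid2 (bj j)); have HM j z : K z -> cabs (z 0 j) <= M j.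
  by rewrite /M; case: (cid2 (bj j)) => m _ /= H /H.
exists (Num.sqrt (\sum_j M j ^+ 2)) => z Kz; rewrite /cnorm ler_sqrt.
  apply: ler_sum => j _; have := HM j z Kz; have := cabs_ge0 (z 0 j); nra.
by apply: sumr_ge0 => j _; exact: sqr_ge0.
Qed.

Lemma exp_growth_gauss (r x : R) : expR (r * x) <= expR (8 * r ^+ 2) * expR (32^-1 * x ^+ 2).
Proof. rewrite -expRD ler_expR; have := sqr_ge0 (x - 16 * r); lra. Qed.

(** The norm is recovered, by [ln] and a square root, from a Gaussian already known to be
    measurable. *)
Lemma measurable_cnorm_gt (r : R) : measurable [set t | r < cnorm (cV t)].
Proof.
have mg : measurable_fun setT (fun t => Num.sqrt (- ln (expR (- (1 * cnorm (cV t) ^+ 2))))).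
  have /measurable_int/measurable_EFinP mg := @integrable_gauss_cV R d 1 ltr01.
  apply: measurableT_comp; first by apply: continuous_measurable_fun; exact: sqrt_continuous.
  apply: measurableT_comp => //.
  exact: measurableT_comp (@measurable_ln R) mg.
have := mg measurableT _ (@measurable_itv R `]r, +oo[); rewrite setTI.
congr measurable; apply/seteqP; split => t; rewrite /= in_itv/= andbT expRK opprK mul1r;
by rewrite sqrtr_sqr ger0_norm// cnorm_ge0.
Qed.

(** Half of the exponent is kept for integrability. Beyond [r] the other half is at most
    [expR (- y)] with [y = r^2 / 64], and [y = K M / e] gives [K M expR (- y) <= e] because
    [y <= expR y]. *)
Lemma gauss_tail (K e : R) : 0 <= K -> 0 < e -> exists r : R,
  (\int[mu]_(t in [set t | (r < cnorm (cV t))%R])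
     (K * expR (- (32^-1 * cnorm (cV t) ^+ 2)))%:E <= e%:E)%E.
Proof.
move=> K0 e0; pose M := @gauss_mass R d 64^-1.
have M0 : 0 <= M by apply: Rintegral_ge0 => t _; exact: expR_ge0.
pose y := K * M / e; have y0 : 0 <= y by rewrite divr_ge0 ?mulr_ge0// ltW.
pose r := 8 * Num.sqrt y; have r0 : 0 <= r by rewrite mulr_ge0// sqrtr_ge0.
have r2 : 64^-1 * r ^+ 2 = y by rewrite /r exprMn sqr_sqrtr//; field.
exists r; set D := [set t | _]; pose c := K * expR (- y).
have c0 : 0 <= c by rewrite mulr_ge0// expR_ge0.
have mg (q : R) : 0 < q -> measurable_fun setT (fun t => expR (- (q * cnorm (cV t) ^+ 2))).
  by move=> q0; have /measurable_int/measurable_EFinP := @integrable_gauss_cV R d q q0.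
have mD : measurable D := measurable_cnorm_gt r.
have ci := @integrable_gaussZ0 R d c 64^-1 ltac:(lra).
apply: (@le_trans _ _ (\int[mu]_(t in D) (c * expR (- (64^-1 * cnorm (cV t) ^+ 2)))%:E)%E).
  apply: ge0_le_integral => //.
  - by move=> t _; rewrite lee_fin mulr_ge0// expR_ge0.
  - apply/measurable_EFinP; apply: measurable_funTS; apply: measurable_funM => //.
    by apply: mg; lra.
  - apply/measurable_EFinP; apply: measurable_funTS; apply: measurable_funM => //.
    by apply: mg; lra.
  - move=> t Dt; rewrite lee_fin /c -mulrA; apply: ler_wpM2l => //.
    rewrite -expRD ler_expR -r2; have : r ^+ 2 <= cnorm (cV t) ^+ 2.
      by rewrite lerXn2r ?nnegrE ?cnorm_ge0// ltW.
    by lra.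
apply: (@le_trans _ _ (\int[mu]_t (c * expR (- (64^-1 * cnorm (cV t) ^+ 2)))%:E)%E).
  apply: ge0_subset_integral => //; first exact: measurable_int ci.
  by move=> t _; rewrite lee_fin mulr_ge0// expR_ge0.
rewrite -[leLHS]fineK; last exact: integrable_fin_num.
rewrite lee_fin -[leLHS]/(\int[mu]_t (c * expR (- (64^-1 * cnorm (cV t) ^+ 2)))).
have -> : \int[mu]_t (c * expR (- (64^-1 * cnorm (cV t) ^+ 2))) = c * M.
  exact: RintegralZl measurableT (@integrable_gauss_cV R d 64^-1 ltac:(lra)).
rewrite /c mulrAC expRN ler_pdivrMr ?expR_gt0//.
have KM : K * M = y * e by rewrite /y mulfVK// gt_eqF.
apply: (@le_trans _ _ (e * y)); first by rewrite KM mulrC.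
apply: ler_wpM2l; first exact: ltW.
by apply: le_trans (expR_ge1Dx y); rewrite lerDr.
Qed.

Context (om : 'rV[R]_(d + d) -> R) (s Cm : R).
Hypotheses (om_gt0 : forall x, 0 < om x) (s_ge0 : 0 <= s) (Cm_ge1 : 1 <= Cm)
  (om_mod : forall x y, om (x + y) <= Cm * om x * bracket y `^ s).

(** The remainder symbol, to be used with [kappa = |alpha|] and [k = |alpha| - 1]. *)
Definition seg_symbol (kappa k : nat) (G : C2d -> C) (z u : Cd) : C :=
  kappa%:R * seg_int k G (diagpt u) (row_mx (z - u) 0).

Lemma Wick_integrand_seg kappa k G F z u :
  Wick_integrand (seg_symbol kappa k G) F z u = kappa%:R * (rem_kernel k G z 0 u * F u).
Proof.
rewrite /Wick_integrand /seg_symbol /rem_kernel.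
have r1 (a b c f : C) : a * b * c * f = a * (b * f * c) by ring.
have -> : wick_phase z u 0 = cdot (z - u) u; last exact: r1.
by apply: eq_bigr => j _; rewrite !mxE subr0.
Qed.

(** The exponential growth of [F] costs half of the Gaussian [e^(-|u|^2 / 16)]. Uniformity for
    bounded [z] yields both absolute convergence and uniformly small tails. *)
Lemma seg_symbol_dom kappa k G F r : tame om G -> Aflat1 F -> exists2 K : R, 0 <= K &
  forall z u, cnorm z <= r -> cabs (Wick_integrand (seg_symbol kappa k G) F z u) <=
    K * expR (- (32^-1 * cnorm u ^+ 2)).
Proof.
move=> [eG [m m0 Gm]] [eF [r1 [C1 [r10 HF]]]].
have [K K0 HK] := shift_kernel_dom om_gt0 s_ge0 Cm_ge1 om_mod k m0 eG Gm `|r|.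
exists (kappa%:R * (K * (`|C1| * expR (8 * r1 ^+ 2)))) => [|z u zr].
  by rewrite !mulr_ge0 ?expR_ge0// ltW.
rewrite Wick_integrand_seg [leLHS]cabsM cabs_nat -[leRHS]mulrA; apply: ler_wpM2l => //.
rewrite [leLHS]cabsM.
have h1 : cabs (rem_kernel k G z 0 u) <= K * expR (- (16^-1 * cnorm u ^+ 2)).
  rewrite rem_kernelE; apply: HK; first exact: le_trans zr (ler_norm _).
    rewrite (_ : cnorm 0 = 0) ?normr_ge0// /cnorm big1 ?sqrtr0// => j _.
    by rewrite mxE cabs0 expr0n.
  by rewrite /rnorm normr0 normr_ge0.
have h2 : cabs (F u) <= `|C1| * (expR (8 * r1 ^+ 2) * expR (32^-1 * cnorm u ^+ 2)).
  apply: (le_trans (HF u)); apply: (@le_trans _ _ (`|C1| * expR (r1 * cnorm u))).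
    by apply: ler_wpM2r; [exact: expR_ge0|exact: ler_norm].
  by apply: ler_wpM2l; [exact: normr_ge0|exact: exp_growth_gauss].
apply: (le_trans (ler_pM (cabs_ge0 _) (cabs_ge0 _) h1 h2)).
have -> : expR (- (32^-1 * cnorm u ^+ 2)) =
    expR (- (16^-1 * cnorm u ^+ 2)) * expR (32^-1 * cnorm u ^+ 2).
  by rewrite -expRD; congr expR; lra.
have r2 (a b c e f : R) : a * b * (c * (e * f)) = a * (c * e) * (b * f) by ring.
by rewrite le_eqVlt r2 eqxx.
Qed.

Lemma cmeasurable_seg_symbol kappa k G F z : entire G -> entire F ->
  cmeasurable setT (fun t => Wick_integrand (seg_symbol kappa k G) F z (cV t)).
Proof.
move=> eG eF; have := cmeasurableM (cmeasurable_cst _ kappa%:R)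
  (cmeasurableM (cmeasurable_rem_kernel k z 0 eG) (cmeasurable_entire_cV eF)).
by apply: eq_cmeasurable => t _; rewrite Wick_integrand_seg.
Qed.

Lemma cintegrable_seg_symbol kappa k G F z : tame om G -> Aflat1 F ->
  cintegrable mu setT (fun t => Wick_integrand (seg_symbol kappa k G) F z (cV t)).
Proof.
move=> tG aF; have [K K0 HK] := seg_symbol_dom kappa k (cnorm z) tG aF.
apply: (cintegrable_dominated measurableT (cmeasurable_seg_symbol kappa k z tG.1 aF.1)
  (integrable_gaussZ0 K (_ : 0 < 32^-1))) => [|t _]; first by lra.
exact: HK.
Qed.

Lemma Wick_symbol_seg kappa k G : tame om G -> Wick_symbol (seg_symbol kappa k G).
Proof.
move=> tG; have [eG _] := tG; split=> [u|F aF].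
  have := (@entire_seg_int _ _ _ k G 0 (row_mx 1%:M 0) (diagpt u) (row_mx (- u) 0) eG).1.
  move=> /(entireZ kappa%:R)[+ _]; apply: eq_entire => z.
  rewrite /seg_symbol mulmx0 add0r mul_mx_row mulmx1 mulmx0 add_row_mx addr0//.
split=> [z|K cK e e0]; first exact: cintegrable_seg_symbol.
have [r Hr] := compact_cnorm_bounded cK.
have [K1 K10 HK1] := seg_symbol_dom kappa k r tG aF.
have [r' Hr'] := gauss_tail K10 e0; exists r' => z Kz.
have mf := measurable_cabs (cmeasurable_seg_symbol kappa k z tG.1 aF.1).
have /measurable_int gi := @integrable_gaussZ0 R d K1 32^-1 ltac:(lra).
have mD : measurable [set t | r' < cnorm (cV t)] := measurable_cnorm_gt r'.
apply: le_trans Hr'; apply: ge0_le_integral => //.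
- by move=> t _; rewrite lee_fin cabs_ge0.
- by apply/measurable_EFinP; exact: measurable_funTS.
- exact: measurable_funTS gi.
- by move=> t _; rewrite lee_fin; apply: HK1; exact: Hr.
Qed.

End WickSymbol.

(** * Unconditional sums over multi-indices *)

Section MultiIndexBoxes.

Definition mcons n (k : nat) (alpha : mindex n) : mindex n.+1 :=
  [ffun j : 'I_(1 + n) => match fintype.split j with inl _ => k | inr i => alpha i end].
Definition mhead n (alpha : mindex n.+1) : nat := alpha (lshift n ord0 : 'I_(1 + n)).
Definition mtail n (alpha : mindex n.+1) : mindex n :=
  [ffun i => alpha (rshift 1 i : 'I_(1 + n))].

Lemma mcons_l n k (alpha : mindex n) : mcons k alpha (lshift n ord0 : 'I_(1 + n)) = k.
Proof.
by rewrite ffunE; case: (@split_ordP 1 n) => // j /eqP; rewrite eq_lrshift.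
Qed.

Lemma mcons_r n k (alpha : mindex n) i : mcons k alpha (rshift 1 i : 'I_(1 + n)) = alpha i.
Proof.
rewrite ffunE; case: (@split_ordP 1 n) => j /eqP; first by rewrite eq_rlshift.
by rewrite eq_rshift => /eqP ->.
Qed.

Lemma mconsK n (alpha : mindex n.+1) : mcons (mhead alpha) (mtail alpha) = alpha.
Proof.
apply/ffunP => j; rewrite ffunE; case: (@split_ordP 1 n) => i ->.
  by rewrite (ord1 i).
by rewrite ffunE.
Qed.

Lemma mhead_mcons n k (alpha : mindex n) : mhead (mcons k alpha) = k.
Proof. exact: mcons_l. Qed.

Lemma mtail_mcons n k (alpha : mindex n) : mtail (mcons k alpha) = alpha.
Proof. by apply/ffunP => i; rewrite ffunE mcons_r. Qed.

Lemma mlen_mcons n k (alpha : mindex n) : mlen (mcons k alpha) = (k + mlen alpha)%N.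
Proof.
rewrite /mlen (@big_split_ord _ _ _ 1 n) big_ord1 mcons_l; congr (_ + _)%N.
by apply: eq_bigr => i _; rewrite mcons_r.
Qed.

(** Boxes rather than simplices [|alpha| <= N], because sums of products over a box factor into
    one-variable sums. *)
Fixpoint mbox n (N : nat) : seq (mindex n) :=
  match n with
  | 0 => [:: [ffun=> 0%N]]
  | n'.+1 => [seq mcons k alpha | k <- iota 0 N.+1, alpha <- mbox n' N]
  end.

Lemma mboxS n N :
  mbox n.+1 N = [seq mcons k alpha | k <- iota 0 N.+1, alpha <- mbox n N].
Proof. by []. Qed.

Lemma mem_mbox n N (alpha : mindex n) : (alpha \in mbox n N) = [forall j, alpha j <= N]%N.
Proof.
elim: n alpha => [|n IH] alpha.
  rewrite inE; transitivity true; last by apply/esym/forallP; case.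
  by apply/eqP/ffunP; case.
rewrite mboxS -[alpha]mconsK; apply/allpairsP/forallP.
  move=> [[k beta] [kN bN ->]] j; move: kN bN; rewrite mem_iota add0n ltnS IH.
  move=> /= kN /forallP bN; case: (@split_ordP 1 n j) => i ->; last by rewrite mcons_r.
  by rewrite (ord1 i) mcons_l.
move=> H; exists (mhead alpha, mtail alpha); split; last by [].
  by rewrite mem_iota add0n ltnS; have := H (lshift n ord0 : 'I_(1 + n)); rewrite mcons_l.
by rewrite IH; apply/forallP => i; have := H (rshift 1 i : 'I_(1 + n)); rewrite mcons_r.
Qed.

Lemma mbox_uniq n N : uniq (mbox n N).
Proof.
elim: n => // n IH; rewrite mboxS; apply: allpairs_uniq => //; first exact: iota_uniq.
move=> [k a] [k' a'] _ _ /= E.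
by rewrite -(mhead_mcons k a) -{2}(mtail_mcons k a) E mhead_mcons mtail_mcons.
Qed.

Lemma mlen_ge n (alpha : mindex n) j : (alpha j <= mlen alpha)%N.
Proof. by rewrite /mlen (bigD1 j)//= leq_addr. Qed.

Lemma notin_mbox n N (alpha : mindex n) : alpha \notin mbox n N -> (N < mlen alpha)%N.
Proof.
rewrite mem_mbox negb_forall => /existsP[j]; rewrite -ltnNge => /leq_trans; apply.
exact: mlen_ge.
Qed.

Lemma sum_mbox_prod (V : comPzSemiRingType) n N (f : 'I_n -> nat -> V) :
  \sum_(alpha <- mbox n N) \prod_j f j (alpha j) = \prod_j \sum_(k <- iota 0 N.+1) f j k.
Proof.
elim: n f => [|n IH] f; first by rewrite big_seq1 !big_ord0.
rewrite mboxS big_allpairs_dep.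
transitivity ((\sum_(k <- iota 0 N.+1) f (lshift n ord0 : 'I_(1 + n)) k) *
    \prod_(i < n) \sum_(k <- iota 0 N.+1) f (rshift 1 i : 'I_(1 + n)) k); last first.
  by rewrite [RHS](@big_split_ord _ _ _ 1 n) big_ord1.
rewrite -(IH (fun i => f (rshift 1 i))) mulr_suml.
apply: eq_bigr => k _; rewrite mulr_sumr; apply: eq_bigr => a _.
rewrite (@big_split_ord _ _ _ 1 n) big_ord1 mcons_l; congr (_ * _).
by apply: eq_bigr => i _; rewrite mcons_r.
Qed.

End MultiIndexBoxes.

(** * Unconditional convergence from geometric decay *)

Section UnconditionalSums.
Context {R : realType}.
Local Notation C := R[i].

Lemma sum_half_iota N : \sum_(k <- iota 0 N.+1) 2^-1 ^+ k = 2 - 2^-1 ^+ N :> R.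
Proof.
elim: N => [|N IH]; first by rewrite big_seq1 !expr0; lra.
by rewrite -[N.+2]addn1 iotaD big_cat IH big_seq1 add0n !exprS; move: (2^-1 ^+ N) => x /=; lra.
Qed.

Lemma sum_half_le n (J : seq (mindex n)) : uniq J ->
  \sum_(alpha <- J) 2^-1 ^+ mlen alpha <= 2 ^+ n :> R.
Proof.
move=> uJ; pose N := \max_(a <- J) mlen a.
have JN : {subset J <= mbox n N}.
  move=> a aJ; rewrite mem_mbox; apply/forallP => j.
  by apply: leq_trans (mlen_ge a j) _; rewrite /N; by apply: leq_bigmax_seq.
apply: (@le_trans _ _ (\sum_(alpha <- mbox n N) 2^-1 ^+ mlen alpha)).
  have [r pr] : exists r, perm_eq (mbox n N) (J ++ r).
    exists [seq a <- mbox n N | a \notin J]; apply: uniq_perm; first exact: mbox_uniq.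
      rewrite cat_uniq uJ filter_uniq ?mbox_uniq// andbT; apply/hasPn => a.
      by rewrite mem_filter => /andP[].
    move=> a; rewrite mem_cat mem_filter; case: (boolP (a \in J)) => //= /JN ->//.
  rewrite (perm_big _ pr) big_cat lerDl; apply: sumr_ge0 => a _.
  by rewrite exprn_ge0// invr_ge0.
have -> : \sum_(alpha <- mbox n N) 2^-1 ^+ mlen alpha =
    \sum_(alpha <- mbox n N) \prod_j 2^-1 ^+ (alpha j) :> R.
  by apply: eq_bigr => a _; rewrite -expr_sum.
rewrite (@sum_mbox_prod R n N (fun _ k => 2^-1 ^+ k)) prodr_const card_ord.
apply: lerXn2r; rewrite ?nnegrE//; first by apply: sumr_ge0 => k _; rewrite exprn_ge0// invr_ge0.
by rewrite sum_half_iota lerBlDr lerDl exprn_ge0// invr_ge0.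
Qed.

(** In [4^-|alpha| = 2^-|alpha| 2^-|alpha|] one factor ensures summability, and the other is at most
    [2^-N] outside the box. *)
Lemma sum_quarter_tail n (J : seq (mindex n)) N : uniq J ->
  (forall a, a \in J -> a \notin mbox n N) ->
  \sum_(alpha <- J) 4^-1 ^+ mlen alpha <= 2 ^+ n * 2^-1 ^+ N :> R.
Proof.
move=> uJ JN; apply: (@le_trans _ _ (\sum_(alpha <- J) 2^-1 ^+ mlen alpha * 2^-1 ^+ N)).
  rewrite big_seq [leRHS]big_seq; apply: ler_sum => a aJ.
  have -> : 4^-1 = 2^-1 * 2^-1 :> R by rewrite -invfM; congr (_^-1); lra.
  rewrite exprMn; apply: ler_wpM2l; first by rewrite exprn_ge0// invr_ge0.
  apply: ler_wiXn2l; rewrite ?invr_ge0// ?invf_le1//; last exact: ltnW (notin_mbox (JN a aJ)).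
  by rewrite ler1n.
by rewrite -mulr_suml; apply: ler_wpM2r; [rewrite exprn_ge0// invr_ge0|exact: sum_half_le].
Qed.

Lemma msumP n (u : mindex n -> C) (s : C) : msum_is u s <->
  forall e : R, 0 < e -> exists J0 : {fset mindex n}, forall J : {fset mindex n},
    (J0 `<=` J)%fset -> cabs (\sum_(a <- J) u a - s) <= e.
Proof.
have psE (J : {fset mindex n}) : partial_sum u J = \sum_(a <- J) u a by rewrite big_seq_fsetE.
have tF : Filter (@totally (mindex n)) by exact: totally_filter.
split=> [/cvgrPdist_le H e e0|H].
  have eC : 0 < e%:C by rewrite ltcR.
  have [J0 _ HJ] := H e%:C eC; exists J0 => J JJ.
  by have := HJ J JJ; rewrite /= psE normCE lecR -cabsN opprB.
apply/cvgrPdist_le => e /pos_real_complex[-> e0].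
have [J0 HJ] := H _ e0; exists J0 => // J JJ /=.
by rewrite psE normCE lecR -cabsN opprB; exact: HJ.
Qed.

Lemma msum_terms_bounded n (u : mindex n -> C) s : msum_is u s ->
  exists2 K : R, 0 < K & forall a, cabs (u a) <= K.
Proof.
move=> /msumP/(_ 1 ltr01)[J0 HJ].
exists (2 + \sum_(a <- J0) cabs (u a)) => [|a].
  by rewrite ltr_wpDr// sumr_ge0// => a _; exact: cabs_ge0.
have [aJ|aJ] := boolP (a \in J0).
  rewrite (big_fsetD1 a)//=; apply: (@le_trans _ _ (cabs (u a) + 0)); first by rewrite addr0.
  rewrite addrCA lerD2l addr_ge0// sumr_ge0// => b _; exact: cabs_ge0.
have h1 := HJ J0 (fsubset_refl _); have := HJ (a |` J0)%fset (fsubsetUr _ _).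
rewrite big_fsetU1//= => h2.
have -> : u a = (u a + \sum_(i <- J0) u i - s) - (\sum_(i <- J0) u i - s) by ring.
apply: (le_trans (cabsB _ _)); apply: (@le_trans _ _ (1 + 1)); first exact: lerD.
by rewrite lerDl sumr_ge0// => b _; exact: cabs_ge0.
Qed.

(** Geometric decay of the terms makes convergence along boxes unconditional: a finite set
    containing a large box adds to it only part of a small tail. *)
Lemma box_msum n (u : mindex n -> C) (s : C) (K : R) :
  (forall a, cabs (u a) <= K * 4^-1 ^+ mlen a) ->
  (forall e : R, 0 < e -> exists N0, forall N, (N0 <= N)%N ->
    cabs (\sum_(a <- mbox n N) u a - s) <= e) ->
  msum_is u s.
Proof.
move=> uK H; apply/msumP => e e0.
have K0 : 0 <= K by have := uK 0; rewrite /mlen big1 ?expr0 ?mulr1 => [/(le_trans (cabs_ge0 _))|j _]; rewrite ?ffunE.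
have e2 : 0 < e / 2 by rewrite divr_gt0.
have [N0 HN0] := H _ e2.
have [N1 HN1] : exists N, K * 2 ^+ n * 2^-1 ^+ N <= e / 2.
  by have [N hN] := geometric_small (K * 2 ^+ n) half_itv e2; exists N; exact/ltW/hN.
pose N := maxn N0 N1.
have HN1' : K * 2 ^+ n * 2^-1 ^+ N <= e / 2.
  apply: le_trans HN1; apply: ler_wpM2l; first by rewrite mulr_ge0// exprn_ge0.
  by apply: ler_wiXn2l; rewrite ?invr_ge0// ?invf_le1// ?ler1n// leq_maxr.
exists [fset a in mbox n N]%fset => J JN.
have pJ : perm_eq J (mbox n N ++ [seq a <- J | a \notin mbox n N]).
  apply: uniq_perm; first exact: fset_uniq.
    rewrite cat_uniq mbox_uniq filter_uniq ?fset_uniq// andbT; apply/hasPn => a.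
    by rewrite mem_filter => /andP[].
  move=> a; rewrite mem_cat mem_filter; case: (boolP (a \in mbox n N)) => //= aN.
  by apply: (fsubsetP JN); rewrite inE.
rewrite (perm_big _ pJ) big_cat /= addrAC.
apply: (le_trans (cabsD _ _)); rewrite -[leRHS](divfK (x:=2))//.
have -> : e / 2 * 2 = e / 2 + e / 2 by lra.
apply: lerD; first by apply: HN0; exact: leq_maxl.
apply: (le_trans (cabs_sum _ _ _)); apply: le_trans HN1'.
apply: (@le_trans _ _ (\sum_(a <- [seq a <- J | a \notin mbox n N]) K * 4^-1 ^+ mlen a)).
  by apply: ler_sum => a _; exact: uK.
rewrite -mulr_sumr -mulrA; apply: ler_wpM2l => //; apply: sum_quarter_tail.
  by rewrite filter_uniq// fset_uniq.
by move=> a; rewrite mem_filter => /andP[].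
Qed.

Lemma sum_quarter_le n (J : seq (mindex n)) : uniq J ->
  \sum_(alpha <- J) 4^-1 ^+ mlen alpha <= 2 ^+ n :> R.
Proof.
move=> uJ; apply: le_trans (sum_half_le uJ); apply: ler_sum => a _.
by apply: lerXn2r; rewrite ?nnegrE ?invr_ge0// lef_pV2 ?posrE// ler_nat.
Qed.

End UnconditionalSums.

(** * Power series in several variables *)

Section Taylor.
Context {R : realType}.
Local Notation C := R[i].
Local Notation leb := (@lebesgue_measure R).

(** Cauchy's integral for the [k]-th Taylor coefficient of [phi] at 0. *)
Definition circ_coef (phi : C -> C) (k : nat) : C :=
  cintegral leb `[0, 1] (fun v => (ecirc v)^-1 ^+ k * phi (ecirc v)).

Lemma circ_integrand_continuous (phi : C -> C) k : continuous phi ->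
  continuous (fun v : R => (ecirc v)^-1 ^+ k * phi (ecirc v)).
Proof.
move=> cphi; apply: ccontinuousM.
  by apply: ccontinuousX; exact: inv_ecirc_continuous.
exact: ccontinuous_comp (@ecirc_continuous R) cphi.
Qed.

Lemma cabs_circ_coef (phi : C -> C) k M : continuous phi ->
  (forall x, cabs x <= 1 -> cabs (phi x) <= M) -> cabs (circ_coef phi k) <= 2 * M.
Proof.
move=> cphi phiM.
have H t : 0 <= t <= 1 -> cabs ((ecirc t)^-1 ^+ k * phi (ecirc t)) <= M.
  move=> _; rewrite cabsM cabsX cabsV cabs_ecirc invr1 expr1n mul1r.
  by apply: phiM; rewrite cabs_ecirc.
have := cabs_cintegral_itv_le (@circ_integrand_continuous phi k cphi) ler01 H.
by rewrite subr0 mulr1.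
Qed.

Lemma Taylor_circle (phi : C -> C) M N z : (forall x, differentiable phi x) ->
  (forall x, cabs x <= 1 -> cabs (phi x) <= M) -> cabs z <= 4^-1 ->
  cabs (phi z - \sum_(k <- iota 0 N.+1) circ_coef phi k * z ^+ k) <= 4 * M * 2^-1 ^+ N.
Proof.
move=> dphi phiM z4.
have z1 : cabs z < 1 by apply: le_lt_trans z4 _; rewrite invf_lt1// ltr1n.
have cphi : continuous phi by move=> x; exact: differentiable_continuous (dphi x).
have mI : measurable (`[0, 1]%classic : set (measurableTypeR R)) by [].
have iK k : cintegrable leb `[0, 1] (fun v => z ^+ k * ((ecirc v)^-1 ^+ k * phi (ecirc v))).
  apply: (cintegrableZ mI); apply: continuous_cintegrable.
  exact: circ_integrand_continuous.
have SE : \sum_(k <- iota 0 N.+1) circ_coef phi k * z ^+ k =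
    cintegral leb `[0, 1] (fun v => \sum_(k <- iota 0 N.+1)
      z ^+ k * ((ecirc v)^-1 ^+ k * phi (ecirc v))).
  rewrite (cintegral_sum mI (iota 0 N.+1) iK); apply: eq_bigr => k _.
  rewrite mulrC; apply/esym; apply: (cintegralZ mI); apply: continuous_cintegrable.
  exact: circ_integrand_continuous.
have cker : continuous (fun v : R => phi (ecirc v) / (1 - z / ecirc v)).
  apply: ccontinuousM; last exact: circle_kernel_continuous.
  exact: ccontinuous_comp (@ecirc_continuous R) cphi.
have iker := continuous_cintegrable 0 1 cker.
have iS : cintegrable leb `[0, 1] (fun v => \sum_(k <- iota 0 N.+1)
    z ^+ k * ((ecirc v)^-1 ^+ k * phi (ecirc v))) by exact: (cintegrable_sum mI).
rewrite -(Cauchy_formula dphi z1) SE -(cintegralB mI iker iS).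
pose g (v : R) := (phi (ecirc v) / (1 - z / ecirc v)) * (z ^+ N.+1 * (ecirc v)^-1 ^+ N.+1).
have gE v : phi (ecirc v) / (1 - z / ecirc v) -
    \sum_(k <- iota 0 N.+1) z ^+ k * ((ecirc v)^-1 ^+ k * phi (ecirc v)) = g v.
  rewrite /g (geometric_kernel N.+1 (circle_kernel_neq0 v z1)).
  rewrite -[X in _ - X]/(\sum_(k <- iota 0 (N.+1 - 0)) z ^+ k * ((ecirc v)^-1 ^+ k * phi (ecirc v))).
  rewrite -/(index_iota 0 N.+1) big_mkord.
  have -> : \sum_(k < N.+1) z ^+ k * ((ecirc v)^-1 ^+ k * phi (ecirc v)) =
      phi (ecirc v) * \sum_(k < N.+1) (z / ecirc v) ^+ k.
    by rewrite mulr_sumr; apply: eq_bigr => k _; rewrite exprMn mulrA mulrC.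
  rewrite -(geometric_kernel N.+1 (circle_kernel_neq0 v z1)) -exprMn.
  rewrite {1}(geometric_kernel N.+1 (circle_kernel_neq0 v z1)) mulrDr addrAC subrr add0r.
  by rewrite -!mulrA; congr (_ * _); exact: mulrC.
have cg : continuous g.
  apply: ccontinuousM; first exact: cker.
  apply: ccontinuousM; first by move=> v; exact: cvg_cst.
  by apply: ccontinuousX; exact: inv_ecirc_continuous.
rewrite [X in cabs X](_ : _ = cintegral leb `[0, 1] g); last by apply: eq_cintegral => v _; exact: gE.
have M0 : 0 <= M := le_trans (cabs_ge0 _) (phiM 0 ltac:(by rewrite cabs0)).
have H t : 0 <= t <= 1 -> cabs (g t) <= 2 * M * 2^-1 ^+ N.
  move=> _; rewrite /g cabsM [cabs (phi _ / _)]cabsM cabsV [cabs (z ^+ _ * _)]cabsM.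
  rewrite !cabsX cabsV cabs_ecirc invr1 expr1n mulr1.
  have k1 := cabs_circle_kernel t z1.
  have k2 : (cabs (1 - z / ecirc t))^-1 <= 2.
    rewrite -[leRHS]invrK lef_pV2 ?posrE ?invr_gt0//.
      by apply: le_trans k1; lra.
    by apply: lt_le_trans k1; lra.
  have k3 : cabs z ^+ N.+1 <= 2^-1 ^+ N.
    apply: (@le_trans _ _ (2^-1 ^+ N.+1)).
      by apply: lerXn2r; rewrite ?nnegrE ?cabs_ge0 ?invr_ge0//; lra.
    by apply: ler_wiXn2l; rewrite ?invr_ge0// ?invf_le1// ler1n.
  apply: ler_pM; rewrite ?mulr_ge0 ?cabs_ge0 ?invr_ge0 ?exprn_ge0 ?cabs_ge0//.
  rewrite mulrC; apply: ler_pM; rewrite ?invr_ge0 ?cabs_ge0//.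
  by apply: phiM; rewrite cabs_ecirc.
have := cabs_cintegral_itv_le cg ler01 H; rewrite subr0 mulr1 => /le_trans; apply.
by rewrite !mulrA; lra.
Qed.

Lemma mpow_mcons n (w : 'rV[C]_(1 + n)) k (alpha : mindex n) :
  mpow (w : 'rV[C]_n.+1) (mcons k alpha) = w 0 (lshift n ord0) ^+ k * mpow (rsubmx w) alpha.
Proof.
rewrite /mpow (@big_split_ord _ _ _ 1 n) big_ord1 /= mcons_l; congr (_ * _).
by apply: eq_bigr => i _; rewrite mcons_r mxE.
Qed.

Definition line_l n (R0 : R) (w' : 'rV[C]_n) (l : C) : 'rV[C]_(1 + n) :=
  row_mx 0 w' + l *: row_mx (R0%:C)%:M 0.

Lemma line_lE n R0 (w' : 'rV[C]_n) l : line_l R0 w' l = row_mx (l * R0%:C)%:M w'.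
Proof.
rewrite /line_l scale_row_mx scaler0 add_row_mx add0r addr0.
by rewrite scale_scalar_mx.
Qed.

Lemma line_l_rnorm n (R0 : R) (w' : 'rV[C]_n) l : 0 <= R0 -> rnorm w' <= R0 -> cabs l <= 1 ->
  rnorm (line_l R0 w' l) <= R0.
Proof.
move=> R00 wR l1; rewrite line_lE; apply: rnorm_le => // j.
case: (@split_ordP 1 n j) => i ->.
  rewrite row_mxEl mxE (ord1 i) eqxx mulr1n cabsM cabsR ger0_norm//.
  by rewrite -[leRHS]mul1r ler_wpM2r.
by rewrite row_mxEr; exact: le_trans (cabs_le_rnorm _ _) wR.
Qed.

(** The Taylor coefficient in the first variable, rescaled by [R0], as a function of the remaining
    variables. *)
Definition slice_coef n (F : 'rV[C]_(1 + n) -> C) (R0 : R) (k : nat) (w' : 'rV[C]_n) : C :=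
  circ_coef (fun l => F (line_l R0 w' l)) k.

Lemma line_l_continuous n (F : 'rV[C]_(1 + n) -> C) R0 w' : entire F ->
  (forall l : C, differentiable (fun l => F (line_l R0 w' l)) l) /\
  continuous (fun l => F (line_l R0 w' l)).
Proof.
move=> eF; have d l := (@entire_line R (1 + n) F (row_mx 0 w') (row_mx (R0%:C)%:M 0) l eF).1.
by split=> // l; exact: differentiable_continuous (d l).
Qed.

Lemma entire_slice_coef n (F : 'rV[C]_(1 + n) -> C) R0 k : entire F ->
  entire (slice_coef F R0 k).
Proof.
move=> eF.
pose K (x : 'rV[C]_n) (v : R) := (ecirc v)^-1 ^+ k * F (line_l R0 x (ecirc v)).
have KE t : K^~ t = fun x => (ecirc t)^-1 ^+ k *
    F (x *m row_mx 0 1%:M + ecirc t *: row_mx (R0%:C)%:M 0).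
  by apply/funext => x; rewrite /K /line_l mul_mx_row mulmx0 mulmx1.
have mI : measurable (`[0, 1]%classic : set (measurableTypeR R)) by [].
have cK x : continuous (K x).
  exact: (@circ_integrand_continuous (fun l => F (line_l R0 x l)) k (line_l_continuous R0 x eF).2).
have mK x : cmeasurable (`[0, 1]%classic : set (measurableTypeR R)) (K x).
  exact: cintegrable_measurable (continuous_cintegrable 0 1 (cK x)).
have eK t : `[0, 1]%classic t -> entire (K^~ t).
  move=> _; rewrite KE.
  exact: (entireZ _ (entire_affine (row_mx 0 1%:M) (ecirc t *: row_mx (R0%:C)%:M 0) eF).1).1.
have domK r : exists2 M : measurableTypeR R -> R, leb.-integrable `[0, 1] (EFin \o M) &
    forall x t, rnorm x <= r -> `[0, 1]%classic t -> cabs (K x t) <= M t.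
  have [M M0 HM] := continuous_bounded (`|r| + `|R0|) (entire_continuous eF).
  exists (fun=> M); first exact: integrable_itv_cst.
  move=> x t xr _; rewrite /K cabsM cabsX cabsV cabs_ecirc invr1 expr1n mul1r; apply: HM.
  rewrite line_lE; apply: rnorm_le => [|j]; first by rewrite addr_ge0.
  case: (@split_ordP 1 n j) => i ->.
    rewrite row_mxEl mxE (ord1 i) eqxx mulr1n cabsM cabs_ecirc mul1r cabsR.
    by rewrite lerDr.
  rewrite row_mxEr; apply: (le_trans (cabs_le_rnorm _ _)); apply: (le_trans xr).
  by apply: (le_trans (ler_norm _)); rewrite lerDl.
exact: (entire_parametric mI mK eK domK).1.
Qed.

Lemma rV0_eq (w : 'rV[C]_0) : w = 0.
Proof. by apply/rowP; case. Qed.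

Lemma row_head_tail n (w : 'rV[C]_(1 + n)) :
  w = row_mx (w 0 (lshift n ord0))%:M (rsubmx w).
Proof.
rewrite -{1}[w]hsubmxK; congr row_mx.
by rewrite [LHS]mx11_scalar mxE.
Qed.

(** Induction on the number of variables: the coefficients of the expansion in the first variable
    are entire in the others and bounded by [2 M]. In the new constant [4 + 4 K], the 4 is the
    one-variable error; the coefficient errors add up to [K (2 M) 2^-N] times a geometric sum of at
    most 2. The coefficients obtained here may depend on [R0]. *)
Lemma Taylor_box n : exists2 K : R, 0 <= K &
  forall (F : 'rV[C]_n -> C) (R0 M : R), entire F -> 0 < R0 ->
  (forall w, rnorm w <= R0 -> cabs (F w) <= M) ->
  exists Fc : mindex n -> C,
    (forall a, cabs (Fc a) <= 2 ^+ n * M * R0^-1 ^+ mlen a) /\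
    forall w N, rnorm w <= R0 / 4 ->
      cabs (F w - \sum_(a <- mbox n N) Fc a * mpow w a) <= K * M * 2^-1 ^+ N.
Proof.
elim: n => [|n [K K0 IH]].
  exists 0 => // F R0 M eF R00 FM; exists (fun=> F 0); split=> [a|w N _].
    rewrite /mlen big_ord0 !expr0 mul1r mulr1; apply: FM.
    by rewrite /rnorm normr0 ltW.
  by rewrite big_seq1 /mpow big_ord0 mulr1 (rV0_eq w) subrr cabs0 !mul0r.
exists (4 + 4 * K) => [|F R0 M eF R00 FM]; first by rewrite addr_ge0// mulr_ge0.
have M0 : 0 <= M by apply: le_trans (cabs_ge0 _) (FM 0 _); rewrite /rnorm normr0 ltW.
have phiM (w' : 'rV[C]_n) l : rnorm w' <= R0 -> cabs l <= 1 -> cabs (F (line_l R0 w' l)) <= M.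
  by move=> wR l1; apply: FM; apply: line_l_rnorm => //; exact: ltW.
have FkM k (w' : 'rV[C]_n) : rnorm w' <= R0 -> cabs (slice_coef F R0 k w') <= 2 * M.
  move=> wR; apply: cabs_circ_coef; first exact: (line_l_continuous R0 w' eF).2.
  by move=> l; exact: phiM.
have [Fc HFc] := choice (fun k => IH _ R0 (2 * M) (entire_slice_coef R0 k eF) R00 (FkM k)).
exists (fun a => Fc (mhead a) (mtail a) * (R0%:C)^-1 ^+ mhead a); split=> [a|w N wR].
  rewrite cabsM cabsX cabsV cabsR (gtr0_norm R00).
  have -> : mlen a = (mhead a + mlen (mtail a))%N by rewrite -mlen_mcons mconsK.
  have := (HFc (mhead a)).1 (mtail a).
  move=> /(ler_wpM2r (_ : 0 <= R0^-1 ^+ mhead a)) H.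
  apply: (le_trans (H _)); first by rewrite exprn_ge0// invr_ge0 ltW.
  by rewrite le_eqVlt; apply/orP; left; apply/eqP; rewrite exprD exprS; ring.
have wE : w = line_l R0 (rsubmx (w : 'rV[C]_(1 + n))) (w 0 (lshift n ord0 : 'I_(1 + n)) / R0%:C).
  rewrite line_lE divfK; last by rewrite -[0]/(0%:C) (inj_eq (@complexI R)) gt_eqF.
  exact: row_head_tail.
set z := _ / R0%:C in wE; set w' := rsubmx _ in wE.
have w'R : rnorm w' <= R0 / 4.
  apply: rnorm_le => [|j]; first by rewrite divr_ge0// ltW.
  by rewrite mxE; exact: le_trans (cabs_le_rnorm _ _) wR.
have z4 : cabs z <= 4^-1.
  rewrite cabsM cabsV cabsR (gtr0_norm R00) ler_pdivrMr// mulrC.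
  exact: le_trans (cabs_le_rnorm _ _) wR.
have w'R1 : rnorm w' <= R0.
  by apply: (le_trans w'R); rewrite ler_pdivrMr// ler_peMr ?ler1n// ltW.
have h1 := Taylor_circle N (line_l_continuous R0 w' eF).1 (fun l => @phiM w' l w'R1) z4.
rewrite -wE in h1.
pose S k := \sum_(a <- mbox n N) Fc k a * mpow w' a.
have SE : \sum_(a <- mbox n.+1 N) Fc (mhead a) (mtail a) * (R0%:C)^-1 ^+ mhead a * mpow w a =
    \sum_(k <- iota 0 N.+1) S k * z ^+ k.
  rewrite mboxS big_allpairs_dep; apply: eq_bigr => k _; rewrite /S mulr_suml.
  apply: eq_bigr => a _; rewrite mhead_mcons mtail_mcons (mpow_mcons w) -/w' /z exprMn.
  by move: (Fc k a) (_ ^+ k) (_ ^+ k) (mpow w' a) => x1 x2 x3 x4; ring.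
rewrite SE.
have -> : F w - \sum_(k <- iota 0 N.+1) S k * z ^+ k =
    (F w - \sum_(k <- iota 0 N.+1) slice_coef F R0 k w' * z ^+ k) +
    \sum_(k <- iota 0 N.+1) (slice_coef F R0 k w' - S k) * z ^+ k.
  have -> : \sum_(k <- iota 0 N.+1) (slice_coef F R0 k w' - S k) * z ^+ k =
      \sum_(k <- iota 0 N.+1) slice_coef F R0 k w' * z ^+ k -
      \sum_(k <- iota 0 N.+1) S k * z ^+ k.
    by rewrite -sumrB; apply: eq_bigr => k _; rewrite mulrBl.
  by rewrite addrA subrK.
apply: (le_trans (cabsD _ _)).
have -> : (4 + 4 * K) * M * 2^-1 ^+ N = 4 * M * 2^-1 ^+ N + K * (2 * M) * 2^-1 ^+ N * 2 by ring.
apply: lerD; first exact: h1.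
apply: (le_trans (cabs_sum _ _ _)).
apply: (@le_trans _ _ (\sum_(k <- iota 0 N.+1) K * (2 * M) * 2^-1 ^+ N * 2^-1 ^+ k)).
  apply: ler_sum => k _; rewrite cabsM cabsX; apply: ler_pM; rewrite ?cabs_ge0 ?exprn_ge0 ?cabs_ge0//.
    exact: (HFc k).2.
  by apply: lerXn2r; rewrite ?nnegrE ?cabs_ge0 ?invr_ge0//; lra.
rewrite -mulr_sumr sum_half_iota; apply: ler_wpM2l.
  by rewrite !mulr_ge0// exprn_ge0// invr_ge0.
by rewrite lerBlDr lerDl exprn_ge0// invr_ge0.
Qed.

End Taylor.

(** * Uniqueness of coefficients; Taylor and exponential series on all of [C^n] *)

Section PowerSeries.
Context {R : realType}.
Local Notation C := R[i].

Lemma cabs_mpow_le n (w : 'rV[C]_n) (a : mindex n) : cabs (mpow w a) <= rnorm w ^+ mlen a.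
Proof.
rewrite /mpow cabs_prod /mlen -prodrXr; apply: ler_prod => j _.
rewrite cabs_ge0 cabsX /=; apply: lerXn2r; rewrite ?nnegrE ?cabs_ge0 ?rnorm_ge0//.
exact: cabs_le_rnorm.
Qed.

Lemma msum_sub n (u v : mindex n -> C) (s t : C) : msum_is u s -> msum_is v t ->
  msum_is (fun a => u a - v a) (s - t).
Proof.
move=> /msumP us /msumP vt; apply/msumP => e e0.
have e2 : 0 < e / 2 by rewrite divr_gt0.
have [J1 H1] := us _ e2; have [J2 H2] := vt _ e2.
exists (J1 `|` J2)%fset => J; rewrite fsubUset => /andP[/H1 h1 /H2 h2].
rewrite sumrB; have -> : \sum_(a <- J) u a - \sum_(a <- J) v a - (s - t) =
  (\sum_(a <- J) u a - s) - (\sum_(a <- J) v a - t) by ring.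
by apply: (le_trans (cabsB _ _)); lra.
Qed.

Lemma pow_weight_le (x x0 : R) (w0 W L : nat) : 0 < x -> x <= x0 -> x0 <= 1 ->
  (w0 <= W)%N -> (L <= W)%N -> x ^+ W <= (x / x0) ^+ w0 * x0 ^+ L.
Proof.
move=> x_gt0 xx0 x01 wW LW; have x00 : 0 < x0 by exact: lt_le_trans xx0.
have -> : x ^+ W = (x / x0) ^+ W * x0 ^+ W by rewrite -exprMn divfK ?gt_eqF.
have q0 : 0 <= x / x0 by rewrite divr_ge0// ltW.
apply: ler_pM; [exact: exprn_ge0|by apply: exprn_ge0; exact: ltW| |].
  by apply: ler_wiXn2l => //; rewrite ler_pdivrMr// mul1r.
by apply: ler_wiXn2l => //; exact: ltW.
Qed.

Definition digits n (b : nat) (a : mindex n) : nat := (\sum_(j < n) a j * b ^ j)%N.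

Lemma digits_inj n b (a a' : mindex n) : (forall j, a j < b)%N -> (forall j, a' j < b)%N ->
  digits b a = digits b a' -> a = a'.
Proof.
elim: n a a' => [|n IH] a a' ab ab' E; first by apply/ffunP; case.
have b0 : (0 < b)%N by apply: leq_trans (ab (lshift n ord0 : 'I_(1 + n))).
have dE (c : mindex n.+1) : digits b c = (mhead c + digits b (mtail c) * b)%N.
  rewrite /digits (@big_split_ord _ _ _ 1 n) big_ord1 /= expn0 muln1; congr (_ + _)%N.
  rewrite big_distrl; apply: eq_bigr => i _ /=; rewrite ffunE expnS; lia.
have h1 : mhead a = mhead a'.
  have : (digits b a %% b = digits b a' %% b)%N by rewrite E.
  by rewrite !dE ![(_ + _ * b)%N]addnC !modnMDl !modn_small//; [exact: ab'|exact: ab].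
rewrite -(mconsK a) -(mconsK a') h1; congr mcons; apply: IH.
- by move=> j; rewrite ffunE.
- by move=> j; rewrite ffunE.
- by move: E; rewrite !dE h1 => /addnI/eqP; rewrite eqn_pmul2r// => /eqP.
Qed.

(* The points x_j = x^(B + b^j) turn the series into a series in one small
   variable x whose lowest exponent is attained by a single multi-index. *)
Lemma msum_coef_eq0 n (a : mindex n -> C) (r0 : R) : 0 < r0 -> r0 <= 1 ->
  (forall x : 'I_n -> R, (forall j, 0 < x j <= r0) ->
    msum_is (fun al => a al * mpow (\row_j (x j)%:C) al) 0) ->
  forall al, a al = 0.
Proof.
move=> r00 r01 H al1; apply: contrapT => /eqP al1n.
have [K K0 HK] : exists2 K : R, 0 < K & forall al, cabs (a al) * r0 ^+ mlen al <= K.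
  have [|K K0 HK] := msum_terms_bounded (H (fun=> r0) _); first by move=> j; rewrite r00 lexx.
  exists K => // al; apply: le_trans (HK al); rewrite cabsM; apply: ler_wpM2l; first exact: cabs_ge0.
  rewrite /mpow cabs_prod /mlen -prodrXr; apply: ler_prod => j _.
  apply/andP; split; first by apply: exprn_ge0; exact: ltW.
  by rewrite mxE cabsX cabsR ger0_norm ?lexx//; exact: ltW.
have exm : exists k, `[< exists al, a al != 0 /\ mlen al = k >].
  by exists (mlen al1); apply/asboolP; exists al1.
case: (ex_minnP exm) => m /asboolP[al2 [al2n al2m]] m_min.
have exV : exists k, `[< exists al, [/\ a al != 0, mlen al = m & digits m.+1 al = k] >].
  by exists (digits m.+1 al2); apply/asboolP; exists al2.
case: (ex_minnP exV) => V0 /asboolP[al0 [al0n al0m al0V]] V_min.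
(* [W al] is the exponent of [x] in the monomial, with [B = V0 + 1] and [b = m + 1]. Weighting the
   degree by [V0 + 1] puts every degree above [m] beyond [W al0]; in degree [m] all entries are
   below [m + 1], so the digits in that base separate multi-indices. *)
pose W (al : mindex n) := (V0.+1 * mlen al + digits m.+1 al)%N.
have Wlt al : a al != 0 -> al != al0 -> (W al0 < W al)%N.
  move=> aln alal0; rewrite /W al0m al0V.
  have mal : (m <= mlen al)%N by apply: m_min; apply/asboolP; exists al.
  move: mal; rewrite leq_eqVlt => /orP[/eqP mE|mlt].
    rewrite -mE ltn_add2l ltn_neqAle; apply/andP; split; last first.
      by apply: V_min; apply/asboolP; exists al.
    apply: contra alal0 => /eqP VE; apply/eqP; apply: (@digits_inj _ m.+1).
    - by move=> j; rewrite ltnS mE mlen_ge.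
    - by move=> j; rewrite ltnS -al0m mlen_ge.
    - by rewrite -VE al0V.
  apply: (@leq_trans (V0.+1 * m.+1)%N); first by rewrite mulnS; lia.
  by apply: leq_trans (leq_addr _ _); rewrite leq_mul2l mlt orbT.
(* Boundedness of the terms at [x_j = r0] gives [cabs (a al) * x0 ^+ mlen al <= K * 4^-1 ^+ mlen
   al], which is summable; what is left of [x ^+ W al] yields one power of [x] more than the lowest
   term has. *)
pose x0 := r0 / 4; have x00 : 0 < x0 by exact: divr_gt0.
have x01 : x0 <= 1 by rewrite /x0; lra.
pose D := K * 2 ^+ n * x0^-1 ^+ (W al0).+1.
have D0 : 0 < D by rewrite !mulr_gt0 ?exprn_gt0 ?invr_gt0.
have key x : 0 < x -> x <= x0 -> cabs (a al0) <= D * x.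
  move=> x_gt0 xx0; have x1 : x <= 1 by exact: le_trans xx0 x01.
  pose p (j : 'I_n) := x ^+ (V0.+1 + m.+1 ^ j).
  have pr j : 0 < p j <= r0.
    rewrite exprn_gt0//=; apply: (@le_trans _ _ x).
      by rewrite -[leRHS]expr1; apply: ler_wiXn2l => //; exact: ltW.
    by apply: (le_trans xx0); rewrite /x0; lra.
  have pE al : mpow (\row_j (p j)%:C) al = (x ^+ W al)%:C.
    rewrite /mpow /W /digits /mlen; under eq_bigr do rewrite mxE -rmorphXn -exprM.
    rewrite -rmorph_prod; congr (_%:C); rewrite prodrXr; congr (_ ^+ _).
    rewrite big_distrr -big_split; apply: eq_bigr => j _.
    by rewrite /= mulnDl [(m.+1 ^ j * _)%N]mulnC.
  have /msumP Hp := H p pr.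
  have xW : 0 < x ^+ W al0 by rewrite exprn_gt0.
  suff : cabs (a al0) * x ^+ W al0 <= D * x * x ^+ W al0 by rewrite ler_pM2r.
  apply/ler_addgt0Pr => e e0; have [J0 HJ] := Hp e e0.
  have := HJ (al0 |` J0)%fset (fsubsetUr _ _).
  rewrite subr0 (big_fsetD1 al0) ?fset1U1//=; set J := (_ `\ al0)%fset => hs.
  have xq : 0 <= x / x0 by rewrite divr_ge0// ltW.
  have Kq : 0 <= K * (x / x0) ^+ (W al0).+1 by apply: mulr_ge0; [exact: ltW|exact: exprn_ge0].
  have tail : cabs (\sum_(al <- J) a al * mpow (\row_j (p j)%:C) al) <= D * x * x ^+ W al0.
    apply: (le_trans (cabs_sum _ _ _)).
    apply: (@le_trans _ _ (\sum_(al <- J) K * (x / x0) ^+ (W al0).+1 * 4^-1 ^+ mlen al)).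
      rewrite big_seq [leRHS]big_seq; apply: ler_sum => al alJ.
      have alal0 : al != al0 by move: alJ; rewrite in_fsetD1 => /andP[].
      rewrite cabsM pE cabsR ger0_norm; last by apply: exprn_ge0; exact: ltW.
      have [->|aln] := eqVneq (a al) 0.
        by rewrite cabs0 mul0r; apply: mulr_ge0 => //; rewrite exprn_ge0// invr_ge0.
      have := @pow_weight_le x x0 (W al0).+1 (W al) (mlen al) x_gt0 xx0 x01 (Wlt _ aln alal0).
      have LW : (mlen al <= W al)%N.
        by rewrite /W mulSn -addnA leq_addr.
      move=> /(_ LW)/(ler_wpM2l (cabs_ge0 (a al))) /le_trans; apply.
      have -> : x0 ^+ mlen al = r0 ^+ mlen al * 4^-1 ^+ mlen al by rewrite -exprMn.
      rewrite mulrCA -[leRHS]mulrA [leRHS]mulrCA; apply: ler_wpM2l.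
        exact: exprn_ge0.
      rewrite mulrA; apply: ler_wpM2r; last exact: HK.
      by rewrite exprn_ge0// invr_ge0.
    rewrite -mulr_sumr; apply: (@le_trans _ _ (K * (x / x0) ^+ (W al0).+1 * 2 ^+ n)).
      apply: ler_wpM2l; last exact: sum_quarter_le (fset_uniq _).
      exact: Kq.
    rewrite /D exprMn [x ^+ _.+1]exprS le_eqVlt; apply/orP; left; apply/eqP.
    by move: (x ^+ W al0) (x0^-1 ^+ (W al0).+1) => y1 y2; ring.
  have -> : cabs (a al0) * x ^+ W al0 = cabs (a al0 * mpow (\row_j (p j)%:C) al0).
    by rewrite cabsM pE cabsR ger0_norm// ltW.
  set X := a al0 * _ in hs *; set Y := \sum_(_ <- J) _ in hs tail.
  have -> : X = (X + Y) - Y by rewrite addrK.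
  by apply: (le_trans (cabsB _ _)); rewrite addrC; exact: lerD.
have a0 : 0 < cabs (a al0) by rewrite cabs_gt0.
pose x := Num.min x0 (cabs (a al0) / (2 * D)).
have x_gt0 : 0 < x by rewrite lt_min x00 divr_gt0// mulr_gt0.
have xx0 : x <= x0 by rewrite ge_min lexx.
have := key x x_gt0 xx0; apply/negP; rewrite -ltNge.
apply: (@le_lt_trans _ _ (D * (cabs (a al0) / (2 * D)))).
  by apply: ler_wpM2l; [exact: ltW|rewrite ge_min lexx orbT].
have -> : D * (cabs (a al0) / (2 * D)) = cabs (a al0) / 2 by field; rewrite gt_eqF.
by lra.
Qed.

Lemma Taylor_msum n (F : 'rV[C]_n -> C) (Fc : mindex n -> C) (K M R0 : R) (w : 'rV[C]_n) :
  0 < R0 -> rnorm w <= R0 / 4 ->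
  (forall a, cabs (Fc a) <= 2 ^+ n * M * R0^-1 ^+ mlen a) ->
  (forall N, cabs (F w - \sum_(a <- mbox n N) Fc a * mpow w a) <= K * M * 2^-1 ^+ N) ->
  (forall a, cabs (Fc a * mpow w a) <= 2 ^+ n * M * 4^-1 ^+ mlen a) /\
  msum_is (fun a => Fc a * mpow w a) (F w).
Proof.
move=> R00 wR HFc HF.
have term a : cabs (Fc a * mpow w a) <= 2 ^+ n * M * 4^-1 ^+ mlen a.
  rewrite cabsM; apply: (@le_trans _ _ (2 ^+ n * M * R0^-1 ^+ mlen a * (R0 / 4) ^+ mlen a)).
    apply: ler_pM; rewrite ?cabs_ge0//; apply: (le_trans (cabs_mpow_le _ _)).
    by apply: lerXn2r; rewrite ?nnegrE ?rnorm_ge0 ?divr_ge0// ltW.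
  by rewrite -mulrA -exprMn mulrA mulVf ?mul1r ?lexx// gt_eqF.
split=> //; apply: box_msum term _ => e e0.
have [N0 HN] := geometric_small (K * M) half_itv e0; exists N0 => N NN.
by rewrite -cabsN opprB; exact: le_trans (HF N) (ltW (HN N NN)).
Qed.

(** The coefficients of [Taylor_box] for a radius [R0] coincide with those for radius 1 by
    uniqueness near the origin, so a single family represents [F] everywhere and obeys the estimates
    of all radii. *)
Lemma Taylor n (F : 'rV[C]_n -> C) : entire F -> exists Fc : mindex n -> C,
  (forall w, msum_is (fun a => Fc a * mpow w a) (F w)) /\
  forall (R0 M : R), 1 <= R0 -> (forall w, rnorm w <= R0 -> cabs (F w) <= M) ->
    forall w a, rnorm w <= R0 / 4 -> cabs (Fc a * mpow w a) <= 2 ^+ n * M * 4^-1 ^+ mlen a.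
Proof.
move=> eF; have [K K0 HK] := @Taylor_box R n.
have [M1 M10 HM1] := continuous_bounded 1 (entire_continuous eF).
have [Fc [Fc1 Fc2]] := HK F 1 M1 eF ltr01 HM1.
have same R0 M Fc' : 1 <= R0 -> (forall a, cabs (Fc' a) <= 2 ^+ n * M * R0^-1 ^+ mlen a) ->
    (forall w N, rnorm w <= R0 / 4 ->
      cabs (F w - \sum_(a <- mbox n N) Fc' a * mpow w a) <= K * M * 2^-1 ^+ N) -> Fc' = Fc.
  move=> R01 Fc'1 Fc'2; apply/funext => al; apply/eqP; rewrite -subr_eq0; apply/eqP.
  move: al; apply: (@msum_coef_eq0 _ _ 4^-1) => [//||x xr]; first by lra.
  have w4 : rnorm (\row_j (x j)%:C : 'rV[C]_n) <= 1 / 4.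
    apply: rnorm_le => [|j]; first by lra.
    by have /andP[x0 x1] := xr j; rewrite mxE cabsR ger0_norm ?mul1r//; exact: ltW.
  have w4' : rnorm (\row_j (x j)%:C : 'rV[C]_n) <= R0 / 4.
    by apply: (le_trans w4); apply: ler_wpM2r => //; rewrite invr_ge0.
  have [_ s1] := @Taylor_msum n F Fc' K M R0 _ (lt_le_trans ltr01 R01) w4' Fc'1 (fun N => Fc'2 _ N w4').
  have [_ s2] := @Taylor_msum n F Fc K M1 1 _ ltr01 w4 Fc1 (fun N => Fc2 _ N w4).
  by have := msum_sub s1 s2; rewrite subrr; under eq_fun do rewrite -mulrBl.
have all_R R0 M : 1 <= R0 -> (forall w, rnorm w <= R0 -> cabs (F w) <= M) ->
    forall w, rnorm w <= R0 / 4 ->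
      (forall a, cabs (Fc a * mpow w a) <= 2 ^+ n * M * 4^-1 ^+ mlen a) /\
      msum_is (fun a => Fc a * mpow w a) (F w).
  move=> R01 FM w wR; have R00 := lt_le_trans ltr01 R01.
  have [Fc' [Fc'1 Fc'2]] := HK F R0 M eF R00 FM.
  rewrite -(same _ _ _ R01 Fc'1 Fc'2).
  exact: @Taylor_msum n F Fc' K M R0 w R00 wR Fc'1 (fun N => Fc'2 w N wR).
exists Fc; split=> [w|R0 M R01 FM w a wR]; last exact: (all_R R0 M R01 FM w wR).1.
pose R0 := 1 + 4 * rnorm w; have R01 : 1 <= R0 by rewrite lerDl mulr_ge0// rnorm_ge0.
have [M M0 HM] := continuous_bounded R0 (entire_continuous eF).
by apply: (all_R R0 M R01 HM w _).2; rewrite /R0; lra.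
Qed.

(** At the point [w] the radius [1 + 4 |w|] is used: the terms are then summable with an exponential
    factor in [|w|], which a Gaussian can absorb. *)
Lemma Taylor_growth n (F : 'rV[C]_n -> C) : Aflat1 F -> exists Fc : mindex n -> C,
  (forall w, msum_is (fun a => Fc a * mpow w a) (F w)) /\
  exists r K : R, [/\ 0 <= r, 0 <= K & forall w a,
    cabs (Fc a * mpow w a) <= K * expR (r * cnorm w) * 4^-1 ^+ mlen a].
Proof.
move=> [eF [r [C0 [r0 HF]]]]; have [Fc [Fs Fb]] := Taylor eF; exists Fc; split=> //.
exists (4 * (r * n%:R)), (2 ^+ n * (`|C0| * expR (r * n%:R))); split.
- by rewrite !mulr_ge0// ltW.
- by rewrite !mulr_ge0 ?exprn_ge0 ?expR_ge0.
move=> w a; pose R0 := 1 + 4 * rnorm w.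
have R01 : 1 <= R0 by rewrite lerDl mulr_ge0// rnorm_ge0.
have FM v : rnorm v <= R0 -> cabs (F v) <= `|C0| * expR (r * n%:R * R0).
  move=> vR; apply: (le_trans (HF v)).
  apply: (@le_trans _ _ (`|C0| * expR (r * cnorm v))).
    by apply: ler_wpM2r; [exact: expR_ge0|exact: ler_norm].
  apply: ler_wpM2l => //; rewrite ler_expR -mulrA; apply: ler_wpM2l; first exact: ltW.
  by apply: (le_trans (cnorm_le_rnorm v)); exact: ler_wpM2l.
have w4 : rnorm w <= R0 / 4 by rewrite /R0; lra.
apply: (le_trans (Fb R0 _ R01 FM w a w4)).
apply: ler_wpM2r; first by rewrite exprn_ge0// invr_ge0.
rewrite -!mulrA; apply: ler_wpM2l; first by rewrite exprn_ge0.
apply: ler_wpM2l => //; rewrite -expRD ler_expR.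
have rn : 0 <= r * n%:R by rewrite mulr_ge0// ltW.
have wc := rnorm_le_cnorm w.
rewrite (_ : r * (n%:R * R0) = r * n%:R + 4 * (r * n%:R) * rnorm w); last by rewrite /R0; ring.
rewrite (_ : 4 * (r * (n%:R * cnorm w)) = 4 * (r * n%:R) * cnorm w); last by ring.
by rewrite lerD2l; apply: ler_wpM2l => //; rewrite mulr_ge0.
Qed.

Lemma prod_cvg n (s : 'I_n -> nat -> R) (l : 'I_n -> R) :
  (forall j, s j @ \oo --> l j) -> (fun N => \prod_j s j N) @ \oo --> \prod_j l j.
Proof.
move=> sl; elim: (index_enum _) => [|j r IH].
  by under eq_fun do rewrite big_nil; rewrite big_nil; exact: cvg_cst.
by under eq_fun do rewrite big_cons; rewrite big_cons; apply: cvgM.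
Qed.

Lemma Aflat1_exp_sum n : Aflat1 (fun x : 'rV[C]_n => cexp (\sum_j x 0 j)).
Proof.
split; first by apply: entire_cexp; apply: entire_sum => j; exact: entire_coord.
exists (n.+1%:R), 1; split=> // z; rewrite mul1r cabs_cexp ler_expR.
apply: (le_trans (ler_norm _)); apply: (le_trans (Re_le_cabs _)); apply: (le_trans (cabs_sum _ _ _)).
apply: (@le_trans _ _ (\sum_(j < n) cnorm z)).
  by apply: ler_sum => j _; exact: le_trans (cabs_le_rnorm z j) (rnorm_le_cnorm z).
rewrite sumr_const card_ord -[leLHS]mulr_natl; apply: ler_wpM2r; first exact: cnorm_ge0.
by rewrite ler_nat.
Qed.

(* The Taylor coefficients of the exponential are identified at real points. *)
Lemma msum_exp_real n (x : 'I_n -> R) : (forall j, 0 < x j <= 4^-1) ->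
  msum_is (fun a => (mfact a)%:R^-1 * mpow (\row_j (x j)%:C) a)
    (cexp (\sum_j (\row_j (x j)%:C : 'rV[C]_n) 0 j)).
Proof.
move=> xr; have x0 j : 0 <= x j by have /andP[/ltW] := xr j.
have aE (a : mindex n) : (mfact a)%:R^-1 * mpow (\row_j (x j)%:C) a =
    (\prod_j ((x j) ^+ a j / (a j)`!%:R))%:C.
  transitivity (\prod_j (((a j)`!%:R)^-1 * (x j)%:C ^+ a j) : C).
    rewrite big_split /= /mfact natr_prod prodfV; congr (_ * _).
    by apply: eq_bigr => j _; rewrite mxE.
  rewrite rmorph_prod; apply: eq_bigr => j _.
  by rewrite rmorphM fmorphV rmorph_nat rmorphXn mulrC.
have sE : cexp (\sum_j (\row_j (x j)%:C : 'rV[C]_n) 0 j) = (\prod_j expR (x j))%:C.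
  have -> : \sum_j (\row_j (x j)%:C : 'rV[C]_n) 0 j = (\sum_j x j)%:C.
    by rewrite rmorph_sum; apply: eq_bigr => j _; rewrite mxE.
  rewrite -expR_sum /cexp /=.
  by rewrite cos0 sin0; apply: complex_ext; rewrite /= ?mulr1 ?mul0r ?mulr0 ?subr0 ?addr0.
rewrite sE; apply: (@box_msum _ _ _ _ 1) => [a|e e0].
  rewrite aE cabsR mul1r ger0_norm; last by apply: prodr_ge0 => j _; rewrite divr_ge0 ?exprn_ge0.
  rewrite /mlen -prodrXr; apply: ler_prod => j _; rewrite divr_ge0 ?exprn_ge0//=.
  rewrite ler_pdivrMr ?ltr0n ?fact_gt0//; apply: (@le_trans _ _ (4^-1 ^+ a j * 1)).
    by rewrite mulr1; apply: lerXn2r; rewrite ?nnegrE ?invr_ge0//; have /andP[] := xr j.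
  by apply: ler_wpM2l; [rewrite exprn_ge0// invr_ge0|rewrite ler1n fact_gt0].
have := @prod_cvg n (fun j N => series (exp_coeff (x j)) N.+1) (fun j => expR (x j)).
move=> /(_ _)/cvgrPdist_le H.
have {}H := H _ e e0.
case: H => [j|N0 _ HN].
  have := @is_cvg_series_exp_coeff R (x j); rewrite -(cvg_shiftS (series (exp_coeff (x j)))).
  exact.
exists N0 => N NN; have := HN N NN => /=; rewrite distrC.
have -> : \sum_(a <- mbox n N) (mfact a)%:R^-1 * mpow (\row_j (x j)%:C) a =
    (\sum_(a <- mbox n N) \prod_j (x j ^+ a j / (a j)`!%:R))%:C :> C.
  by rewrite rmorph_sum; apply: eq_bigr => a _; exact: aE.
rewrite -rmorphB cabsR.
rewrite (@sum_mbox_prod R n N (fun j k => x j ^+ k / k`!%:R)) /series /=.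
by under eq_bigr do rewrite /index_iota subn0.
Qed.

(** [Taylor_growth] for [e^(x_1 + ... + x_n)] supplies convergence and bounds at complex points;
    only the coefficients have to be identified, by comparison with the real exponential series. *)
Lemma msum_exp n : (forall x : 'rV[C]_n,
    msum_is (fun a => (mfact a)%:R^-1 * mpow x a) (cexp (\sum_j x 0 j))) /\
  exists r K : R, [/\ 0 <= r, 0 <= K & forall (x : 'rV[C]_n) a,
    cabs ((mfact a)%:R^-1 * mpow x a) <= K * expR (r * cnorm x) * 4^-1 ^+ mlen a].
Proof.
have [Fc [Fs [r [K [r0 K0 FK]]]]] := Taylor_growth (@Aflat1_exp_sum n).
have FcE a : Fc a = (mfact a)%:R^-1.
  apply/eqP; rewrite -subr_eq0; apply/eqP; move: a.
  apply: (@msum_coef_eq0 _ _ 4^-1) => [//||x xr]; first by lra.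
  have := msum_sub (Fs (\row_j (x j)%:C)) (msum_exp_real xr); rewrite subrr.
  by under eq_fun do rewrite -mulrBl.
split=> [x|]; first by have := Fs x; under eq_fun do rewrite FcE.
by exists r, K; split=> // x a; rewrite -FcE.
Qed.

End PowerSeries.

(** * The extended operator *)

Section Interchange.
Context {R : realType}.
Local Notation C := R[i].

Lemma msum_unique n (u : mindex n -> C) (s t : C) : msum_is u s -> msum_is u t -> s = t.
Proof.
move=> /msumP us /msumP ut; apply/eqP; rewrite -subr_eq0; apply/eqP/cabs_le_eps => e e0.
have e2 : 0 < e / 2 by rewrite divr_gt0.
have [J1 H1] := us _ e2; have [J2 H2] := ut _ e2.
have h1 := H1 (J1 `|` J2)%fset (fsubsetUl _ _); have h2 := H2 (J1 `|` J2)%fset (fsubsetUr _ _).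
set S := \sum_(_ <- _) _ in h1 h2; have -> : s - t = (S - t) - (S - s) by ring.
by apply: (le_trans (cabsB _ _)); lra.
Qed.

Lemma msum_single n (u : mindex n -> C) b : (forall a, a != b -> u a = 0) -> msum_is u (u b).
Proof.
move=> u0; apply/msumP => e e0; exists [fset b]%fset => J; rewrite fsub1set => bJ.
rewrite (big_fsetD1 b)//= big1_seq ?addr0 ?subrr ?cabs0 ?ltW// => a /andP[_].
by rewrite in_fsetD1 => /andP[/u0].
Qed.

Lemma msumZ n (u : mindex n -> C) (s c : C) : msum_is u s -> msum_is (fun a => c * u a) (c * s).
Proof.
move=> /msumP us; apply/msumP => e e0.
have c0 : 0 < cabs c + 1 by rewrite ltr_wpDl// cabs_ge0.
have [J0 H] := us _ (divr_gt0 e0 c0); exists J0 => J /H {}H.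
rewrite -mulr_sumr -mulrBr cabsM; apply: (@le_trans _ _ ((cabs c + 1) * (e / (cabs c + 1)))).
  by apply: ler_pM; rewrite ?cabs_ge0// lerDl.
by rewrite mulrCA mulfV ?mulr1 ?gt_eqF.
Qed.

Lemma msum_box_tail n (u : mindex n -> C) (s : C) (M : R) N : msum_is u s ->
  (forall a, cabs (u a) <= M * 4^-1 ^+ mlen a) ->
  cabs (\sum_(a <- mbox n N) u a - s) <= M * (2 ^+ n * 2^-1 ^+ N).
Proof.
move=> /msumP us uM.
have M0 : 0 <= M.
  by have := le_trans (cabs_ge0 _) (uM 0); rewrite pmulr_lge0// exprn_gt0// invr_gt0.
apply/ler_addgt0Pr => e e0; have [J0 HJ] := us e e0.
pose J := ([fset a in mbox n N] `|` J0)%fset.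
have := HJ J (fsubsetUr _ _).
have pJ : perm_eq J (mbox n N ++ [seq a <- J | a \notin mbox n N]).
  apply: uniq_perm; first exact: fset_uniq.
    rewrite cat_uniq mbox_uniq filter_uniq ?fset_uniq// andbT; apply/hasPn => a.
    by rewrite mem_filter => /andP[].
  move=> a; rewrite mem_cat mem_filter; case: (boolP (a \in mbox n N)) => //= aN.
  by rewrite /J in_fsetU inE /= aN.
rewrite (perm_big _ pJ) big_cat /=; set S := \sum_(_ <- mbox n N) _.
set T := \sum_(_ <- _) _ => hST.
have tail : cabs T <= M * (2 ^+ n * 2^-1 ^+ N).
  apply: (le_trans (cabs_sum _ _ _)).
  apply: (@le_trans _ _ (\sum_(a <- [seq a <- J | a \notin mbox n N]) M * 4^-1 ^+ mlen a)).
    by apply: ler_sum => a _; exact: uM.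
  rewrite -mulr_sumr; apply: ler_wpM2l => //; apply: sum_quarter_tail.
    by rewrite filter_uniq// fset_uniq.
  by move=> a; rewrite mem_filter => /andP[].
have -> : S - s = (S + T - s) - T by ring.
by apply: (le_trans (cabsB _ _)); rewrite addrC; exact: lerD.
Qed.

(** Outside the box [N] the series is at most [M t * (2 ^+ n * 2^-1 ^+ N)]. Integrating this
    explicit tail gives convergence along boxes, and [box_msum] makes it unconditional. *)
Lemma cintegral_msum {disp} {T : measurableType disp} (mu : {measure set T -> \bar R}) n
    (u : mindex n -> T -> C) (s : T -> C) (M : T -> R) :
  (forall a, cmeasurable setT (u a)) -> cmeasurable setT s ->
  mu.-integrable setT (EFin \o M) ->
  (forall a t, cabs (u a t) <= M t * 4^-1 ^+ mlen a) ->
  (forall t, msum_is (u ^~ t) (s t)) ->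
  msum_is (fun a => cintegral mu setT (u a)) (cintegral mu setT s).
Proof.
move=> mu_ ms iM uM us.
have iMZ (c : R) : mu.-integrable setT (EFin \o (fun t => M t * c)).
  have := integrableZl measurableT c iM; apply: eq_integrable => // t _ /=.
  by rewrite mulrC.
have IM (c : R) : \int[mu]_(t in setT) (M t * c) = (\int[mu]_(t in setT) M t) * c.
  by apply: RintegralZr.
have iu a : cintegrable mu setT (u a).
  by apply: (cintegrable_dominated measurableT (mu_ a) (iMZ (4^-1 ^+ mlen a))) => t _; exact: uM.
have uM0 t a : cabs (u a t) <= M t * 1.
  apply: (le_trans (uM a t)); have M0 : 0 <= M t.
    by have := le_trans (cabs_ge0 _) (uM 0 t); rewrite pmulr_lge0// exprn_gt0// invr_gt0.
  by apply: ler_wpM2l => //; rewrite exprn_ile1 ?invr_ge0// invf_le1// ler1n.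
have tail N t : cabs (\sum_(a <- mbox n N) u a t - s t) <= M t * (2 ^+ n * 2^-1 ^+ N).
  by apply: msum_box_tail (us t) _ => a; exact: uM.
have mS N : cmeasurable setT (fun t => \sum_(a <- mbox n N) u a t).
  exact: cmeasurable_sum.
have iS N : cintegrable mu setT (fun t => \sum_(a <- mbox n N) u a t).
  exact: (cintegrable_sum measurableT).
have is_ : cintegrable mu setT s.
  have iD : cintegrable mu setT (fun t => \sum_(a <- mbox n 0) u a t - s t).
    apply: (cintegrable_dominated measurableT (cmeasurableB (mS 0%N) ms) (iMZ _)) => t _.
    exact: tail.
  have -> : s = (fun t => \sum_(a <- mbox n 0) u a t - (\sum_(a <- mbox n 0) u a t - s t)).
    by apply/funext => t; rewrite opprB addrC subrK.
  exact: (cintegrableB measurableT (iS 0%N) iD).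
apply: (@box_msum _ _ _ _ (2 * \int[mu]_(t in setT) M t)) => [a|e e0].
  rewrite -mulrA -IM; apply: (cabs_cintegral_le measurableT (mu_ a) (iMZ _)) => t _; exact: uM.
set I := \int[mu]_(t in setT) M t.
have [N0 HN] := geometric_small (2 * (I * 2 ^+ n)) half_itv e0; exists N0 => N NN.
have <- : cintegral mu setT (fun t => \sum_(a <- mbox n N) u a t) =
    \sum_(a <- mbox n N) cintegral mu setT (u a) := cintegral_sum measurableT _ iu.
rewrite -(cintegralB measurableT (iS N) is_).
have := cabs_cintegral_le measurableT (cmeasurableB (mS N) ms) (iMZ _) (fun t _ => tail N t).
by rewrite IM => /le_trans; apply; have := ltW (HN N NN); rewrite -/I -!mulrA.
Qed.

End Interchange.

(** * The extended symbol: equality of operators and uniqueness *)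

Section WickOperator.
Context {R : realType} {d : nat}.
Local Notation C := R[i].
Local Notation Cd := 'rV[C]_d.
Local Notation C2d := 'rV[C]_(d + d).
Local Notation mu := (@lebesgue_tuple R (d + d)).
Local Notation cV := (@cV_of_tuple R d).

Context (om : 'rV[R]_(d + d) -> R) (s Cm : R).
Hypotheses (om_gt0 : forall x, 0 < om x) (s_ge0 : 0 <= s) (Cm_ge1 : 1 <= Cm)
  (om_mod : forall x y, om (x + y) <= Cm * om x * bracket y `^ s).
Context (kappa k : nat) (G : C2d -> C).
Hypothesis tG : tame om G.

(** Serves both the Taylor series of [F] and the expansion of [e^((u, w))] in powers of [conj w]:
    exponential growth of the terms is absorbed by the Gaussian of the Wick kernel. *)
Lemma msum_Op_int (h : mindex d -> Cd -> C) (H : Cd -> C) (r K : R) z :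
  (forall a, entire (h a)) -> entire H ->
  (forall u a, cabs (h a u) <= K * expR (r * cnorm u) * 4^-1 ^+ mlen a) ->
  (forall u, msum_is (h ^~ u) (H u)) ->
  msum_is (fun a => Op_int (seg_symbol kappa k G) (h a) z) (Op_int (seg_symbol kappa k G) H z).
Proof.
move=> eh eH hK hH; apply: msumZ.
have [eG [m m0 Gm]] := tG.
have [K1 K10 HK1] := shift_kernel_dom om_gt0 s_ge0 Cm_ge1 om_mod k m0 eG Gm (cnorm z).
have rem1 u : cabs (rem_kernel k G z 0 u) <= K1 * expR (- (16^-1 * cnorm u ^+ 2)).
  rewrite rem_kernelE; apply: HK1 => //.
    rewrite (_ : cnorm 0 = 0) ?cnorm_ge0// /cnorm big1 ?sqrtr0// => j _.
    by rewrite mxE cabs0 expr0n.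
  by rewrite /rnorm normr0 cnorm_ge0.
have K_ge0 : 0 <= K.
  have := le_trans (cabs_ge0 _) (hK 0 0); rewrite pmulr_lge0 ?exprn_gt0 ?invr_gt0//.
  by rewrite pmulr_lge0// expR_gt0.
pose K2 := kappa%:R * (K1 * (K * expR (8 * r ^+ 2))).
apply: (@cintegral_msum _ _ _ mu _ _ _ (fun t => K2 * expR (- (32^-1 * cnorm (cV t) ^+ 2)))).
- by move=> a; exact: cmeasurable_seg_symbol.
- exact: cmeasurable_seg_symbol.
- by apply: integrable_gaussZ0; lra.
- move=> a t; rewrite Wick_integrand_seg cabsM cabs_nat [cabs (_ * h a _)]cabsM.
  have h2 : cabs (h a (cV t)) <=
      K * (expR (8 * r ^+ 2) * expR (32^-1 * cnorm (cV t) ^+ 2)) * 4^-1 ^+ mlen a.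
    apply: (le_trans (hK _ _)); apply: ler_wpM2r; first by rewrite exprn_ge0// invr_ge0.
    by apply: ler_wpM2l => //; exact: exp_growth_gauss.
  have -> : expR (- (32^-1 * cnorm (cV t) ^+ 2)) =
      expR (- (16^-1 * cnorm (cV t) ^+ 2)) * expR (32^-1 * cnorm (cV t) ^+ 2).
    by rewrite -expRD; congr expR; lra.
  have r1 (q a1 a2 b1 b2 b3 b4 : R) :
    q * (a1 * (b1 * b2)) * (a2 * b3) * b4 = q * (a1 * a2 * (b1 * (b2 * b3) * b4)) by ring.
  rewrite [leRHS]r1; apply: ler_wpM2l => //.
  by apply: ler_pM (rem1 _) h2; exact: cabs_ge0.
- move=> t; rewrite Wick_integrand_seg.
  have := @msumZ R d (h ^~ (cV t)) _ (kappa%:R * rem_kernel k G z 0 (cV t)) (hH (cV t)).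
  have -> : (fun a => Wick_integrand (seg_symbol kappa k G) (h a) z (cV t)) =
      (fun a => kappa%:R * rem_kernel k G z 0 (cV t) * h a (cV t)).
    by apply/funext => a; rewrite Wick_integrand_seg mulrA.
  by rewrite mulrA.
Qed.

(* c(z, w) = pi^(-d) int b(z, u) e^((z - u, u - w)) du *)
Definition ext_symbol (x : C2d) : C := ((pi ^- d)%:C * kappa%:R) * kernel_int k G x.

Lemma Aflat1_mpow (a : mindex d) : Aflat1 (fun u : Cd => mpow u a).
Proof.
split; first exact: entire_mpow.
exists (mlen a).+1%:R, 1; split=> // z; rewrite mul1r expRM_natl exprS.
apply: (le_trans (cabs_mpow_le _ _)); apply: (@le_trans _ _ (1 * expR (cnorm z) ^+ mlen a)).
  rewrite mul1r; apply: lerXn2r; rewrite ?nnegrE ?rnorm_ge0 ?expR_ge0//.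
  apply: (le_trans (rnorm_le_cnorm z)); apply: le_trans (expR_ge1Dx _).
  by rewrite lerDr.
apply: ler_wpM2r; first by rewrite exprn_ge0// expR_ge0.
by apply: le_trans (expR_ge1Dx _); rewrite lerDl cnorm_ge0.
Qed.

Lemma Op_intZ (q : C) F z : Aflat1 F ->
  Op_int (seg_symbol kappa k G) (fun u => q * F u) z = q * Op_int (seg_symbol kappa k G) F z.
Proof.
move=> aF; rewrite /Op_int mulrCA; congr (_ * _).
have iF := cintegrable_seg_symbol om_gt0 s_ge0 Cm_ge1 om_mod kappa k z tG aF.
rewrite -(cintegralZ measurableT q iF); apply: eq_cintegral => t _.
by rewrite !Wick_integrand_seg !mulrA [_ * q]mulrC !mulrA.
Qed.

(** The phases satisfy [(z - u, u - w) + (z, w) = (z - u, u) + (u, w)]; the right-hand side is the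
    Wick phase plus the exponent of the function to which the operator is applied. *)
Lemma rem_kernel_exp z w u :
  rem_kernel k G z (cconj w) u * cexp (cdot z w) =
  rem_kernel k G z 0 u * cexp (\sum_j (\row_j (u 0 j * conjc (w 0 j)) : Cd) 0 j).
Proof.
rewrite /rem_kernel -[LHS]mulrA -[RHS]mulrA; congr (_ * _); rewrite -!cexpD; congr cexp.
rewrite /wick_phase /cdot -!big_split; apply: eq_bigr => j _ /=; rewrite !mxE.
by move: (z 0 j) (u 0 j) (conjc _) (conjc _) => z1 u1 u2 w1; ring.
Qed.

Lemma mpow_rowM (u w : Cd) a :
  mpow (\row_j (u 0 j * conjc (w 0 j))) a = mpow u a * mpow (cconj w) a.
Proof.
by rewrite /mpow -big_split; apply: eq_bigr => j _; rewrite !mxE exprMn.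
Qed.

Lemma cnorm_rowM (u w : Cd) :
  cnorm (\row_j (u 0 j * conjc (w 0 j))) <= cnorm w * cnorm u.
Proof.
rewrite -(@ler_pXn2r _ 2)// ?nnegrE ?mulr_ge0 ?cnorm_ge0// exprMn [cnorm u ^+ 2]cnorm_sqr.
rewrite [leLHS]cnorm_sqr mulr_sumr; apply: ler_sum => j _; rewrite mxE cabsM cabs_conj exprMn mulrC.
apply: ler_wpM2r; first exact: sqr_ge0.
apply: lerXn2r; rewrite ?nnegrE ?cabs_ge0 ?cnorm_ge0//.
exact: le_trans (cabs_le_rnorm w j) (rnorm_le_cnorm w).
Qed.

(** Exhibits the [k_alpha] of the extended symbol as [Op(b)] applied to monomials, a family that
    serves every [F] in [Op_eq_ext]. *)
Lemma Op_coef_expansion z w :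
  msum_is (fun a => Op_int (seg_symbol kappa k G) (fun u => mpow u a) z *
      mpow (cconj w) a / (mfact a)%:R)
    (untilde ext_symbol z w * cexp (cdot z w)).
Proof.
have [E1 [r [K [r0 K0 E2]]]] := @msum_exp R d.
pose row (u : Cd) : Cd := \row_j (u 0 j * conjc (w 0 j)).
pose h (a : mindex d) (u : Cd) : C := ((mfact a)%:R^-1 * mpow (cconj w) a) * mpow u a.
have hE a u : h a u = (mfact a)%:R^-1 * mpow (row u) a.
  by rewrite /h mpow_rowM -mulrA [mpow _ _ * mpow u a]mulrC.
pose H (u : Cd) : C := cexp (\sum_j row u 0 j).
have eH : entire H.
  apply: entire_cexp; apply: entire_sum => j; under eq_fun do rewrite mxE.
  by apply: entireM; [exact: entire_coord|exact: entire_cst].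
have eh a : entire (h a) by exact: (entireZ _ (entire_mpow a)).1.
have := @msum_Op_int h H (r * cnorm w) K z eh eH.
have hK u a : cabs (h a u) <= K * expR (r * cnorm w * cnorm u) * 4^-1 ^+ mlen a.
  rewrite hE; apply: (le_trans (E2 _ _)); apply: ler_wpM2r; first by rewrite exprn_ge0// invr_ge0.
  apply: ler_wpM2l => //; rewrite ler_expR -mulrA; apply: ler_wpM2l => //; exact: cnorm_rowM.
have hH u : msum_is (h ^~ u) (H u).
  have -> : h ^~ u = fun a => (mfact a)%:R^-1 * mpow (row u) a by apply/funext => a; exact: hE.
  exact: E1.
move=> /(_ hK hH).
have -> : (fun a => Op_int (seg_symbol kappa k G) (h a) z) =
    (fun a => Op_int (seg_symbol kappa k G) (fun u => mpow u a) z *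
      mpow (cconj w) a / (mfact a)%:R).
  apply/funext => a; rewrite (Op_intZ _ _ (Aflat1_mpow a)).
  have r1 (x1 x2 x3 : C) : x1 * x2 * x3 = x3 * x2 * x1 by ring.
  exact: r1.
have -> // : Op_int (seg_symbol kappa k G) H z = untilde ext_symbol z w * cexp (cdot z w).
rewrite /Op_int /untilde /ext_symbol /kernel_int row_mxKl row_mxKr.
have iK := cintegrable_kernel om_gt0 s_ge0 Cm_ge1 om_mod k z (cconj w) tG.
rewrite -!mulrA; congr (_ * _); rewrite mulrA [_ * cexp _]mulrC.
rewrite mulrA [_ * kappa%:R]mulrC -(cintegralZ measurableT _ iK).
apply: eq_cintegral => t _; rewrite Wick_integrand_seg -/(row (cV t)) /H -rem_kernel_exp.
by rewrite -[RHS]mulrA [cexp _ * _]mulrC.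
Qed.

Lemma Op_series (F : Cd -> C) : Aflat1 F -> exists Fc : mindex d -> C,
  (forall w, msum_is (fun a => Fc a * mpow w a) (F w)) /\
  forall z, msum_is (fun a => Fc a * Op_int (seg_symbol kappa k G) (fun u => mpow u a) z)
    (Op_int (seg_symbol kappa k G) F z).
Proof.
move=> aF; have [Fc [Fs [r [K [r0 K0 FK]]]]] := Taylor_growth aF.
exists Fc; split; [exact: Fs|move=> z]; have eF := aF.1.
have eh a : entire (fun u : Cd => Fc a * mpow u a) := (entireZ (Fc a) (entire_mpow a)).1.
have := @msum_Op_int (fun a u => Fc a * mpow u a) F r K z eh eF FK Fs.
suff -> : (fun a => Op_int (seg_symbol kappa k G) (fun u => Fc a * mpow u a) z) =
  (fun a => Fc a * Op_int (seg_symbol kappa k G) (fun u => mpow u a) z) by [].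
by apply/funext => a; rewrite (Op_intZ _ _ (Aflat1_mpow a)).
Qed.

Lemma Op_eq_ext : Op_eq (seg_symbol kappa k G) (untilde ext_symbol).
Proof.
move=> F aF; have [Fc [Fs Fo]] := Op_series aF.
exists Fc, (fun a z => Op_int (seg_symbol kappa k G) (fun u => mpow u a) z).
exact: And3 Fs Op_coef_expansion Fo.
Qed.

Lemma msum_coef_inj (u v : mindex d -> C) (f : Cd -> C) :
  (forall w, msum_is (fun a => u a * mpow w a) (f w)) ->
  (forall w, msum_is (fun a => v a * mpow w a) (f w)) -> u = v.
Proof.
move=> us vs; apply/funext => a; apply/eqP; rewrite -subr_eq0; apply/eqP; move: a.
apply: (@msum_coef_eq0 _ _ _ 1) => // x _.
have := msum_sub (us (\row_j (x j)%:C)) (vs (\row_j (x j)%:C)); rewrite subrr.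
by under eq_fun do rewrite -mulrBl.
Qed.

(** [Op_ext] provides coefficients that might differ from one [F] to another. For [F = u^a],
    uniqueness forces [Fc] to be the indicator of [a], so [kc a] is [Op(b)] at that monomial; the
    family [kc] is the same for all [F], being determined by [c]. *)
Lemma Op_eq_coefs (c : Cd -> Cd -> C) z w : Op_eq (seg_symbol kappa k G) c ->
  msum_is (fun a => Op_int (seg_symbol kappa k G) (fun u => mpow u a) z *
      mpow (cconj w) a / (mfact a)%:R)
    (c z w * cexp (cdot z w)).
Proof.
move=> bc.
have coef a : exists2 kc : mindex d -> Cd -> C,
    (forall z w, msum_is (fun al => (kc al z / (mfact al)%:R) * mpow w al)
      (c z (cconj w) * cexp (cdot z (cconj w)))) &
    forall z, kc a z = Op_int (seg_symbol kappa k G) (fun u => mpow u a) z.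
  have [Fc [kc [F1 F2 F3]]] := bc _ (Aflat1_mpow a).
  exists kc => [z' w'|z'].
    have := F2 z' (cconj w'); rewrite cconjK.
    suff -> : (fun al => kc al z' * mpow w' al / (mfact al)%:R) =
      (fun al => kc al z' / (mfact al)%:R * mpow w' al) by [].
    by apply/funext => al; rewrite mulrAC.
  have Fca : Fc = fun al => (al == a)%:R.
    apply: (msum_coef_inj F1) => w'.
    have := @msum_single R d (fun al => (al == a)%:R * mpow w' al) a.
    by rewrite eqxx mul1r; apply => al /negPf ->; rewrite mul0r.
  have h3 := F3 z'; rewrite Fca in h3.
  have h4 : msum_is (fun al => (al == a)%:R * kc al z') (kc a z').
    have := @msum_single R d (fun al => (al == a)%:R * kc al z') a.
    by rewrite eqxx mul1r; apply => al /negPf ->; rewrite mul0r.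
  exact: msum_unique h4 h3.
have [k0 k0c _] := coef 0.
have kE a z' : k0 a z' = Op_int (seg_symbol kappa k G) (fun u => mpow u a) z'.
  have [k1 k1c <-] := coef a.
  have /(congr1 (fun f => f a)) := msum_coef_inj (k0c z') (k1c z').
  by move=> /(congr1 (fun y => y * (mfact a)%:R)); rewrite !divfK// pnatr_eq0 -lt0n prodn_gt0// => j; rewrite fact_gt0.
have := k0c z (cconj w); rewrite cconjK.
suff -> : (fun al => k0 al z / (mfact al)%:R * mpow (cconj w) al) =
  (fun a => Op_int (seg_symbol kappa k G) (fun u => mpow u a) z *
      mpow (cconj w) a / (mfact a)%:R) by [].
by apply/funext => al; rewrite kE mulrAC.
Qed.

Lemma Op_eq_unique (c : Cd -> Cd -> C) : Op_eq (seg_symbol kappa k G) c ->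
  untilde ext_symbol = c.
Proof.
move=> bc; apply/funext => z; apply/funext => w.
apply: (mulIf (cexp_neq0 (cdot z w))).
have h1 := @Op_coef_expansion z w.
have h2 := @Op_eq_coefs c z w bc.
exact: msum_unique h1 h2.
Qed.

End WickOperator.

(** * From the analytic lemmas to the bounds of the theorem *)

Section Assembly.
Context {R : realType} {d : nat}.
Local Notation C := R[i].
Local Notation Cd := 'rV[C]_d.
Local Notation C2d := 'rV[C]_(d + d).

Lemma dzwZ beta gamma (q : C) (G : C2d -> C) : entire G ->
  dzw beta gamma (fun x => q * G x) = fun x => q * dzw beta gamma G x.
Proof.
move=> eG; rewrite /dzw; elim: (_ ++ _) => [|v r IH]; first by [].
rewrite -[LHS]/(pd v (pds r (fun x => q * G x))) IH; apply/funext => x.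
exact: (entireZ q (entire_pds r eG)).2.
Qed.

Lemma Ahat_untilde (G : C2d -> C) : entire G -> Ahat (untilde G).
Proof. by move=> eG; rewrite -[Ahat _]/(entire (tilde (untilde G))) untildeK. Qed.

Lemma Wick_boundZ rho om m (q : C) (g : Cd -> Cd -> C) :
  Wick_bound rho om m g -> Wick_bound rho om m (fun z w => q * g z w).
Proof.
move=> gb N N0; have [K HK] := gb N N0; exists (cabs q * K) => z w.
rewrite cabsM -!mulrA; apply: ler_wpM2l; first exact: cabs_ge0.
by have := HK z w; rewrite -!mulrA.
Qed.

Lemma Ahat_Sh_bound rho om (a : Cd -> Cd -> C) beta gamma : Ahat_Sh rho om a ->
  Wick_bound rho om (mlen beta + mlen gamma) (untilde (dzw beta gamma (tilde a))).
Proof.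
move=> [/entire_tilde ea Ha]; rewrite -dz_dwbar_untilde// tildeK -mlenD.
exact: Ha.
Qed.

(** On the diagonal the Gaussian factor is 1, [N = 0] is taken, and [<w + w> >= <w>] turns the
    bracket of the sum into that of [w]. *)
Lemma Wick_bound_diag rho (om : 'rV[R]_(d + d) -> R) m (G : C2d -> C) :
  0 <= rho -> (forall x, 0 < om x) -> Wick_bound rho om m (untilde G) ->
  exists K : R, forall w, cabs (G (diagpt w)) <=
    K * om (to_real ((Num.sqrt 2)%:C *: cconj w)) * cbracket w `^ (- (rho * m%:R)).
Proof.
move=> rho0 om0 Gb; have [K HK] := Gb 0 (lexx 0); exists `|K| => w.
have := HK w w; rewrite subrr -[untilde G w w]/(G (diagpt w)).
have -> : cnorm (0 : Cd) = 0.
  by rewrite /cnorm big1 ?sqrtr0// => j _; rewrite mxE cabs0 expr0n.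
rewrite expr0n mulr0 expR0 mulr1 oppr0 powRr0 mulr1 => /le_trans; apply.
set O := om _; have O0 : 0 <= O := ltW (om0 _).
apply: (@le_trans _ _ (`|K| * O * cbracket (w + w) `^ (- (rho * m%:R)))).
  apply: ler_wpM2r; first exact: powR_ge0.
  by apply: ler_wpM2r; [exact: O0|exact: ler_norm].
apply: ler_wpM2l; first exact: mulr_ge0.
have rm0 : 0 <= rho * m%:R by exact: mulr_ge0.
have := @powR_neg_le R (cbracket w) (cbracket (w + w)) _ 1 (cbracket_gt0 w) ltr01 rm0.
rewrite powR1 !mul1r; apply; rewrite -[leRHS]mul1r.
apply: cbracket_le => //; rewrite expr1n mul1r lerD2l.
rewrite -mulr2n -scaler_nat cnormZ cabs_nat ler_peMl ?sqr_ge0//; lra.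
Qed.

End Assembly.

Theorem proposition4p3 (R : realType) (d : nat) (rho : R)
    (om : 'rV[R]_(d + d) -> R) (a : 'rV[R[i]]_d -> 'rV[R[i]]_d -> R[i])
    (rho_ge0 : 0 <= rho) (rho_le1 : rho <= 1)
    (om_Sh : Shubin_weight rho om) (a_Sh : Ahat_Sh rho om a) :
  (forall alpha : mindex d, alpha != 0 ->
     Wick_symbol (remainder_symbol a alpha) /\
     exists c : 'rV[R[i]]_d -> 'rV[R[i]]_d -> R[i],
       unique (fun c => Ahat c /\ Op_eq (remainder_symbol a alpha) c) c /\
       forall beta gamma : mindex d,
         Wick_bound rho om (2 * mlen alpha + mlen (beta + gamma))
           (dz_dwbar beta gamma c)) /\
  (forall alpha beta gamma : mindex d, exists C : R, forall w,
     cabs (miter dz beta (miter dzbar gamma (diag_symbol a alpha)) w) <=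
       C * om (to_real ((Num.sqrt 2)%:C *: cconj w))
         * cbracket w `^ (- (rho * (2 * mlen alpha + mlen (beta + gamma))%:R))).
Proof.
have [[om_gt0 _ _ [Cm [s [Cm_ge1 s_ge0 om_mod]]]] _ _] := om_Sh.
have eT := entire_tilde a_Sh.1.
(* The order [2 |alpha|] arises because [alpha] is added to the multi-indices of both variables. *)
have bound alpha beta gamma : Wick_bound rho om (2 * mlen alpha + mlen (beta + gamma))
    (untilde (dzw beta gamma (dzw alpha alpha (tilde a)))).
  rewrite dzwD//; have := Ahat_Sh_bound (beta + alpha) (gamma + alpha) a_Sh.
  congr (Wick_bound _ _ _ _); rewrite !mlenD; lia.
have Tg alpha : dz_dwbar alpha alpha a = untilde (dzw alpha alpha (tilde a)).
  by rewrite -dz_dwbar_untilde// tildeK.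
split=> [alpha _|alpha beta gamma].
- pose G := dzw alpha alpha (tilde a).
  have eG : entire G by exact: entire_dzw.
  have aG : alg_tame om G.
    split=> // beta gamma; split; first exact: entire_dzw.
    exists (rho * (2 * mlen alpha + mlen (beta + gamma))%:R); first by rewrite mulr_ge0.
    exact: bound.
  have tG := alg_tame_tame aG.
  pose k := (mlen alpha).-1.
  have bE : remainder_symbol a alpha = seg_symbol (mlen alpha) k G.
    by apply/funext => z; apply/funext => u; exact: remainder_symbolE (Tg alpha).
  rewrite bE; split; first exact: (Wick_symbol_seg om_gt0 s_ge0 Cm_ge1 om_mod).
  have eK := entire_kernel_int om_gt0 s_ge0 Cm_ge1 om_mod k tG.
  have eE : entire (ext_symbol (mlen alpha) k G) := (entireZ _ eK).1.
  exists (untilde (ext_symbol (mlen alpha) k G)); split; first split.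
  + split; first exact: Ahat_untilde.
    exact: (Op_eq_ext om_gt0 s_ge0 Cm_ge1 om_mod).
  + by move=> c [_ bc]; exact: (Op_eq_unique om_gt0 s_ge0 Cm_ge1 om_mod tG bc).
  move=> beta gamma; rewrite dz_dwbar_untilde// dzwZ//.
  rewrite (dzw_kernel_int om_gt0 s_ge0 Cm_ge1 om_mod)//.
  apply: Wick_boundZ; have [eH _] := aG.2 beta gamma.
  apply: (kernel_int_bound om_gt0 s_ge0 Cm_ge1 om_mod k eH); first by rewrite mulr_ge0.
  exact: bound.
- have -> : diag_symbol a alpha = fun w => dzw alpha alpha (tilde a) (diagpt w).
    by apply/funext => w; rewrite /diag_symbol Tg.
  rewrite miter_diag; last exact: entire_dzw.
  exact: Wick_bound_diag (bound alpha beta gamma).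
Qed.
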